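(* Consider finite sequences (including the empty sequence) of moves from the set $\{m_e\}\cup\{m_{i,j}: i,j\ge 0\}$. To each such sequence associate the marked bipolar map obtained by starting from the initial structure (a single oriented edge, whose lower endpoint is the start vertex and whose upper endpoint is the active vertex) and successively applying the moves of the sequence by the sewing rules. This mapping from sequences of moves to marked bipolar maps is a bijection.
   Context: **Bipolar-oriented planar maps.** A planar map here is a finite connected planar graph $G$ without self-loops (multiple edges allowed), with two distinguished vertices, the south pole $S$ (bottom) and the north pole $N$ (top), incident to the same face, embedded in a closed disk with $S$ at the bottom and $N$ at the top of the boundary circle and all other vertices in the interior; maps are considered up to orientation-preserving homeomorphism (respecting all marked data). Within the disk there are two boundary faces, the western face $W$ and the eastern face $E$; all other faces are interior faces. A bipolar orientation is an acyclic orientation of the edges whose only source (vertex with no incoming edges) is $S$ and whose only sink (vertex with no outgoing edges) is $N$. Oriented edges are said to point north (upward). An upward (downward) edge of a vertex is an outgoing (incoming) edge. Each edge has a face on its west (left when facing north) and on its east. At every vertex other than the poles, the incident edges in cyclic order form one group of upward edges followed by one group of downward edges, so that upward and downward edges are each linearly ordered from west to east. The boundary of each interior face consists of two directed paths from its minimum vertex to its maximum vertex, its west side and its east side. The western (eastern) boundary of the map is the directed path from $S$ to $N$ bounding $W$ (bounding $E$). **Marked bipolar maps.** A marked bipolar map is a bipolar-oriented planar map together with a start vertex on its western boundary which is not at the top, and an active vertex on its eastern boundary which is not at the bottom, such that the start vertex and every vertex below it on the western boundary has at most one downward edge, and the active vertex and every vertex above it on the eastern boundary has at most one upward edge. The edges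 on the western boundary below the start vertex and on the eastern boundary above the active vertex are called missing. They are boundaries of (open) interior faces that are part of the map, i.e. each missing edge is incident to an interior face, but they are regarded as not themselves belonging to the structure. **Sewing rules.** Each move adds exactly one (non-missing) edge. - Move $m_e$: sew an edge to the current marked bipolar map upwards from the active vertex, and move the active vertex to the upper endpoint of this edge. If the eastern boundary has a vertex above the active vertex, the new edge is sewn to (identified with) the southernmost missing edge on the eastern boundary, which thereby becomes non-missing; otherwise there is a new vertex, which becomes the top vertex. - Move $m_{i,j}$ ($i,j\ge0$): first sew in an open face with $i+1$ edges on its west side and $j+1$ edges on its east side, by sewing the top of the face to the current active vertex and the west side of the face to the eastern boundary of the marked bipolar map (going down from the active vertex); then sew an edge to the southernmost edge of the east side of the new face; the new active vertex is the upper endpoint of this edge. The other edges of the east side of the new face are missing. If there are fewer than $i+1$ edges on the eastern boundary below the old active vertex, the west side of the new face is sewn to as many of them as there are, starting from the top; the remaining western edges of the face are missing edges on the western boundary of the map, and the start vertex is then no longer at the bottom. *)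

(* Defs.v *)
From mathcomp Require Import all_boot.

Set Implicit Arguments.
Unset Strict Implicit.
Unset Printing Implicit Defensive.

(** * Oriented combinatorial maps with marked vertices

    An oriented edge [e] consists of two darts: [(e, true)] sits at the tail
    of [e] and [(e, false)] at its head.  [rot d] is the next dart clockwise
    around the vertex carrying [d].  The map is drawn on the sphere; [outer] is
    some dart having on its left the face that contains the complement of the
    disk (see [face] below). *)
Record map_data := MapData {
  vertex : finType;
  edge : finType;
  tail : edge -> vertex;
  head : edge -> vertex;
  rot : edge * bool -> edge * bool;
  outer : edge * bool;
  south : vertex;
  north : vertex;
  start : vertex;
  active : vertex
}.

Definition dart (M : map_data) : finType := (edge M * bool)%type.

Definition vert (M : map_data) (d : dart M) : vertex M :=
  if d.2 then tail d.1 else head d.1.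

(** A dart [d] is also read as the left side of its edge, traversed away from
    [vert d].  [face] moves along a face boundary keeping the face on the left,
    so the orbits of [face] are the faces; [(e, true)] lies in the face to the
    west of [e] and [(e, false)] in the face to its east. *)
Definition face (M : map_data) (d : dart M) : dart M := rot (d.1, ~~ d.2).

Definition step (M : map_data) : rel (vertex M) :=
  fun u v => [exists e : edge M, (tail e == u) && (head e == v)].

Definition adjacent (M : map_data) : rel (vertex M) :=
  fun u v => step u v || step v u.

Definition on_outer (M : map_data) (d : dart M) : bool :=
  fconnect (@face M) (outer M) d.

(** The poles cut the outer face of the sphere into the faces [W] and [E] of the
    disk.  Both boundaries are directed from the south pole to the north pole,
    so the edges bounding [W] are those with the outer face on their west, and
    the edges bounding [E] those with the outer face on their east. *)
Definition west_edge (M : map_data) (e : edge M) : bool :=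
  @on_outer M (e, true).

Definition east_edge (M : map_data) (e : edge M) : bool :=
  @on_outer M (e, false).

Definition west_step (M : map_data) : rel (vertex M) :=
  fun u v => [exists e : edge M,
    [&& west_edge e, tail e == u & head e == v]].

Definition east_step (M : map_data) : rel (vertex M) :=
  fun u v => [exists e : edge M,
    [&& east_edge e, tail e == u & head e == v]].

Definition on_west (M : map_data) (v : vertex M) : bool :=
  [exists e : edge M, west_edge e && ((tail e == v) || (head e == v))].

Definition on_east (M : map_data) (v : vertex M) : bool :=
  [exists e : edge M, east_edge e && ((tail e == v) || (head e == v))].

Definition indegree (M : map_data) (v : vertex M) : nat :=
  #|[set e : edge M | head e == v]|.

Definition outdegree (M : map_data) (v : vertex M) : nat :=
  #|[set e : edge M | tail e == v]|.

(** Planarity is Euler's formula for a connected combinatorial map. *)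
Record planar_map (M : map_data) : Prop := PlanarMap {
  rot_inj : injective (@rot M);
  rot_vert : forall d d' : dart M, fconnect (@rot M) d d' = (vert d == vert d');
  no_loop : forall e : edge M, tail e != head e;
  connected : forall u v : vertex M, connect (@adjacent M) u v;
  euler : #|vertex M| + fcard (@face M) (dart M) = #|edge M| + 2
}.

Record bipolar (M : map_data) : Prop := Bipolar {
  bipolar_planar : planar_map M;
  poles_neq : south M != north M;
  south_outer : exists2 d : dart M, vert d = south M & on_outer d;
  north_outer : exists2 d : dart M, vert d = north M & on_outer d;
  acyclic : forall u v : vertex M, step u v -> ~~ connect (@step M) v u;
  sources : forall v : vertex M, (indegree v == 0) = (v == south M);
  sinks : forall v : vertex M, (outdegree v == 0) = (v == north M)
}.

Definition missing_west (M : map_data) (e : edge M) : bool :=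
  west_edge e && connect (@west_step M) (head e) (start M).

Definition missing_east (M : map_data) (e : edge M) : bool :=
  east_edge e && connect (@east_step M) (active M) (tail e).

Record marked_bipolar (M : map_data) : Prop := MarkedBipolar {
  marked_is_bipolar : bipolar M;
  start_west : on_west (start M);
  start_not_top : start M != north M;
  active_east : on_east (active M);
  active_not_bottom : active M != south M;
  below_start : forall v : vertex M,
    connect (@west_step M) v (start M) -> indegree v <= 1;
  above_active : forall v : vertex M,
    connect (@east_step M) (active M) v -> outdegree v <= 1;
  missing_interior : forall e : edge M, missing_west e || missing_east e ->
    exists b : bool, ~~ @on_outer M (e, b)
}.

(** Existence of an orientation-preserving homeomorphism respecting the
    orientation of the edges, the outer face and the marked vertices. *)
Definition isomorphic (M M' : map_data) : Prop :=
  exists (f : vertex M -> vertex M') (g : edge M -> edge M'),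
    let gd (d : dart M) : dart M' := (g d.1, d.2) in
    [/\ bijective f /\ bijective g,
        (forall e, tail (g e) = f (tail e)) /\
        (forall e, head (g e) = f (head e)),
        forall d, rot (gd d) = gd (rot d),
        on_outer (gd (outer M)) &
        [/\ f (south M) = south M', f (north M) = north M',
            f (start M) = start M' & f (active M) = active M']].

(** * Sewing

    The corner of a vertex immediately before a dart [c] (in clockwise order)
    is denoted by [c]; it lies in the face on the left of [c].  For an edge [e]
    of the eastern boundary, [(e, false)] is thus the eastern corner at the head
    of [e], and iterating [face] from there walks down the eastern boundary
    from corner to corner until the corner of the south pole. *)

Definition old (E : Type) (d : E * bool) : option E * bool := (Some d.1, d.2).

Definition old_rot (E : Type) (r : E * bool -> E * bool)
    (d : option E * bool) : option E * bool :=
  if d is (Some e, b) then old (r (e, b)) else d.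

Definition insert_before (D : eqType) (c n : D) (r : D -> D) (d : D) : D :=
  if r d == c then n else if r d == n then c else r d.

(** Adds, in the corner [c], an edge leading to a new vertex; the edge goes
    upwards from [vert c] if [b], downwards otherwise.  The last three arguments
    are the new south, north and active vertices ([None] being the new vertex).
    The outer face stays on both sides of the new edge when [c] is an outer
    corner, as is always the case below. *)
Definition add_leaf (M : map_data) (b : bool) (c : dart M)
    (s n a : option (vertex M)) : map_data :=
  @MapData (option (vertex M)) (option (edge M))
    (fun e => if e is Some e' then Some (tail e')
              else if b then Some (vert c) else None)
    (fun e => if e is Some e' then Some (head e')
              else if b then None else Some (vert c))
    (insert_before (old c) (None, b) (old_rot (@rot M)))
    (None, false)
    s n (Some (start M)) a.

(** Adds an edge upwards from the outer corner [c] to the outer corner [a],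
    with the outer face remaining on its east, and makes its upper endpoint
    active. *)
Definition add_chord (M : map_data) (c a : dart M) : map_data :=
  @MapData (vertex M) (option (edge M))
    (fun e => if e is Some e' then tail e' else vert c)
    (fun e => if e is Some e' then head e' else vert a)
    (insert_before (old a) (None, false)
       (insert_before (old c) (None, true) (old_rot (@rot M))))
    (None, false)
    (south M) (north M) (start M) (vert a).

(** Adds the east side, with [j.+1] edges, of a face whose bottom is at the
    corner [c] and whose top is at the corner [a]: first the [j] upper edges
    going down from the top, which are missing, then the southernmost edge. *)
Fixpoint sew_east (j : nat) (M : map_data) (c a : dart M) : map_data :=
  if j is j'.+1 then
    @sew_east j'
      (add_leaf false a (Some (south M)) (Some (north M)) (Some (active M)))
      (old c) (None, true)
  else add_chord c a.

(** Walks [k] edges down the eastern boundary from the corner [c], a new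
    (missing) edge being added below the south pole whenever the latter is
    reached; then adds the east side of the face. *)
Fixpoint sew_face (k j : nat) (M : map_data) (c a : dart M) : map_data :=
  if k is k'.+1 then
    if vert c == south M then
      @sew_face k' j (add_leaf false c None (Some (north M)) (Some (active M)))
        (None, true) (old a)
    else sew_face k' j (face c) a
  else sew_east j c a.

Definition set_active (M : map_data) (v : vertex M) : map_data :=
  @MapData (vertex M) (edge M) (@tail M) (@head M) (@rot M) (outer M)
    (south M) (north M) (start M) v.

(** [MoveE] is m_e and [MoveF i j] is m_{i,j}. *)
Inductive move := MoveE | MoveF of nat & nat.

(** The edges of the eastern boundary just above and just below the active
    vertex. *)
Definition edge_above (M : map_data) : option (edge M) :=
  [pick e : edge M | east_edge e && (tail e == active M)].

Definition edge_below (M : map_data) : option (edge M) :=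
  [pick e : edge M | east_edge e && (head e == active M)].

(** In a marked bipolar map [edge_below M] is never [None]. *)
Definition apply_move (M : map_data) (m : move) : map_data :=
  match m, edge_above M, edge_below M with
  | MoveE, Some e, _ => set_active (head e)
  | MoveE, None, Some e =>
      @add_leaf M true (e, false) (Some (south M)) None None
  | MoveF i j, _, Some e => @sew_face i.+1 j M (e, false) (e, false)
  | _, _, None => M
  end.

Definition single_edge : map_data :=
  @MapData bool unit (fun=> false) (fun=> true) id (tt, false)
    false true false true.

Definition map_of_moves (s : seq move) : map_data :=
  foldl apply_move single_edge s.

(* Main.v *)
Require Import Defs.
From mathcomp Require Import all_boot.

(* Euler's formula is used through a count of upward darts.  The dart following
   an upward dart clockwise around its vertex is either downward, and every
   vertex other than the poles has such a change, or upward, at a bottom corner of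
   the face between the two, and every face has such a corner (the bottom of the
   outer face being the south pole).  Euler's formula says that there are no
   others: every other vertex has one change and every face one bottom corner.
   These two local conditions are preserved by sewing an edge along an explicit
   list of outer darts, and by removing one.

   In a marked bipolar map, let [x] be the edge of the eastern boundary below
   the active vertex.  The last move can be read off at [x]: if the outer face is
   on both sides of [x], it was [m_e] with a new top vertex (or [x] is the initial
   edge); if [x] is not the bottom east edge of the face on its west, it was [m_e]
   along a missing edge; otherwise it was an [m_{i,j}] sewing that face, whose west
   and east sides give [i] and [j].  Undoing the move yields a smaller marked
   bipolar map, or the same map with fewer edges below the active vertex. *)

Set Implicit Arguments.
Unset Strict Implicit.
Unset Printing Implicit Defensive.

(** * Orbits of a permutation *)

(** Sewing changes the types of vertices and edges at every step, so maps built by different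
    sequences cannot be compared directly. States are therefore placed in one ambient oriented map:
    a set [A] of its edges, a rotation [r] and boundary lists, to which a map built by moves is
    related by an embedding.

    A move [m_{i,j}] is not atomic: between its elementary steps (walking down an edge, extending
    below the south pole, hanging a missing edge, closing by a chord) the structure need not be a
    marked bipolar map, since the lower end of a hanging path is a second source. The invariant
    [sewing] covers these states; [marking] is the case with no face under construction. Acyclicity
    is kept as an integer height increasing along edges, with an inequality ensuring that the
    closing chord will go upwards.

    For surjectivity the undone steps are redone inside the ambient map. For injectivity each
    undoing is shown to be determined by the ambient data alone, including the number of steps of
    each kind. *)

Section Iteration.
Variable T : finType.
Implicit Types (f : T -> T) (x y : T) (s : seq T).

Lemma fconnectP_iter f x y : fconnect f x y -> exists n, y = iter n f x.
Proof. by move=> /iter_findex <-; exists (findex f x y). Qed.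

Lemma fconnect_img (T' : finType) (p : T -> T') f (f' : T' -> T') :
  (forall x, fconnect f' (p x) (p (f x))) ->
  forall x y, fconnect f x y -> fconnect f' (p x) (p y).
Proof.
move=> pf x _ /fconnectP_iter [n ->]; elim: n => [|n IHn] //=.
exact: connect_trans IHn (pf _).
Qed.

Lemma fconnect_closed (P : pred T) f :
  (forall x, P x -> P (f x)) -> forall x y, fconnect f x y -> P x -> P y.
Proof.
by move=> Pf x _ /fconnectP_iter [n ->] Px; elim: n => //= n; apply: Pf.
Qed.

(** A discrete intermediate value principle. It supplies the passage from upward to downward darts
    around a vertex, and the bottom corner of a face. *)
Lemma fconnect_change (P : pred T) f x y :
  fconnect f x y -> P x -> ~~ P y ->
  exists z, [/\ fconnect f x z, P z & ~~ P (f z)].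
Proof.
move=> /fconnectP_iter [n ->] Px; elim: n => [|n IHn] /=; first by rewrite Px.
case Pn: (P (iter n f x)) => nP; last by apply: IHn; rewrite Pn.
by exists (iter n f x); rewrite fconnect_iter.
Qed.

Lemma fpath_avoid (P : pred T) f f' x s :
  (forall z, P (f z) -> f' z = f z) -> all P s -> fpath f x s -> fpath f' x s.
Proof.
move=> ff'; elim: s x => //= y s IHs x /andP[Py Ps] /andP[/eqP fx].
by move/(IHs _ Ps) => ->; rewrite ff' ?fx ?eqxx.
Qed.

Lemma fcycle_in f s x : injective f -> fcycle f s -> f x \in s -> x \in s.
Proof.
move=> f_inj cyc fxs; rewrite -(fconnect_cycle cyc fxs).
by rewrite fconnect_sym // fconnect1.
Qed.

Lemma fconnect_out f f' s x y :
  (forall z, z \notin s -> f z \notin s /\ f' z = f z) -> x \notin s ->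
  fconnect f x y -> y \notin s /\ fconnect f' x y.
Proof.
move=> ff' xs /fconnectP_iter [n ->]; clear y.
suff [ns e]: iter n f x \notin s /\ iter n f' x = iter n f x.
  by split; rewrite // -e fconnect_iter.
by elim: n => //= n [] /ff'[? e] ->.
Qed.

(** The orbit of an injective map of a finite type returns to its starting point. This excludes
    faces whose boundary only goes up or only goes down. *)
Lemma fconnect_increasing (h : T -> nat) f x : injective f ->
  (forall z, fconnect f x z -> h z < h (f z)) -> False.
Proof.
move=> f_inj lt_h.
have le n : h x + n <= h (iter n f x).
  elim: n => [|n IHn]; rewrite ?addn0 // addnS.
  by apply: leq_ltn_trans IHn (lt_h _ _); apply: fconnect_iter.
have := le (order f x); rewrite iter_order //.
by rewrite -[X in _ <= X]addn0 leq_add2l leqNgt order_gt0.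
Qed.

(** Cuts [n] out of its cycle and leaves it as a fixed point; this undoes [insert_before] when [n]
    was fixed beforehand. *)
Definition skip n f x := if x == n then n else if f x == n then f n else f x.

Lemma skip_inj n f : injective f -> injective (skip n f).
Proof.
move=> f_inj x y; rewrite /skip.
case: (x =P n) => [->|/eqP xn]; case: (y =P n) => [->|/eqP yn] //.
- case: (f y =P n) => [e en|e /esym]; last by move/e.
  by apply/f_inj; rewrite -en.
- case: (f x =P n) => [e en|e]; last by move/e.
  by apply/f_inj; rewrite en e.
case: (f x =P n) => [ex|nx]; case: (f y =P n) => [ey|ny].
- by move=> _; apply: f_inj; rewrite ex ey.
- by move/f_inj => e; rewrite e eqxx in yn.
- by move/f_inj => e; rewrite e eqxx in xn.
exact: f_inj.
Qed.

Lemma fconnect_skip n f x y : injective f -> x != n -> y != n ->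
  fconnect (skip n f) x y = fconnect f x y.
Proof.
move=> f_inj xn yn; apply/idP/idP.
  apply: (fconnect_img (p := id)) => z; rewrite /skip.
  case: eqP => [->|_]; first exact: connect0.
  case: (f z =P n) => [<-|_]; last exact: fconnect1.
  exact: (fconnect_iter f 2 z).
(* Collapsing [n] onto its successor maps orbits of [f] to orbits of [skip n f]. *)
pose p z := if z == n then f n else z.
have pf z : fconnect (skip n f) (p z) (p (f z)).
  rewrite /p; case: (z =P n) => [->|/eqP zn].
    by case: eqP => [e|_]; rewrite ?e; apply: connect0.
  have := fconnect1 (skip n f) z; rewrite {2}/skip (negbTE zn).
  by case: ifP.
by move/(fconnect_img pf); rewrite /p (negbTE xn) (negbTE yn).
Qed.

Lemma skip_insert c n f : injective f -> f n = n -> c != n ->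
  skip n (insert_before c n f) =1 f.
Proof.
move=> f_inj fn cn x; rewrite /skip /insert_before fn eqxx.
case: (x =P n) => [->|/eqP xn] //; rewrite [n == c]eq_sym (negbTE cn).
have fxn : f x != n by rewrite -fn (inj_eq f_inj).
case: (f x =P c) => [->|_]; first by rewrite eqxx.
by rewrite (negbTE fxn) (negbTE fxn).
Qed.

Lemma skip_fix n f : injective f -> f n = n -> skip n f =1 f.
Proof.
move=> f_inj fn x; rewrite /skip; case: eqP => [->|xn] //.
by case: eqP => [e|//]; case: xn; apply: f_inj; rewrite e.
Qed.

(** [insert_before c n f] is [f] followed by the transposition of [c] and [n]. *)
Lemma insert_inj (c n : T) f : injective f -> injective (insert_before c n f).
Proof.
move=> f_inj; apply: (inj_comp (f := insert_before c n id) _ f_inj).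
apply: inv_inj => x; rewrite /insert_before.
case: (x =P c) => [->|/eqP/negbTE xc]; first by rewrite eqxx; case: eqP.
by case: (x =P n) => [->|/eqP/negbTE xn]; rewrite ?eqxx ?xc ?xn.
Qed.

End Iteration.

(** * Rotations *)

Notation up e := (e, true).
Notation dn e := (e, false).

(* Submaps of a fixed oriented map: only the darts over a subset of [E] matter, so
   that edges can be added and removed without changing types. *)
Section Structure.
Variables (V E : finType) (tl hd : E -> V).
Implicit Types (d n c : E * bool) (D : {set E * bool}) (A : {set E}).
Implicit Types (r : E * bool -> E * bool) (e : E) (O X Y : seq (E * bool)).

Definition dart_vertex d : V := if d.2 then tl d.1 else hd d.1.
Local Notation vt := dart_vertex.
Definition rv d : E * bool := (d.1, ~~ d.2).
Definition fc r d : E * bool := r (rv d).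
Definition darts A : {set E * bool} := [set d | d.1 \in A].

Lemma rvK : involutive rv.
Proof. by case=> e b; rewrite /rv /= negbK. Qed.

Lemma fc_inj r : injective r -> injective (fc r).
Proof. by move=> r_inj d d' /r_inj /(can_inj rvK). Qed.

(* [vs_one]: going clockwise around a vertex there is at most one change from
   upward to downward edges. *)
Record vstruct D r : Prop := VStruct {
  vs_inj : injective r;
  vs_dom : forall d, (r d \in D) = (d \in D);
  vs_vt : forall d, d \in D -> vt (r d) = vt d;
  vs_orb : forall d d', d \in D -> d' \in D -> vt d = vt d' -> fconnect r d d';
  vs_one : forall d d', d \in D -> d' \in D -> vt d = vt d' ->
    d.2 -> d'.2 -> ~~ (r d).2 -> ~~ (r d').2 -> d = d'
}.

Lemma vs_conn D r d d' : vstruct D r -> d \in D -> fconnect r d d' ->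
  d' \in D /\ vt d' = vt d.
Proof.
move=> vs dD /fconnectP_iter [k ->]; elim: k => //= k [IH1 IH2].
by rewrite (vs_dom vs) (vs_vt vs).
Qed.

Lemma eq_vstruct D r r' : r =1 r' -> vstruct D r -> vstruct D r'.
Proof.
move=> rr' [vi vd vv vo v1]; split=> [d d'|d|d|d d'|d d'].
- by rewrite -!rr' => /vi.
- by rewrite -rr'.
- by rewrite -rr'; apply: vv.
- by rewrite -(eq_fconnect rr'); apply: vo.
by rewrite -!rr'; apply: v1.
Qed.

Lemma vs_skip D r n : vstruct D r -> n \in D -> vstruct (D :\ n) (skip n r).
Proof.
move=> vs nD; have ri := vs_inj vs.
(* A change seen at [d] once [n] is removed was at [n] if [n] is an upward dart following [d], and
   was already at [d] otherwise. *)
pose chg d := if (r d == n) && n.2 then n else d.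
have chgP d : d \in D :\ n -> d.2 -> ~~ (skip n r d).2 ->
    [/\ chg d \in D, (chg d).2, ~~ (r (chg d)).2 & vt (chg d) = vt d].
  rewrite !inE /skip /chg => /andP[/negbTE-> dD] d2.
  case: (r d =P n) => [e|_] //=; case n2: n.2 => //= rn2.
    by split=> //; rewrite -e (vs_vt vs).
  by split=> //; rewrite e n2.
split.
- exact: skip_inj.
- move=> d; rewrite !inE /skip; case: (d =P n) => [->|/eqP dn]; first by rewrite eqxx.
  case: (r d =P n) => [e|/eqP rn] /=; last by rewrite (negbTE rn) (vs_dom vs).
  rewrite (vs_dom vs) nD -(vs_dom vs d) e nD andbT.
  by apply: contra dn => /eqP e'; rewrite -(inj_eq ri) e e'.
- move=> d; rewrite !inE /skip => /andP[/negbTE-> dD].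
  by case: (r d =P n) => [e|_]; rewrite ?(vs_vt vs) // -e (vs_vt vs).
- move=> d d'; rewrite !inE => /andP[dn dD] /andP[dn' dD'] e.
  by rewrite fconnect_skip //; apply: (vs_orb vs).
move=> d d' dD dD' e d2 d2' s2 s2'.
have [aD a2 ra va] := chgP d dD d2 s2; have [bD b2 rb vb] := chgP d' dD' d2' s2'.
have := vs_one vs aD bD _ a2 b2 ra rb; rewrite va vb => /(_ e).
move: dD dD'; rewrite !inE => /andP[/eqP dn _] /andP[/eqP dn' _]; rewrite /chg.
case: ifP => [/andP[/eqP e1 _]|_]; case: ifP => [/andP[/eqP e2 _]|_] //; try congruence.
by move=> _; apply: ri; rewrite e1 e2.
Qed.

Lemma vs_single D r n : vstruct D r -> n \notin D -> r n = n ->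
  (forall d, d \in D -> vt d != vt n) -> vstruct (n |: D) r.
Proof.
move=> vs nD rn Dn; split.
- exact: vs_inj vs.
- move=> d; rewrite !inE (vs_dom vs); congr (_ || _).
  by rewrite -{1}rn (inj_eq (vs_inj vs)).
- by move=> d; rewrite !inE => /orP[/eqP->|/(vs_vt vs)]; rewrite ?rn.
- move=> d d'; rewrite !inE => /orP[/eqP->|dD] /orP[/eqP->|dD'].
  + by rewrite connect0.
  + by move/esym/eqP; rewrite (negbTE (Dn _ dD')).
  + by move/eqP; rewrite (negbTE (Dn _ dD)).
  exact: (vs_orb vs).
move=> d d'; rewrite !inE => /orP[/eqP->|dD] /orP[/eqP->|dD'] //.
- by move/esym/eqP; rewrite (negbTE (Dn _ dD')).
- by move/eqP; rewrite (negbTE (Dn _ dD)).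
exact: (vs_one vs).
Qed.

(** The new dart goes between [p] and [c]. With the direction of one of these neighbours it only
    lengthens an existing group; if all darts of the vertex have the opposite direction, it forms a
    group of its own. No second change arises in either case. *)
Lemma vs_insert D r n c p : vstruct D r -> n \notin D -> r n = n -> c \in D ->
  vt n = vt c -> r p = c ->
  [\/ c.2 = n.2, p.2 = n.2 | forall d, d \in D -> vt d = vt c -> d.2 = ~~ n.2] ->
  vstruct (n |: D) (insert_before c n r).
Proof.
move=> vs nD rn cD nc rp cond; have ri := vs_inj vs.
have cn : c != n by apply: contraNneq nD => <-.
have ii := @insert_inj _ c n r ri.
have pD : p \in D by rewrite -(vs_dom vs) rp.
have pn : p != n by apply: contraNneq nD => <-.
have vp : vt p = vt c by rewrite -rp (vs_vt vs).
have rD d : d \in D -> r d != n.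
  by move=> dD; apply: contraNneq nD => <-; rewrite (vs_dom vs).
have insn : insert_before c n r n = c.
  by rewrite /insert_before rn [n == c]eq_sym (negbTE cn) eqxx.
have insD d : d \in D -> insert_before c n r d = if d == p then n else r d.
  move=> dD; rewrite /insert_before -[d == p](inj_eq ri) rp.
  by rewrite (negbTE (rD d dD)).
have nND d : d \in D -> d == n = false.
  by move=> dD; apply: contraNF nD => /eqP <-.
split=> //.
- move=> d; rewrite !inE /insert_before.
  case: (r d =P c) => [e|/eqP nrc].
    by rewrite eqxx -(vs_dom vs d) e cD orbT.
  case: (r d =P n) => [e|/eqP nrn].
    by rewrite cD orbT -(inj_eq ri) e rn eqxx.
  by rewrite (negbTE nrn) (vs_dom vs) -(inj_eq ri) rn (negbTE nrn).
- move=> d; rewrite !inE => /orP[/eqP->|dD]; first by rewrite insn.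
  by rewrite insD //; case: eqP => [->|_]; rewrite ?nc ?vp ?(vs_vt vs).
- have conn d d' : d \in D -> d' \in D -> vt d = vt d' ->
      fconnect (insert_before c n r) d d'.
    move=> dD dD' e; rewrite -(fconnect_skip (n := n) ii) ?nND //.
    by rewrite (eq_fconnect (skip_insert ri rn cn)); apply: (vs_orb vs).
  have n_c : fconnect (insert_before c n r) n c by rewrite -{2}insn fconnect1.
  move=> d d'; rewrite !inE => /orP[/eqP->|dD] /orP[/eqP->|dD'] e.
  + exact: connect0.
  + by apply: connect_trans n_c (conn _ _ _ _ _); rewrite // -nc.
  + rewrite fconnect_sym //.
    by apply: connect_trans n_c (conn _ _ _ _ _); rewrite // -nc.
  exact: conn.
case: cond => [cn2|pn2|all2].
- move=> d d'; rewrite !inE => /orP[/eqP->|dD] /orP[/eqP->|dD'] //.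
  + by rewrite insn cn2 => _ -> _ /negP.
  + by rewrite insn cn2 => _ _ -> _ /negP.
  rewrite !insD // => e d2 d2'; case: eqP => [dp|_]; case: eqP => [dp'|_].
  + by rewrite dp dp'.
  + by rewrite -cn2 -rp -dp; apply: (vs_one vs).
  + by rewrite -cn2 -rp -dp'; apply: (vs_one vs).
  exact: (vs_one vs).
- have no d : d \in D -> d != p -> vt d = vt c -> d.2 -> ~~ (r d).2 -> n.2 -> c.2.
    move=> dD dp e d2 rd2 n2; apply: contraNT dp => c2.
    by apply/eqP; apply: (vs_one vs); rewrite ?vp ?pn2 ?rp.
  move=> d d'; rewrite !inE => /orP[/eqP->|dD] /orP[/eqP->|dD'] //.
  + rewrite insn insD // => e n2 d2' c2; case: eqP => [_|/eqP dp]; first by rewrite n2.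
    by move=> rd2; case/negP: c2; apply: (no _ dD' dp _ d2' rd2); rewrite // -e.
  + rewrite insn insD // => e d2 n2; case: eqP => [_|/eqP dp]; first by rewrite n2.
    by move=> rd2 /negP[]; apply: (no _ dD dp _ d2 rd2); rewrite // e.
  rewrite !insD // => e d2 d2'; case: eqP => [dp|_]; case: eqP => [dp'|_].
  + by rewrite dp dp'.
  + by rewrite -pn2 -dp d2.
  + by rewrite -pn2 -dp' d2'.
  exact: (vs_one vs).
case n2: n.2 in all2 *.
  move=> d d'; rewrite !inE => /orP[/eqP->|dD] /orP[/eqP->|dD'] //.
  - by move=> e _; rewrite all2 // -nc.
  - by move=> e; rewrite all2 // -nc.
  rewrite !insD // => e d2 d2'; case: eqP => [_|_]; first by rewrite n2.
  case: eqP => [_|_]; first by rewrite n2.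
  exact: (vs_one vs).
move=> d d'; rewrite !inE => /orP[/eqP->|dD]; first by rewrite n2.
move=> /orP[/eqP->|dD']; first by rewrite n2.
rewrite !insD // => e d2 d2'.
have nochg x : x \in D -> x != p -> x.2 -> ~~ (r x).2 -> vt x != vt c.
  move=> xD xp x2 rx2; apply: contra rx2 => /eqP e'.
  by rewrite all2 ?(vs_dom vs) ?(vs_vt vs).
case: eqP => [dp|/eqP dp]; case: eqP => [dp'|/eqP dp'].
- by rewrite dp dp'.
- by move=> _ H; have := nochg _ dD' dp' d2' H; rewrite -e dp vp eqxx.
- by move=> H _; have := nochg _ dD dp d2 H; rewrite e dp' vp eqxx.
exact: (vs_one vs).
Qed.

End Structure.

(** * The outer walk and the inner faces when one edge is added or removed *)

Section Core.
Variables (V E : finType) (tl hd : E -> V).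
Notation vt := (dart_vertex tl hd).
Notation vstruct := (vstruct tl hd).
Implicit Types (d n c : E * bool) (D : {set E * bool}) (A : {set E}).
Implicit Types (r : E * bool -> E * bool) (e : E) (O X Y s : seq (E * bool)).

(* [co_face]: an inner face has only one bottom corner, that is, one edge [e]
   such that [up e] is followed clockwise by an up dart, the face being on the
   east of [e]. *)
Record core A r O : Prop := Core {
  co_vs : vstruct (darts A) r;
  co_cyc : fcycle (fc r) O;
  co_uniq : uniq O;
  co_sub : forall d, d \in O -> d.1 \in A;
  co_face : forall e e', e \in A -> e' \in A ->
    (r (up e)).2 -> (r (up e')).2 -> dn e \notin O ->
    fconnect (fc r) (dn e) (dn e') -> e = e'
}.

Lemma core_rot A r X Y : core A r (X ++ Y) -> core A r (Y ++ X).
Proof.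
have eqXY : X ++ Y =i Y ++ X by move=> d; rewrite !mem_cat orbC.
case=> vs cyc un sub face; split=> //.
- by rewrite -rot_size_cat rot_cycle.
- by rewrite uniq_catC.
- by move=> d; rewrite -eqXY; apply: sub.
by move=> e e' ? ? ? ?; rewrite -eqXY; apply: face.
Qed.

Lemma darts1U A e b : darts (e |: A) = (e, b) |: ((e, ~~ b) |: darts A).
Proof.
by apply/setP=> -[x []]; rewrite !inE /= !xpair_eqE; case: b; rewrite ?andbT ?andbF ?orbF.
Qed.

Lemma darts1D A e b : darts (A :\ e) = darts A :\ (e, b) :\ (e, ~~ b).
Proof.
by apply/setP=> -[x []]; rewrite !inE /= !xpair_eqE; case: b; rewrite ?andbT ?andbF ?orbF.
Qed.

(* Faces avoiding the outer face are not affected by a modification of the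
   rotation that only takes place at outer corners. *)
Lemma face_out A A' r r' s O' e e' :
  (forall d, d \notin s ->
     [/\ fc r d \notin s, d \notin O' & fc r' d = fc r d]) ->
  (forall x, x \in A -> dn x \notin s -> x \in A') ->
  (forall e e', e \in A' -> e' \in A' ->
    (r' (up e)).2 -> (r' (up e')).2 -> dn e \notin O' ->
    fconnect (fc r') (dn e) (dn e') -> e = e') ->
  e \in A -> e' \in A -> (r (up e)).2 -> (r (up e')).2 -> dn e \notin s ->
  fconnect (fc r) (dn e) (dn e') -> e = e'.
Proof.
move=> sub AA' face' eA e'A re re' es conn.
have [] := @fconnect_out _ (fc r) (fc r') s (dn e) (dn e') _ es conn.
  by move=> z /sub[].
have [_ eO' fe] := sub _ es.
move=> e's conn'; apply: face' conn'; rewrite ?AA' //.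
  by rewrite -[r' (up e)]/(fc r' (dn e)) fe.
by have [_ _ fe'] := sub _ e's; rewrite -[r' (up e')]/(fc r' (dn e')) fe'.
Qed.

Lemma notin_cons2 (T : eqType) (x y z : T) (s : seq T) :
  x \notin y :: z :: s -> [/\ x != y, x != z & x \notin s].
Proof. by rewrite !in_cons !negb_or => /and3P[]. Qed.

Lemma last_cycle (T : finType) (f : T -> T) x (s : seq T) :
  fcycle f (x :: s) -> fpath f x s /\ f (last x s) = x.
Proof. by rewrite /= rcons_path => /andP[? /eqP]. Qed.

Lemma cycle_cons (T : finType) (f : T -> T) x (s : seq T) :
  fpath f x s -> f (last x s) = x -> fcycle f (x :: s).
Proof. by move=> fs fx; rewrite /= rcons_path fs /= fx eqxx. Qed.

(** Both sides of the new edge are outer, so the outer walk runs along it and back before resuming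
    at [c]. Face successors change only at outer darts and at the new edge, so [face_out] takes care
    of the inner faces. *)
Lemma core_leaf A r c X e b p : core A r (c :: X) -> e \notin A ->
  (forall b', r (e, b') = (e, b')) -> vt (e, b) = vt c ->
  (forall d, d.1 \in A -> vt d != vt (e, ~~ b)) -> r p = c ->
  [\/ c.2 = b, p.2 = b | forall d, d.1 \in A -> vt d = vt c -> d.2 = ~~ b] ->
  core (e |: A) (insert_before c (e, b) r) ((e, b) :: (e, ~~ b) :: c :: X).
Proof.
case=> vs cyc un sub face eA re vec new rp cond.
have ri := vs_inj vs; pose n := (e, b); pose m := (e, ~~ b).
have nX d : d.1 \notin A -> d \notin c :: X by apply: contra => /sub.
have cA : c.1 \in A by rewrite sub ?mem_head.
have cn : c != n by apply/eqP=> ec; move: eA; rewrite -[e]/(n.1) -ec cA.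
have cm : c != m by apply/eqP=> ec; move: eA; rewrite -[e]/(m.1) -ec cA.
have nm : n != m by rewrite xpair_eqE eqxx; case: (b).
have r'i : injective (insert_before c n r) by apply: insert_inj.
have fcE d : d != n -> d != m -> fc r d != c ->
    fc (insert_before c n r) d = fc r d.
  move=> dn dm dc; rewrite /fc /insert_before (negbTE dc : _ == _ = _).
  case: eqP => // /esym ed; case/eqP: dm; apply: (can_inj (@rvK E)).
  by apply: ri; rewrite -ed -[r _]/(r (e, ~~ ~~ b)) negbK re.
have fcn : fc (insert_before c n r) n = m.
  rewrite /fc /insert_before (_ : rv n = m) // re.
  by rewrite [m == c]eq_sym (negbTE cm) [m == n]eq_sym (negbTE nm).
have fcm : fc (insert_before c n r) m = c.
  rewrite /fc /insert_before (_ : rv m = n); last by rewrite /rv /= negbK.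
  by rewrite re [_ == c]eq_sym (negbTE cn) eqxx.
have [pth lst] := last_cycle cyc.
have cyc' : fcycle (fc (insert_before c n r)) (n :: m :: c :: X).
  apply: cycle_cons => /=.
    rewrite fcn fcm !eqxx /=; apply: fpath_avoid pth => [|].
      instantiate (1 := fun d => d \in X) => /= d fX; apply: fcE.
      - apply: contraTneq fX => ->; rewrite /fc /rv /= re.
        by have := nX m eA; rewrite inE negb_or => /andP[].
      - apply: contraTneq fX => ->; rewrite /fc /rv /= re negbK.
        by have := nX n eA; rewrite inE negb_or => /andP[].
      by apply: contraTneq fX => ->; move: un => /= /andP[].
    exact/allP.
  by rewrite -[LHS]/(insert_before c n (fc r) (last c X)) /insert_before lst eqxx.
split=> //.
- rewrite (darts1U _ _ b); apply: (@vs_insert _ _ _ _ _ _ _ _ p) => //.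
  + apply: vs_single => //; first by rewrite inE.
    by move=> d; rewrite inE => /new.
  + by rewrite !inE negb_or nm.
  + by rewrite !inE cA orbT.
  case: cond => [->|->|H]; [by apply: Or31|by apply: Or32|apply: Or33].
  move=> d; rewrite !inE => /orP[/eqP->|] //; last exact: H.
- rewrite /= inE negb_or nm -/m; move: un => /= ->; rewrite andbT.
  by rewrite -!/(_ \in c :: X); move: (nX n eA) (nX m eA); rewrite /= => -> ->.
- move=> d; rewrite !in_cons => /or3P[/eqP->|/eqP->|/sub dA].
  + by rewrite !inE eqxx.
  + by rewrite !inE eqxx.
  by rewrite !inE dA orbT.
move=> e1 e2 e1A e2A u1 u2 e1O.
have Asub d : d \notin [:: n, m, c & X] -> [/\ fc (insert_before c n r) d \notin [:: n, m, c & X],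
    d \notin c :: X & fc r d = fc (insert_before c n r) d].
  move=> dO; split; first by apply: contra dO; apply: fcycle_in; [apply: fc_inj|].
    by have [] := notin_cons2 dO.
  have [dn dm dX] := notin_cons2 dO.
  rewrite fcE //; apply: contra dX => /eqP dc.
  by apply: (fcycle_in (fc_inj ri) cyc); rewrite dc mem_head.
apply: (face_out Asub _ face e1A e2A u1 u2 e1O) => x.
rewrite in_setU1 => /orP[/eqP->|//]; rewrite /n /m.
by case: (b); rewrite !in_cons eqxx ?orbT.
Qed.

Lemma core_unleaf A r c X e b :
  core A r ((e, b) :: (e, ~~ b) :: c :: X) ->
  core (A :\ e) (skip (e, b) r) (c :: X).
Proof.
case=> vs cyc un sub face; have ri := vs_inj vs.
pose n := (e, b); pose m := (e, ~~ b).
have rvm : rv m = n by rewrite /rv /= negbK.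
have [/= /and3P[/eqP fn /eqP fm pth] lst] := last_cycle cyc.
rewrite -/n -/m in fn fm lst cyc un sub face *.
have rm : r m = m by rewrite -{2}fn.
have rn : r n = c by rewrite -fm /fc rvm.
have [nO mO unX] : [/\ n \notin c :: X, m \notin c :: X & uniq (c :: X)].
  by move: un; rewrite !cons_uniq in_cons negb_or => /and3P[/andP[_ ->] -> ->].
have ne d : d \in c :: X -> d.1 != e.
  case: d => x b' dX; apply: contraNneq nO => /= ex; rewrite ex in dX.
  apply: contraNT mO; rewrite /n /m => nX; have : b' != b by apply: contraNneq nX => <-.
  by case: (b) (b') dX => -[].
have fcE d : d != n -> d != m -> fc r d != n -> fc (skip n r) d = fc r d.
  move=> dn dm fdn; rewrite /fc /skip (negbTE fdn : (r (rv d) == n) = _).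
  by rewrite -rvm (can_eq (@rvK E)) (negbTE dm).
have si := @skip_inj _ n r ri.
have cyc' : fcycle (fc (skip n r)) (c :: X).
  apply: cycle_cons.
    apply: fpath_avoid pth => [|].
      instantiate (1 := fun d => d \in X) => /= d fX; apply: fcE.
      - apply: contraTneq fX => ->; rewrite fn.
        by move: mO; rewrite in_cons negb_or => /andP[].
      - apply: contraTneq fX => ->; rewrite fm.
        by move: unX => /= /andP[].
      apply: contraTneq fX => ->.
      by move: nO; rewrite in_cons negb_or => /andP[].
    exact/allP.
  rewrite /fc /skip -/(fc r _) lst eqxx rn.
  case: eqP => // /esym; rewrite -rvm => /(can_inj (@rvK E)) e1.
  by have := mO; rewrite e1 -[_ \in _]/(last c X \in c :: X) mem_last.
split=> //.
- have eA : e \in A by apply: (sub n); rewrite mem_head.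
  have vs' : vstruct (darts A :\ n) (skip n r) by apply: vs_skip; rewrite // inE.
  rewrite (darts1D _ _ b).
  (* The dart [m] at the free end is already a fixed point of the rotation, so deleting it as well
     changes nothing. *)
  apply: (eq_vstruct _ (vs_skip vs' (n := m) _)).
    by apply: skip_fix; rewrite // /skip rm; case: eqP => // ->; case: eqP.
  by rewrite !inE /= eA andbT xpair_eqE eqxx; case: (b).
- by move=> d dX; rewrite in_setD1 ne // sub // in_cons orbC in_cons dX orbT.
move=> e1 e2 e1A e2A u1 u2 e1O.
apply: (@face_out (A :\ e) A _ r [:: n, m, c & X] _ _ _ _ _ face) u1 u2 _.
- move=> d dO; have [dn dm dX] : [/\ d != n, d != m & d \notin c :: X].
    exact: notin_cons2.
  have fE : fc (skip n r) d = fc r d.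
    rewrite fcE // -[n]lst (inj_eq (fc_inj ri)).
    by apply: contraNneq dX => ->; apply: mem_last.
  rewrite fE; split; [|exact: dO|by []].
  by apply: contra dO; apply: fcycle_in cyc; apply: fc_inj.
- by move=> x; rewrite !inE => /andP[].
- by [].
- by [].
move: e1A; rewrite in_setD1 => /andP[e1e _].
rewrite in_cons negb_or xpair_eqE (negbTE e1e) /=.
by rewrite in_cons negb_or xpair_eqE (negbTE e1e).
Qed.

(** Inside the downward stretch every dart but the last is followed by a downward one. So a boundary
    walk that goes up and then down has a single bottom corner. *)
Lemma last_down (f : E * bool -> E * bool) d (s t : seq E) x y :
  fcycle f (d :: map (fun e => up e) s ++ map (fun e => dn e) (rcons t x)) ->
  y \in rcons t x -> (f (dn y)).2 -> y = x.
Proof.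
move=> cyc yt fy; have [pth _] := last_cycle cyc; move: pth.
case/splitPr def_t: _ / yt => [t1 [|z t2]].
  by have := congr1 (last y) def_t; rewrite last_cat last_rcons.
by rewrite map_cat !cat_path /= => /and3P[_ _ /and3P[_ /eqP fyz _]]; move: fy; rewrite fyz.
Qed.

(** The chord cuts the outer walk in two: [up e] and [a :: X] bound the new inner face, [dn e] and
    [c :: Y] remain outer. As [a :: X] goes up and then down, the new face has one bottom corner by
    [last_down]; the other inner faces are untouched. *)
Lemma core_chord A r a c X Y e p q (s t : seq E) x : core A r (a :: X ++ c :: Y) ->
  e \notin A -> (forall b, r (e, b) = (e, b)) ->
  tl e = vt c -> hd e = vt a -> r p = c -> r q = a ->
  c.2 \/ p.2 ->
  [\/ ~~ a.2, ~~ q.2 | forall d, d.1 \in A -> vt d = vt a -> d.2] ->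
  a :: X = map (fun e => up e) s ++ map (fun e => dn e) (rcons t x) ->
  core (e |: A) (insert_before a (dn e) (insert_before c (up e) r))
    (dn e :: c :: Y).
Proof.
case=> vs cyc un sub face eA re tlc hda rp rq condc conda inner.
have ri := vs_inj vs.
set r1 := insert_before c (up e) r; set r2 := insert_before a (dn e) r1.
have nO d : d.1 \notin A -> d \notin a :: X ++ c :: Y by apply: contra => /sub.
have aA : a.1 \in A by rewrite sub ?mem_head.
have cO : c \in a :: X ++ c :: Y by rewrite in_cons mem_cat mem_head !orbT.
have cA : c.1 \in A by rewrite sub.
have [aXc unXcY] : a \notin X ++ c :: Y /\ uniq (X ++ c :: Y) by apply/andP.
have ac : a != c by apply: contraNneq aXc => ->; rewrite mem_cat mem_head orbT.
have cn b : c != (e, b) by apply/eqP=> ec; move: eA; rewrite -[e]/((e, b).1) -ec cA.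
have an b : a != (e, b) by apply/eqP=> ec; move: eA; rewrite -[e]/((e, b).1) -ec aA.
have Oe d : d \in a :: X ++ c :: Y -> d.1 != e.
  by move/sub; apply: contraTneq => ->.
have r1i : injective r1 by apply: insert_inj.
have r2i : injective r2 by apply: insert_inj.
have r1dn : r1 (dn e) = dn e.
  by rewrite /r1 /insert_before re [dn e == c]eq_sym (negbTE (cn _)) xpair_eqE andbF.
have r1up : r1 (up e) = c.
  by rewrite /r1 /insert_before re [_ == c]eq_sym (negbTE (cn _)) eqxx.
have r2dn : r2 (dn e) = a.
  by rewrite /r2 /insert_before r1dn [_ == a]eq_sym (negbTE (an _)) eqxx.
have r2up : r2 (up e) = c.
  by rewrite /r2 /insert_before r1up [c == a]eq_sym (negbTE ac) (negbTE (cn _)).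
have fcE d : (fc r d).1 != e -> fc r2 d = if fc r d == a then dn e
    else if fc r d == c then up e else fc r d.
  move=> fA; have ne b : fc r d == (e, b) = false.
    by apply/eqP => ed; rewrite ed eqxx in fA.
  rewrite -[LHS]/(insert_before a (dn e) (insert_before c (up e) (fc r)) d).
  rewrite /insert_before ne.
  case: (fc r d =P c) => [->|_]; last by rewrite ne.
  by rewrite [_ == a]eq_sym (negbTE (an _)) xpair_eqE andbF [c == a]eq_sym (negbTE ac).
have [pth lst] := last_cycle cyc.
have {pth lst} : [/\ fpath (fc r) a X, fc r (last a X) = c, fpath (fc r) c Y
    & fc r (last c Y) = a].
  move: pth lst; rewrite cat_path last_cat /=.
  by case/and3P=> -> /eqP -> ->.
case=> pX lX pY lY.
have path_ok z s' : {subset s' <= a :: X ++ c :: Y} -> a \notin s' ->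
    c \notin s' -> fpath (fc r) z s' -> fpath (fc r2) z s'.
  move=> sO as' cs'; apply: (@fpath_avoid _ (mem s')) => /= [d ds'|]; last exact/allP.
  rewrite fcE ?Oe ?sO //.
  by rewrite (negbTE (memPn as' _ ds')) (negbTE (memPn cs' _ ds')).
have [aX aY] : a \notin X /\ a \notin c :: Y by apply/norP; rewrite -mem_cat.
have [cX cY] : c \notin X /\ c \notin Y.
  move: unXcY; rewrite cat_uniq => /and3P[_ /hasPn cX /= /andP[-> _]].
  by split=> //; apply: (cX c); rewrite mem_head.
have sX : {subset X <= a :: X ++ c :: Y}.
  by move=> d dX; rewrite in_cons mem_cat dX orbT.
have sY : {subset Y <= a :: X ++ c :: Y}.
  by move=> d dX; rewrite in_cons mem_cat in_cons dX !orbT.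
have cyc2 : fcycle (fc r2) (dn e :: c :: Y).
  apply: cycle_cons => /=; last by rewrite fcE lY ?eqxx // Oe ?mem_head.
  rewrite [fc _ _]r2up eqxx path_ok //.
  by move: aY; rewrite in_cons => /norP[].
have cycI : fcycle (fc r2) (up e :: a :: X).
  apply: cycle_cons => /=.
    by rewrite [fc _ _]r2dn eqxx path_ok.
  by rewrite fcE lX ?Oe // eqxx [c == a]eq_sym (negbTE ac).
have unI : uniq (a :: X).
  by rewrite /= aX; move: unXcY; rewrite cat_uniq => /andP[].
split=> //.
- rewrite (darts1U _ _ false).
  have vs1 : vstruct (up e |: darts A) r1.
    apply: (vs_insert vs (p := p)); rewrite ?re ?inE //.
    by case: condc => ->; [apply: Or31|apply: Or32].
  have q1 : r1 q = a.
    rewrite /r1 /insert_before rq [a == up e]eq_sym.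
    by rewrite (negbTE ac) [_ == a]eq_sym (negbTE (an _)).
  apply: (vs_insert vs1 (p := q)); rewrite ?inE ?aA ?orbT //=.
    by rewrite xpair_eqE andbF.
  case: conda => [/negbTE->|/negbTE->|H]; [exact: Or31|exact: Or32|apply: Or33].
  by move=> d; rewrite !inE => /orP[/eqP->|] //; apply: H.
- rewrite cons_uniq; apply/andP; split; last first.
    by move: unXcY; rewrite cat_uniq => /and3P[].
  by apply: contra (nO (dn e) eA) => eY; rewrite in_cons mem_cat eY !orbT.
- move=> d; rewrite in_cons in_setU1 => /orP[/eqP->|dY]; first by rewrite eqxx.
  by rewrite sub ?orbT // in_cons mem_cat dY !orbT.
move=> e1 e2 e1A e2A u1 u2 e1O conn.
have [e1I|e1I] := boolP (dn e1 \in up e :: a :: X).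
  have e2I : dn e2 \in up e :: a :: X.
    by rewrite -(fconnect_cycle cycI e1I).
  have lastI e0 : dn e0 \in up e :: a :: X -> (r2 (up e0)).2 -> e0 = x.
    move=> e0I ue0; move: e0I cycI; rewrite inner in_cons xpair_eqE andbF /=.
    rewrite mem_cat => /orP[/mapP[? _ []] //|/mapP[y yt [e0y]]]; subst y.
    by move=> cycx; apply: last_down cycx yt ue0.
  by rewrite (lastI _ e1I u1) (lastI _ e2I u2).
apply: (@face_out (e |: A) A r2 r ((up e :: a :: X) ++ (dn e :: c :: Y)) _ _ _ _ _ face) u1 u2 _ conn => //.
- move=> d; rewrite mem_cat => /norP[dI dO].
  have dO' : d \notin a :: X ++ c :: Y.
    rewrite -cat_cons mem_cat; apply/norP; split.
      by apply: contra dI => dX; rewrite in_cons dX orbT.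
    by apply: contra dO => dX; rewrite in_cons dX orbT.
  split=> //.
    rewrite mem_cat; apply/norP; split.
      by apply: contra dI; apply: fcycle_in cycI; apply: fc_inj.
    by apply: contra dO; apply: fcycle_in cyc2; apply: fc_inj.
  rewrite fcE; last first.
    apply/eqP => de; have : d.1 != e.
      apply/eqP=> d1; case: d d1 dI dO {dO' de} => ? [] /= -> dI dO.
        by rewrite mem_head in dI.
      by rewrite mem_head in dO.
    have : rv d = (e, (fc r d).2).
      by apply: ri; rewrite re -[r (rv d)]/(fc r d) -{1}de; case: (fc r d).
    by move/(congr1 fst) => /= d1; rewrite d1 eqxx.
  case: eqP => [da|_].
    by case/negP: dO'; apply: fcycle_in cyc _; rewrite ?da ?mem_head //; apply: fc_inj.
  case: eqP => [dc|//].
  by case/negP: dO'; apply: fcycle_in cyc _; rewrite ?dc //; apply: fc_inj.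
- move=> e0; rewrite in_setU1 => /orP[/eqP->|//].
  by rewrite mem_cat mem_head orbT.
by rewrite mem_cat; apply/norP.
Qed.

(** Removing [e] merges the inner face on its west, bounded by [up e :: a :: X], into the outer face
    on its east. The two walks are disjoint because [up e] is not outer, so they concatenate to a
    walk without repetition. *)
Lemma core_unchord A r a c X Y e : core A r (dn e :: c :: Y) ->
  fcycle (fc r) (up e :: a :: X) -> uniq (up e :: a :: X) ->
  up e \notin dn e :: c :: Y ->
  core (A :\ e) (skip (up e) (skip (dn e) r)) (a :: X ++ c :: Y).
Proof.
case=> vs cyc un sub face cycI unI upO; have ri := vs_inj vs.
set r1 := skip (dn e) r; set r2 := skip (up e) r1.
have r1i : injective r1 by apply: skip_inj.
have r2i : injective r2 by apply: skip_inj.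
have [/= /andP[/eqP rup pY] lY] := last_cycle cyc.
have [/= /andP[/eqP rdn pX] lX] := last_cycle cycI.
rewrite /fc /rv /= in rup rdn.
have IO d : d \in up e :: a :: X -> d \notin dn e :: c :: Y.
  move=> dI; apply: contra upO => dO.
  by rewrite -(fconnect_cycle cyc dO) (fconnect_cycle cycI dI) mem_head.
have eA : e \in A by apply: (sub (dn e)); rewrite mem_head.
have aIO : a \notin dn e :: c :: Y by apply: IO; rewrite in_cons mem_head orbT.
have a_dn : a != dn e by apply: contraNneq aIO => ->; rewrite mem_head.
have c_up : c != up e.
  by apply: contraNneq upO => <-; rewrite in_cons mem_head orbT.
have c_dn : c != dn e.
  by apply: contraTneq un => ->; rewrite /= mem_head.
have a_up : a != up e.
  by apply: contraTneq unI => ->; rewrite /= mem_head.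
have r1up : r1 (up e) = c.
  by rewrite /r1 /skip rup (negbTE c_dn) xpair_eqE andbF.
have fcE d : d != up e -> d != dn e -> fc r2 d = if fc r d == dn e then a
    else if fc r d == up e then c else fc r d.
  move=> d_up d_dn; rewrite /fc /r2 /skip r1up.
  rewrite -[up e]/(rv (dn e)) (can_eq (@rvK E)) (negbTE d_dn) /rv /=.
  rewrite /r1 /skip -[dn e]/(rv (up e)) (can_eq (@rvK E)) (negbTE d_up) /rv /= rdn.
  by case: (r _ =P dn e) => [_|_] //; rewrite (negbTE a_up).
have unO : uniq (c :: Y) by move: un => /andP[].
have unX : uniq (a :: X) by move: unI => /andP[].
have path_ok z s : up e \notin z :: s -> dn e \notin z :: s ->
    fpath (fc r) z s -> fpath (fc r2) z s.
  elim: s z => //= y s IHs z; rewrite !(in_cons z).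
  move=> /norP[uz us] /norP[dz ds] /andP[/eqP fz pth].
  rewrite IHs // fcE 1?eq_sym // fz.
  have /negbTE-> : y != dn e by apply: contraNneq ds => ->; rewrite mem_head.
  have /negbTE-> : y != up e by apply: contraNneq us => ->; rewrite mem_head.
  by rewrite eqxx.
have upY : up e \notin c :: Y by move: upO; rewrite in_cons => /norP[].
have dnY : dn e \notin c :: Y by move: un => /andP[].
have upX : up e \notin a :: X by move: unI => /andP[].
have dnI : dn e \notin up e :: a :: X.
  by apply/negP=> /IO; rewrite mem_head.
have dnX : dn e \notin a :: X by move: dnI; rewrite in_cons => /norP[].
have cycN : fcycle (fc r2) (a :: X ++ c :: Y).
  apply: cycle_cons.
    rewrite cat_path path_ok //= path_ok // fcE ?andbT.
    - by rewrite lX xpair_eqE andbF !eqxx.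
    - by apply: contraNneq upX => <-; apply: mem_last.
    - by apply: contraNneq dnX => <-; apply: mem_last.
  rewrite last_cat /= fcE.
  - by rewrite lY eqxx.
  - by apply: contraNneq upY => <-; apply: mem_last.
  - by apply: contraNneq dnY => <-; apply: mem_last.
have Asub d : d \in a :: X ++ c :: Y -> d \in up e :: a :: X \/ d \in dn e :: c :: Y.
  rewrite -cat_cons mem_cat => /orP[dX|dY]; [left|right].
    by rewrite in_cons dX orbT.
  by rewrite in_cons dY orbT.
have inA d : d \in up e :: a :: X -> d.1 \in A.
  move=> dI; have : d \in darts A; last by rewrite inE.
  rewrite -(fconnect_cycle cycI (mem_head _ _)) in dI.
  have clos x : x \in darts A -> fc r x \in darts A.
    by rewrite (vs_dom vs) !inE.
  by apply: fconnect_closed clos _ _ dI _; rewrite inE.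
split=> //.
- rewrite (darts1D _ _ false) /=.
  apply: vs_skip; last by rewrite !inE /= eA xpair_eqE andbF.
  by apply: vs_skip; rewrite // inE.
- rewrite -cat_cons cat_uniq unX unO andbT andTb; apply/hasPn => d dY.
  apply/negP=> dX; have := IO d; rewrite in_cons dX orbT => /(_ isT).
  by rewrite in_cons dY orbT.
- move=> d dXY; rewrite in_setD1; apply/andP; split; last by case: (Asub d dXY) => [/inA|/sub].
  apply: contraTneq dXY; case: d => ? [] /= ->; rewrite -cat_cons mem_cat.
    by rewrite (negbTE upX) (negbTE upY).
  by rewrite (negbTE dnX) (negbTE dnY).
move=> e1 e2 e1A e2A u1 u2 e1O conn.
apply: (@face_out (A :\ e) A r2 r ((up e :: a :: X) ++ (dn e :: c :: Y)) _ _ _ _ _ face) u1 u2 _ conn => //.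
- move=> d dO; have [dI dO'] : d \notin up e :: a :: X /\ d \notin dn e :: c :: Y.
    by apply/norP; rewrite -mem_cat.
  have fE : fc r2 d = fc r d.
    rewrite fcE; first 1 last.
    - by apply: contra dI => /eqP ->; rewrite mem_head.
    - by apply: contra dO' => /eqP ->; rewrite mem_head.
    case: eqP => [fd|_].
      by case/negP: dO'; apply: fcycle_in cyc _; rewrite ?fd ?mem_head //; apply: fc_inj.
    case: eqP => [fd|//].
    by case/negP: dI; apply: fcycle_in cycI _; rewrite ?fd ?mem_head //; apply: fc_inj.
  split=> //; rewrite fE mem_cat; apply/norP; split.
    by apply: contra dI; apply: fcycle_in cycI; apply: fc_inj.
  by apply: contra dO'; apply: fcycle_in cyc; apply: fc_inj.
- by move=> x; rewrite in_setD1 => /andP[].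
move: e1A; rewrite in_setD1 => /andP[e1e _].
move: e1O; rewrite -cat_cons mem_cat => /norP[eX eY].
have [ne1 ne2] : dn e1 != up e /\ dn e1 != dn e.
  by rewrite !xpair_eqE andbF (negbTE e1e).
rewrite mem_cat [_ \in up e :: _]in_cons [_ \in dn e :: _]in_cons.
by rewrite (negbTE ne1) (negbTE ne2) (negbTE eX) (negbTE eY).
Qed.

End Core.

(** * The outer boundary during sewing *)

Notation ups s := [seq up e | e <- s].
Notation downs s := [seq dn e | e <- s].

Lemma mem_ups (E : eqType) (s : seq E) e b : ((e, b) \in ups s) = b && (e \in s).
Proof.
case: b => /=; first by rewrite mem_map // => ? ? [].
by apply/mapP => -[? _ []].
Qed.

Lemma mem_downs (E : eqType) (s : seq E) e b :
  ((e, b) \in downs s) = ~~ b && (e \in s).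
Proof.
case: b => /=; last by rewrite mem_map // => ? ? [].
by apply/mapP => -[? _ []].
Qed.

Lemma uniq_ups (E : eqType) (s : seq E) : uniq (ups s) = uniq s.
Proof. by rewrite map_inj_uniq // => ? ? []. Qed.

Lemma uniq_downs (E : eqType) (s : seq E) : uniq (downs s) = uniq s.
Proof. by rewrite map_inj_uniq // => ? ? []. Qed.

Lemma seq_last (T : Type) (s : seq T) : s = [::] \/ exists s' x, s = rcons s' x.
Proof. by case: (lastP s) => [|s' x]; [left | right; exists s', x]. Qed.

Lemma fcycle_adjacent (T : eqType) (f : T -> T) (s t : seq T) x y :
  fcycle f (s ++ x :: y :: t) -> f x = y.
Proof.
by rewrite -(rot_cycle (size s)) rot_size_cat /= => /andP[/eqP].
Qed.

Lemma insert_other (T : eqType) (c n : T) f x :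
  f x != c -> f x != n -> insert_before c n f x = f x.
Proof. by rewrite /insert_before => /negbTE-> /negbTE->. Qed.

Section Invariant.
Variables (V E : finType) (tl hd : E -> V).
Notation vt := (dart_vertex tl hd).
Notation core := (core tl hd).
Implicit Types (A : {set E}) (r : E * bool -> E * bool) (e x y z w : E).
Implicit Types (s t Wm Wr Ea H Ew Eb : seq E) (u v So St No Ac B C : V).

Fixpoint upath u s v : Prop :=
  if s is x :: s' then tl x = u /\ upath (hd x) s' v else u = v.

Fixpoint dpath u s v : Prop :=
  if s is x :: s' then hd x = u /\ dpath (tl x) s' v else u = v.

Lemma upath_cat u s t v :
  upath u (s ++ t) v <-> exists2 m, upath u s m & upath m t v.
Proof.
elim: s u => [|x s IHs] u /=.
  by split=> [p|[m -> //]]; exists u.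
split=> [[tx /IHs[m sm mt]]|[m [tx sm] mt]]; first by exists m.
by split=> //; apply/IHs; exists m.
Qed.

Lemma dpath_cat u s t v :
  dpath u (s ++ t) v <-> exists2 m, dpath u s m & dpath m t v.
Proof.
elim: s u => [|x s IHs] u /=.
  by split=> [p|[m -> //]]; exists u.
split=> [[tx /IHs[m sm mt]]|[m [tx sm] mt]]; first by exists m.
by split=> //; apply/IHs; exists m.
Qed.

Lemma upath_rcons u s x v : upath u (rcons s x) v <-> upath u s (tl x) /\ hd x = v.
Proof.
rewrite -cats1; split=> [/upath_cat /= [m sm [xm hv]]|[sx hv]].
  by rewrite xm.
by apply/upath_cat; exists (tl x).
Qed.

Lemma dpath_rcons u s x v : dpath u (rcons s x) v <-> dpath u s (hd x) /\ tl x = v.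
Proof.
rewrite -cats1; split=> [/dpath_cat /= [m sm [xm hv]]|[sx hv]].
  by rewrite xm.
by apply/dpath_cat; exists (hd x).
Qed.

Lemma upath_rev u s v : upath u s v <-> dpath v (rev s) u.
Proof.
elim: s u => [|x s IHs] u /=; first by split.
rewrite rev_cons; split=> [[? /IHs p]|/dpath_rcons[/IHs p ?]]; last by [].
exact/dpath_rcons.
Qed.

Lemma upath_mem u s v x : upath u s v -> x \in s -> exists s1 s2,
  [/\ s = rcons s1 x ++ s2, upath u (rcons s1 x) (hd x) & upath (hd x) s2 v].
Proof.
move=> p /splitPr def_s; case: def_s p => s1 s2.
rewrite -cat_rcons => /upath_cat[m /upath_rcons[p hx] q].
by exists s1, s2; split=> //; [apply/upath_rcons | rewrite hx].
Qed.

(** The outer walk, starting at the south pole. The hanging path [H] has the outer face on both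
    sides, so it is run down and then up again. *)
Definition outline Wm Wr Ea H Ew Eb :=
  ups (Wm ++ Wr) ++ downs (Ea ++ H) ++ ups (rev H) ++ downs (Ew ++ Eb).

Lemma outline_nil Wm Wr Ea Ew Eb :
  outline Wm Wr Ea [::] Ew Eb = ups (Wm ++ Wr) ++ downs (Ea ++ Ew ++ Eb).
Proof. by rewrite /outline cats0 [downs (Ea ++ _)]map_cat. Qed.

(* [Wm] and [Ea] are the missing edges of the western and eastern boundary,
   [Wr] the other western edges (both upwards); [H] is a path hanging from the
   active vertex, [Ew] and [Eb] the eastern edges below the active vertex, those
   in [Ew] being already sewn to the face under construction.  [B] and [C] are
   the lower ends of [H] and [Ew].  Since [Wm] and [Ea] are outer, [i_low] and
   [i_high] express that their edges are the only downward edge of their head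
   and the only upward edge of their tail. *)
Record sewing A r Wm Wr Ea H Ew Eb So St No Ac B C : Prop := Sewing {
  i_core : core A r (outline Wm Wr Ea H Ew Eb);
  i_rank : exists h : V -> nat, (forall e, e \in A -> h (tl e) < h (hd e)) /\
    (Ew != [::] -> h C < h B);
  i_Wr0 : Wr != [::];
  i_Wm : upath So Wm St;
  i_Wr : upath St Wr No;
  i_Ea : dpath No Ea Ac;
  i_H : dpath Ac H B;
  i_Ew : dpath Ac Ew C;
  i_Eb : dpath C Eb So;
  i_src : forall e, e \in A ->
    [\/ tl e = So, H != [::] /\ tl e = B | exists2 e', e' \in A & hd e' = tl e];
  i_So : forall e, e \in A -> hd e != So;
  i_B : H != [::] -> forall e, e \in A -> hd e != B;
  i_snk : forall e, e \in A ->
    hd e = No \/ exists2 e', e' \in A & tl e' = hd e;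
  i_No : forall e, e \in A -> tl e != No;
  i_low : forall w, w \in Wm -> exists2 e, e \in A & r (up e) = dn w;
  i_high : forall z, z \in Ea -> exists2 e, e \in A & r (dn e) = up z;
  i_WE : forall w, w \in Wm -> w \notin Ea ++ Eb;
  i_EW : forall z, z \in Ea -> z \notin Wm ++ Wr;
  i_top : forall x s, Ew = x :: s -> x \notin Wm
}.

Definition marking A r Wm Wr Ea Eb So St No Ac :=
  sewing A r Wm Wr Ea [::] [::] Eb So St No Ac Ac Ac.

Section Facts.
Variables (A : {set E}) (r : E * bool -> E * bool) (Wm Wr Ea H Ew Eb : seq E).
Variables (So St No Ac B C : V).
Hypothesis I : sewing A r Wm Wr Ea H Ew Eb So St No Ac B C.

Lemma sewing_inj : injective r. Proof. exact: vs_inj (co_vs (i_core I)). Qed.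

Lemma sewing_dom d : ((r d).1 \in A) = (d.1 \in A).
Proof. by have := vs_dom (co_vs (i_core I)) d; rewrite !inE. Qed.

Lemma sewing_vt d : d.1 \in A -> vt (r d) = vt d.
Proof. by move=> dA; apply: (vs_vt (co_vs (i_core I))); rewrite inE. Qed.

Lemma sewing_one e e' f f' : e \in A -> e' \in A -> tl e = tl e' ->
  r (up e) = dn f -> r (up e') = dn f' -> e = e' /\ f = f'.
Proof.
move=> eA e'A tt re re'; suff ee' : up e = up e'.
  by case: ee' re' => <-; rewrite re => -[].
by apply: (vs_one (co_vs (i_core I))); rewrite ?inE ?re ?re'.
Qed.

Lemma mem_outline e b : ((e, b) \in outline Wm Wr Ea H Ew Eb) =
  if b then e \in Wm ++ Wr ++ H else e \in Ea ++ H ++ Ew ++ Eb.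
Proof.
rewrite !mem_cat !mem_ups !mem_downs mem_rev !mem_cat.
by case: b => /=; rewrite ?orbF ?orbA.
Qed.

Lemma sewing_sub e : (e \in Wm) || (e \in Wr) || (e \in Ea) || (e \in H) ||
  (e \in Ew) || (e \in Eb) -> e \in A.
Proof.
move=> eO; suff [b] : exists b, (e, b) \in outline Wm Wr Ea H Ew Eb.
  by move/(co_sub (i_core I)).
case: (boolP ((e, true) \in outline Wm Wr Ea H Ew Eb)) => [?|nt]; first by exists true.
exists false; move: nt; rewrite !mem_outline !mem_cat !negb_or => /and3P[nm nr nh].
by move: eO; rewrite (negbTE nm) (negbTE nr) (negbTE nh) !orbF /= -orbA.
Qed.

Lemma sewing_uniqs : [/\ uniq (Wm ++ Wr ++ H), uniq (Ea ++ H ++ Ew ++ Eb)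
  & forall e, e \in H -> e \notin Wm ++ Wr].
Proof.
have un := co_uniq (i_core I).
have upsT s : [seq d <- ups s | d.2] = ups s.
  by elim: s => //= x s ->.
have downsT s : [seq d <- downs s | d.2] = [::] by elim: s.
have upsF s : [seq d <- ups s | ~~ d.2] = [::] by elim: s.
have downsF s : [seq d <- downs s | ~~ d.2] = downs s.
  by elim: s => //= x s ->.
have unW : uniq (Wm ++ Wr ++ H).
  have := filter_uniq snd un; rewrite !filter_cat !upsT !downsT !cats0 /=.
  rewrite -map_cat uniq_ups cat_uniq rev_uniq has_rev -cat_uniq.
  by rewrite -catA.
split=> //.
  have := filter_uniq (fun d => ~~ d.2) un.
  by rewrite !filter_cat !upsF !downsF /= -map_cat uniq_downs -catA.
move=> e eH; move: unW; rewrite catA cat_uniq => /and3P[_ /hasPn W _].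
exact: W.
Qed.

Lemma sewing_rank : exists h : V -> nat,
  [/\ forall e, e \in A -> h (tl e) < h (hd e),
      Ew != [::] -> h C < h B,
      forall u s v, {subset s <= A} -> dpath u s v -> h v + size s <= h u &
      forall u s v, {subset s <= A} -> upath u s v -> h u + size s <= h v].
Proof.
have [h [hA hE]] := i_rank I; exists h.
have hd_ok u s v : {subset s <= A} -> dpath u s v -> h v + size s <= h u.
  elim: s u => [|x s IHs] u sA /=; first by move->; rewrite addn0.
  case=> <- /IHs IH; rewrite addnS; apply: leq_ltn_trans (hA _ (sA _ (mem_head _ _))).
  by apply: IH => y ys; rewrite sA // in_cons ys orbT.
split=> // u s v sA /upath_rev/hd_ok; rewrite size_rev; apply.
by move=> y; rewrite mem_rev; apply: sA.
Qed.

Lemma dpath_live u s v : {subset s <= A} -> dpath u s v ->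
  (exists2 d, d.1 \in A & vt d = u) -> exists2 d, d.1 \in A & vt d = v.
Proof.
case: (seq_last s) => [->/= _ -> //|[s' [x ->]]] sA /dpath_rcons[_ <-] _.
by exists (up x); rewrite // sA // mem_rcons mem_head.
Qed.

Lemma sewing_live : [/\ exists2 d, d.1 \in A & vt d = So,
  exists2 d, d.1 \in A & vt d = No, exists2 d, d.1 \in A & vt d = Ac,
  exists2 d, d.1 \in A & vt d = B & exists2 d, d.1 \in A & vt d = C].
Proof.
have sA e (P : seq E) : {subset P <= Wm ++ Wr ++ Ea ++ H ++ Ew ++ Eb} -> e \in P -> e \in A.
  by move=> PO /PO; rewrite !mem_cat !orbA; apply: sewing_sub.
have No_live : exists2 d, d.1 \in A & vt d = No.
  case: (seq_last Wr) (i_Wr0 I) (i_Wr I) sA => [->//|[s [x def_Wr]]] _ W sA.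
  exists (dn x); last by move: W; rewrite def_Wr => /upath_rcons[].
  apply: (sA x Wr) => [y yW|]; first by rewrite !mem_cat yW orbT.
  by rewrite def_Wr mem_rcons mem_head.
have Ac_live : exists2 d, d.1 \in A & vt d = Ac.
  apply: dpath_live (i_Ea I) No_live => e; apply: sA => y ys.
  by rewrite !mem_cat ys !orbT.
have B_live : exists2 d, d.1 \in A & vt d = B.
  apply: dpath_live (i_H I) Ac_live => e; apply: sA => y ys.
  by rewrite !mem_cat ys !orbT.
have C_live : exists2 d, d.1 \in A & vt d = C.
  apply: dpath_live (i_Ew I) Ac_live => e; apply: sA => y ys.
  by rewrite !mem_cat ys !orbT.
split=> //; apply: dpath_live (i_Eb I) C_live => e; apply: sA => y ys.
by rewrite !mem_cat ys !orbT.
Qed.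

(** The named vertices are all ends of edges of [A], so a newly added vertex is none of them. *)
Lemma sewing_fresh v : (forall d, d.1 \in A -> vt d != v) ->
  [/\ v != So, v != No, v != Ac, v != B & v != C].
Proof.
have [[d1 A1 <-] [d2 A2 <-] [d3 A3 <-] [d4 A4 <-] [d5 A5 <-]] := sewing_live.
by move=> vA; split; rewrite eq_sym vA.
Qed.

Lemma sewing_B_snk : B = No \/ exists2 e, e \in A & tl e = B.
Proof.
have [[HE HH] sA] := (conj (i_Ea I) (i_H I), sewing_sub).
case: (seq_last H) HH sA => [-> /= <-|[s [x ->]] /dpath_rcons[_ <-]] sA.
  case: (seq_last Ea) HE sA => [-> /= <-|[s [x ->]] /dpath_rcons[_ <-]] sA.
    by left.
  by right; exists x; rewrite // sA // mem_rcons mem_head !orbT.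
by right; exists x; rewrite // sA // mem_rcons mem_head !orbT.
Qed.

End Facts.

(** The map itself is unchanged: only the cut between missing and other eastern edges moves past
    [z], and the outline remains the same list. *)
Lemma fwd_set A r Wm Wr Ea z Eb So St No Ac :
  marking A r Wm Wr (rcons Ea z) Eb So St No Ac ->
  marking A r Wm Wr Ea (z :: Eb) So St No (hd z).
Proof.
move=> I; have /dpath_rcons[Ea_z tz] := i_Ea I.
split=> //.
- by have := i_core I; rewrite !outline_nil cat_rcons.
- by have [h [? _]] := i_rank I; exists h.
- exact: i_Wr0 I.
- exact: i_Wm I.
- exact: i_Wr I.
- by rewrite /= tz; have := i_Eb I.
- by move=> e /(i_src I)[?|[//]|?]; [apply: Or31|apply: Or33].
- exact: i_So I.
- exact: i_snk I.
- exact: i_No I.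
- exact: i_low I.
- by move=> x xE; apply: (i_high I); rewrite mem_rcons in_cons xE orbT.
- by move=> w /(i_WE I); rewrite cat_rcons.
by move=> x xE; apply: (i_EW I); rewrite mem_rcons in_cons xE orbT.
Qed.

Lemma fwd_walk A r Wm Wr Ea Ew x Eb So St No Ac B C :
  sewing A r Wm Wr Ea [::] Ew (x :: Eb) So St No Ac B C ->
  sewing A r Wm Wr Ea [::] (rcons Ew x) Eb So St No Ac B (tl x).
Proof.
move=> I; have [hx Eb_x] := i_Eb I.
split; try by case: I.
- by have := i_core I; rewrite !outline_nil cat_rcons.
(* While [H] is empty, [B] is the active vertex, so the inequality just says that the walk has
   descended. *)
- have [h [hA hC]] := i_rank I; exists h; split=> // _.
  have xA : x \in A by rewrite (sewing_sub I) // mem_head !orbT.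
  case: Ew I hC => [|y s] I; last by move/(_ isT); apply: ltn_trans; rewrite -hx hA.
  by have := i_H I; have /= -> := i_Ew I => <- _; rewrite -hx hA.
- by apply/dpath_rcons; rewrite hx; split=> //; apply: i_Ew I.
- by move=> w /(i_WE I); rewrite !mem_cat in_cons !negb_or => /and3P[-> _ ->].
move=> y s; case: Ew I => [|y' s'] I [yx _]; last by rewrite -yx; apply: (i_top I).
by rewrite -yx; apply/negP => /(i_WE I); rewrite mem_cat mem_head orbT.
Qed.

(** The new edge has the outer face on both sides and therefore enters both the western and the
    eastern list, at their upper ends. *)
Lemma fwd_top A r Wm Wr x Eb So St No Ac e :
  marking A r Wm Wr [::] (x :: Eb) So St No Ac -> e \notin A ->
  (forall b, r (e, b) = (e, b)) -> tl e = Ac ->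
  (forall d, d.1 \in A -> vt d != hd e) ->
  marking (e |: A) (insert_before (dn x) (up e) r) Wm (rcons Wr e) [::]
    (e :: x :: Eb) So St (hd e) (hd e).
Proof.
move=> I eA re te fresh; have [hx Eb_x] := i_Eb I; have /= NoAc := i_Ea I.
have sub := sewing_sub I; have xA : x \in A by rewrite sub // mem_head !orbT.
have [nSo nNo nAc _ _] := sewing_fresh I fresh.
have old f b : f \in A -> (f, b) != up e.
  by apply: contraTneq => -[->].
split=> //.
- have := i_core I; rewrite outline_nil => /core_rot /= K.
  rewrite outline_nil -rcons_cat map_rcons cat_rcons.
  apply: (@core_rot _ _ _ _ _ _ (up e :: dn e :: dn x :: downs Eb) (ups (Wm ++ Wr))).
  apply: (core_leaf (b := true) (p := finv r (dn x)) K); rewrite ?f_finv //.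
  + by rewrite /dart_vertex /= te hx.
  + exact: sewing_inj I.
  (* The active vertex is the old north pole, which carries only downward darts. *)
  apply: Or33 => -[f [|//]] fA /= ; rewrite /dart_vertex /= hx -NoAc => tf.
  by have := i_No I fA; rewrite tf eqxx.
- have [h [hA _]] := i_rank I.
  exists (fun v => if v == hd e then (h Ac).+1 else h v); split=> // f.
  rewrite in_setU1 => /orP[/eqP->|fA]; first by rewrite eqxx te eq_sym (negbTE nAc).
  have := fresh (up f) fA; have := fresh (dn f) fA; rewrite /dart_vertex /=.
  by move=> /negbTE-> /negbTE->; apply: hA.
- by case: (Wr).
- exact: i_Wm I.
- by apply/upath_rcons; rewrite te -NoAc; split=> //; apply: i_Wr I.
- by rewrite /= te hx.
- move=> f; rewrite in_setU1 => /orP[/eqP->|/(i_src I)].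
    by apply: Or33; exists x; rewrite ?in_setU1 ?xA ?orbT // hx.
  case=> [?|[//]|[g gA hg]]; [exact: Or31|apply: Or33; exists g => //].
  by rewrite in_setU1 gA orbT.
- by move=> f; rewrite in_setU1 => /orP[/eqP->//|/(i_So I)].
- move=> f; rewrite in_setU1 => /orP[/eqP->|/(i_snk I)[->|[g gA hg]]]; first by left.
    by right; exists e; rewrite ?in_setU1 ?eqxx // te NoAc.
  by right; exists g; rewrite // in_setU1 gA orbT.
- move=> f; rewrite in_setU1 => /orP[/eqP->|fA]; first by rewrite te eq_sym.
  exact: (fresh (up f)).
- move=> w wW; have [f fA rf] := i_low I wW; exists f; first by rewrite in_setU1 fA orbT.
  rewrite insert_other rf // ?old ?sub ?wW //.
  apply: contraTneq (i_WE I wW) => -[->]; by rewrite mem_head.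
move=> w wW; rewrite !in_cons !negb_or.
have wA : w \in A by rewrite sub ?wW.
rewrite (contraTneq _ wA) /=; last by move->.
by have := i_WE I wW; rewrite in_cons negb_or.
Qed.

(** The eastern boundary is exhausted before the west side of the face is. The edge hung below the
    old south pole belongs both to the missing western edges and to the edges already sewn to the
    face. *)
Lemma fwd_ext A r Wm Wr w Ws Ea Ew So St No Ac B C e :
  sewing A r Wm Wr Ea [::] Ew [::] So St No Ac B C -> Ew != [::] ->
  Wm ++ Wr = w :: Ws -> e \notin A ->
  (forall b, r (e, b) = (e, b)) -> hd e = So ->
  (forall d, d.1 \in A -> vt d != tl e) ->
  sewing (e |: A) (insert_before (up w) (dn e) r) (e :: Wm) Wr Ea [::]
    (rcons Ew e) [::] (tl e) St No Ac B (tl e).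
Proof.
move=> I Ew0 def_W eA re he fresh; have sub := sewing_sub I.
have /= CSo := i_Eb I; have /= AcB := i_H I.
have [nSo nNo nAc nB nC] := sewing_fresh I fresh.
have old f b : f \in A -> (f, b) != dn e.
  by apply: contraTneq => -[->].
have tw : tl w = So.
  have : upath So (Wm ++ Wr) No.
    by apply/upath_cat; exists St; [apply: i_Wm I | apply: i_Wr I].
  by rewrite def_W => -[].
have wA : w \in A.
  have : w \in Wm ++ Wr by rewrite def_W mem_head.
  by rewrite mem_cat => /orP[wW|wW]; rewrite sub // wW ?orbT.
(* The old south pole carries only upward darts, so the dart before the corner [up w] is upward; it
   is the one that [i_low] demands for [e]. *)
have [p rp p2] : exists2 p, r p = up w & p.2 /\ p.1 \in A.
  exists (finv r (up w)); first by rewrite f_finv //; apply: sewing_inj I.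
  have rp : r (finv r (up w)) = up w by rewrite f_finv //; apply: sewing_inj I.
  have pA : (finv r (up w)).1 \in A by rewrite -(sewing_dom I) rp.
  have := sewing_vt I pA; rewrite rp; case: (finv r (up w)) pA => f [] //= fA.
  by rewrite /dart_vertex /= tw => hf; have := i_So I fA; rewrite -hf eqxx.
split=> //.
- have := i_core I; rewrite outline_nil def_W /= => K.
  rewrite outline_nil cats0 cat_cons def_W -rcons_cat map_rcons.
  have -> : ups (e :: w :: Ws) ++ rcons (downs (Ea ++ Ew)) (dn e) =
    (up e :: up w :: ups Ws ++ downs (Ea ++ Ew)) ++ [:: dn e].
    by rewrite /= -cats1 -catA.
  apply: core_rot; rewrite cats0 in K.
  apply: (core_leaf (b := false) (p := p) K) => //.
    by rewrite /dart_vertex /= tw.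
  apply: Or33 => -[f []] //= fA; rewrite /dart_vertex /= tw => hf.
  by have := i_So I fA; rewrite hf eqxx.
- have [h [hA hC]] := i_rank I.
  (* All heights are shifted by one to leave 0 to the new south pole. *)
  exists (fun v => if v == tl e then 0 else (h v).+1); split=> [f|_].
    rewrite in_setU1 => /orP[/eqP->|fA]; first by rewrite eqxx he eq_sym (negbTE nSo).
    have := fresh (up f) fA; have := fresh (dn f) fA; rewrite /dart_vertex /=.
    by move=> /negbTE-> /negbTE->; rewrite ltnS; apply: hA.
  by rewrite eqxx eq_sym (negbTE nB).
- exact: i_Wr0 I.
- by rewrite /= he; split=> //; apply: i_Wm I.
- exact: i_Wr I.
- exact: i_Ea I.
- by apply/dpath_rcons; rewrite he -CSo; split=> //; apply: i_Ew I.
- move=> f; rewrite in_setU1 => /orP[/eqP->|/(i_src I)]; first exact: Or31.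
  case=> [->|[//]|[g gA hg]]; apply: Or33; [exists e|exists g] => //.
    by rewrite in_setU1 eqxx.
  by rewrite in_setU1 gA orbT.
- move=> f; rewrite in_setU1 => /orP[/eqP->|fA]; first by rewrite he eq_sym.
  exact: (fresh (dn f)).
- move=> f; rewrite in_setU1 => /orP[/eqP->|/(i_snk I)[->|[g gA hg]]].
  + by right; exists w; rewrite ?in_setU1 ?wA ?orbT // he.
  + by left.
  by right; exists g; rewrite // in_setU1 gA orbT.
- by move=> f; rewrite in_setU1 => /orP[/eqP->//|/(i_No I)].
- move=> f; rewrite in_cons => /orP[/eqP->|fW].
    exists p.1; first by rewrite in_setU1 p2.2 orbT.
    by rewrite /insert_before -{1}p2.1 -surjective_pairing rp eqxx.
  have [g gA rg] := i_low I fW; exists g; first by rewrite in_setU1 gA orbT.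
  by rewrite insert_other rg // ?old // ?sub ?fW // xpair_eqE andbF.
- move=> z zE; have [g gA rg] := i_high I zE.
  exists g; first by rewrite in_setU1 gA orbT.
  rewrite insert_other rg //; last by rewrite xpair_eqE andbF.
  by apply: contraTneq (i_EW I zE) => -[->]; rewrite def_W mem_head.
- move=> f; rewrite in_cons cats0 => /orP[/eqP->|fW].
    by apply: contra eA => eE; rewrite sub // eE !orbT.
  by have := i_WE I fW; rewrite cats0.
- move=> z zE; rewrite cat_cons in_cons negb_or (i_EW I zE) andbT.
  by apply: contraNneq eA => <-; rewrite sub // zE !orbT.
move=> f s; case: Ew I Ew0 {CSo sub} => // y Ew' I _ [<- _].
rewrite in_cons negb_or (i_top I (erefl _)) andbT.
by apply: contraNneq eA => <-; rewrite (sewing_sub I) // mem_head !orbT.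
Qed.

(** The new lower end of the hanging path is a source besides the south pole until the chord is
    drawn; the middle alternative of [i_src] allows for it. *)
Lemma fwd_hang A r Wm Wr Ea H Ew Eb So St No Ac B C e a X :
  sewing A r Wm Wr Ea H Ew Eb So St No Ac B C -> Ew != [::] ->
  ups (rev H) ++ downs (Ew ++ Eb) = a :: X -> e \notin A ->
  (forall b, r (e, b) = (e, b)) -> hd e = B ->
  (forall d, d.1 \in A -> vt d != tl e) ->
  sewing (e |: A) (insert_before a (dn e) r) Wm Wr Ea (rcons H e) Ew Eb
    So St No Ac (tl e) C.
Proof.
move=> I Ew0 def_a eA re he fresh; have sub := sewing_sub I.
have [nSo nNo nAc nB nC] := sewing_fresh I fresh.
have old f b : f \in A -> (f, b) != dn e.
  by apply: contraTneq => -[->].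
have [h0 [hA hC hdp hup]] := sewing_rank I.
have aP : vt a = B /\ (~~ a.2 /\ (exists2 t, a = dn t & t \notin Wm) \/
    H != [::] /\ exists2 y, a = up y & y \in H).
  case: (seq_last H) (i_H I) def_a => [->|[s [y ->]] /dpath_rcons[_ ty]].
    move=> /= <-; case: Ew I Ew0 {sub hC} => // t Ew' I _ [<- _].
    have [ht _] := i_Ew I; rewrite -ht; split=> //; left; split=> //.
    by exists t; rewrite // (i_top I (erefl _)).
  rewrite rev_rcons => -[<- _]; split=> //; right; split; first by case: (s).
  by exists y; rewrite // mem_rcons mem_head.
case: aP => va aP.
have BSo : B != So.
  apply/eqP=> BS; have : h0 So <= h0 C.
    apply: leq_trans (hdp _ _ _ _ (i_Eb I)); first exact: leq_addr.
    by move=> y yE; rewrite sub // yE !orbT.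
  by rewrite leqNgt -BS hC.
split=> //.
- have := i_core I; rewrite /outline def_a catA => /core_rot K.
  have -> : ups (Wm ++ Wr) ++ downs (Ea ++ rcons H e) ++ ups (rev (rcons H e)) ++
    downs (Ew ++ Eb) = (ups (Wm ++ Wr) ++ downs (Ea ++ H)) ++ (dn e :: up e :: a :: X).
    by rewrite rev_rcons map_cons cat_cons def_a -rcons_cat map_rcons cat_rcons catA.
  apply: core_rot; apply: (core_leaf (b := false) (p := finv r a) K) => //.
  + by rewrite va.
  + by rewrite f_finv //; apply: sewing_inj I.
  (* For the first hanging edge the corner is a downward dart; later on the lower end of [H] has
     only upward darts. *)
  case: aP => [[/negbTE a2 _]|[H0 _]]; first exact: Or31.
  apply: Or33 => -[f []] //= fA; rewrite va => hf.
  by have := i_B I H0 fA; rewrite -hf eqxx.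
(* The new vertex must lie below [B] but above [C], and these may have consecutive heights. Doubling
   all heights makes room just below [B]. *)
- exists (fun v => if v == tl e then (h0 B).*2.-1 else (h0 v).*2).
  have hB : 0 < h0 B by apply: leq_ltn_trans (hC Ew0).
  have ltB n : n < h0 B -> n.*2 < (h0 B).*2.-1.
    by case: (h0 B) => // m; rewrite ltnS doubleS /= ltnS leq_double.
  split=> [f|_]; last by rewrite eqxx eq_sym (negbTE nC) ltB ?hC.
  rewrite in_setU1 => /orP[/eqP->|fA].
    by rewrite eqxx he eq_sym (negbTE nB) prednK ?double_gt0.
  have := fresh (up f) fA; have := fresh (dn f) fA; rewrite /dart_vertex /=.
  by move=> /negbTE-> /negbTE->; rewrite ltn_double hA.
- exact: i_Wr0 I.
- exact: i_Wm I.
- exact: i_Wr I.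
- exact: i_Ea I.
- by apply/dpath_rcons; rewrite he; split=> //; apply: i_H I.
- exact: i_Ew I.
- exact: i_Eb I.
- move=> f; rewrite in_setU1 => /orP[/eqP->|/(i_src I)].
    by apply: Or32; split=> //; case: (H).
  case=> [?|[_ tf]|[g gA hg]]; [exact: Or31|apply: Or33..].
    by exists e; rewrite ?in_setU1 ?eqxx // he.
  by exists g; rewrite // in_setU1 gA orbT.
- by move=> f; rewrite in_setU1 => /orP[/eqP->|/(i_So I)//]; rewrite he.
- move=> _ f; rewrite in_setU1 => /orP[/eqP->|fA]; first by rewrite he eq_sym.
  exact: (fresh (dn f)).
- move=> f; rewrite in_setU1 => /orP[/eqP->|/(i_snk I)[->|[g gA hg]]].
  + rewrite he; have [->|[g gA hg]] := sewing_B_snk I; first by left.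
    by right; exists g; rewrite // in_setU1 gA orbT.
  + by left.
  by right; exists g; rewrite // in_setU1 gA orbT.
- by move=> f; rewrite in_setU1 => /orP[/eqP->//|/(i_No I)].
- move=> f fW; have [g gA rg] := i_low I fW.
  exists g; first by rewrite in_setU1 gA orbT.
  rewrite insert_other rg ?old ?sub ?fW //.
  case: aP => [[_ [t -> tW]]|[_ [y -> _]]]; last by rewrite xpair_eqE andbF.
  by apply: contraNneq tW => -[<-].
- move=> z zE; have [g gA rg] := i_high I zE.
  exists g; first by rewrite in_setU1 gA orbT.
  rewrite insert_other rg //; last by rewrite xpair_eqE andbF.
  case: aP => [[_ [t -> tW]]|[_ [y -> yH]]]; first by rewrite xpair_eqE andbF.
  have [_ + _] := sewing_uniqs I; rewrite cat_uniq => /and3P[_ /hasPn/(_ y)].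
  by rewrite mem_cat yH => /(_ isT) yE _; apply: contraNneq yE => -[<-].
- exact: i_WE I.
- exact: i_EW I.
exact: i_top I.
Qed.

End Invariant.

Section Invariant.
Variables (V E : finType) (tl hd : E -> V).
Notation vt := (dart_vertex tl hd).
Notation core := (core tl hd).
Notation sewing := (sewing tl hd).
Notation marking := (marking tl hd).
Implicit Types (A : {set E}) (r : E * bool -> E * bool) (e x y z w : E).
Implicit Types (s t Wm Wr Ea H Ew Eb : seq E) (u v So St No Ac B C : V).

(** Apart from locating the upper corner [a], this says that [a] is never [dn w] with [w] in [Wm]:
    an insertion before [a] does not separate a missing western edge from the upward dart that
    [i_low] puts before it. *)
Lemma sewing_corner A r Wm Wr Ea H Ew Eb So St No Ac B C a X :
  sewing A r Wm Wr Ea H Ew Eb So St No Ac B C -> Ew != [::] ->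
  ups (rev H) ++ downs (Ew ++ Eb) = a :: X ->
  vt a = B /\ ((exists2 t, a = dn t & t \notin Wm) \/
    H != [::] /\ exists2 y, a = up y & y \in H).
Proof.
move=> I Ew0.
case: (seq_last H) (i_H I) => [->|[s [y ->]] /dpath_rcons[_ ty]].
  move=> /= <-; case: Ew I Ew0 => // t Ew' I _ [<- _].
  have [ht _] := i_Ew I; rewrite -ht; split=> //; left.
  by exists t; rewrite // (i_top I (erefl _)).
rewrite rev_rcons => -[<- _]; split=> //; right; split; first by case: (s).
by exists y; rewrite // mem_rcons mem_head.
Qed.

Lemma sewing_B_So A r Wm Wr Ea H Ew Eb So St No Ac B C :
  sewing A r Wm Wr Ea H Ew Eb So St No Ac B C -> Ew != [::] -> B != So /\ B != C.
Proof.
move=> I Ew0; have [h0 [hA hC hdp hup]] := sewing_rank I.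
have lt_CB := hC Ew0; split; last first.
  by apply/eqP=> BC; rewrite BC ltnn in lt_CB.
apply/eqP=> BS; have : h0 So <= h0 C.
  apply: leq_trans (hdp _ _ _ _ (i_Eb I)); first exact: leq_addr.
  by move=> y yE; rewrite (sewing_sub I) // yE !orbT.
by rewrite leqNgt -BS lt_CB.
Qed.

Lemma sewing_walked A r Wm Wr Ea H Ew Eb So St No Ac B C c X Y :
  sewing A r Wm Wr Ea H Ew Eb So St No Ac B C ->
  downs Eb ++ ups (Wm ++ Wr) ++ X = c :: Y ->
  vt c = C /\ ((exists2 t, c = dn t & t \notin Wm) \/
     exists2 y, c = up y & y \in Wm ++ Wr).
Proof.
case: Eb => [|y s] I.
  have /= CSo := i_Eb I.
  case def_W: (Wm ++ Wr) => [|w Ws].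
    by case: (Wm) (Wr) (i_Wr0 I) def_W => [|? ?] [|? ?].
  move=> [<- _]; split; last by right; exists w; rewrite ?mem_head.
  have : upath tl hd So (Wm ++ Wr) No.
    by apply/upath_cat; exists St; [apply: i_Wm I | apply: i_Wr I].
  by rewrite def_W CSo => -[].
move=> [<- _]; have [hy _] := i_Eb I; split=> //; left; exists y => //.
by apply/negP => /(i_WE I); rewrite mem_cat mem_head orbT.
Qed.

(** Closing the face turns the hanging path into missing eastern edges and makes its lower end [B]
    the active vertex. The chord from [C] to [B] respects the height because [h C < h B] has been
    maintained. *)
Lemma fwd_chord A r Wm Wr Ea H Ew Eb So St No Ac B C e a X c Y :
  sewing A r Wm Wr Ea H Ew Eb So St No Ac B C -> Ew != [::] ->
  ups (rev H) ++ downs Ew = a :: X ->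
  downs Eb ++ ups (Wm ++ Wr) ++ downs (Ea ++ H) = c :: Y ->
  e \notin A -> (forall b, r (e, b) = (e, b)) -> tl e = C -> hd e = B ->
  marking (e |: A) (insert_before a (dn e) (insert_before c (up e) r))
    Wm Wr (Ea ++ H) (e :: Eb) So St No B.
Proof.
move=> I Ew0 def_a def_c eA re te he; have sub := sewing_sub I.
have old f b b' : f \in A -> (f, b) != (e, b').
  by apply: contraTneq => -[->].
have def_a' : ups (rev H) ++ downs (Ew ++ Eb) = a :: X ++ downs Eb.
  by rewrite map_cat catA def_a.
have [va aP] := sewing_corner I Ew0 def_a'; have [BSo BC] := sewing_B_So I Ew0.
have [un1 un2 HW] := sewing_uniqs I.
have aux1 f : r f = a \/ r f != a by case: eqP; [left|right].
case: (seq_last Ew) Ew0 => [->//|[Ew' [l def_Ew]]] Ew0.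
have lA : l \in A by rewrite sub // def_Ew mem_rcons mem_head !orbT.
have tl_l : tl l = C by have := i_Ew I; rewrite def_Ew => /dpath_rcons[].
have K : core A r (a :: X ++ c :: Y).
  have := i_core I; rewrite /outline catA => /core_rot.
  by rewrite def_a' -cat_cons -catA def_c.
have [vc cP] := sewing_walked I def_c.
have r_l : r (up l) = c.
  have cyc := co_cyc K; move: cyc; rewrite -cat_cons -def_a def_Ew map_rcons.
  by rewrite -rcons_cat cat_rcons => /fcycle_adjacent.
have notW w f : w \in Wm -> r (up f) = dn w ->
    insert_before a (dn e) (insert_before c (up e) r) (up f) = dn w.
  move=> wW rf; have wA : w \in A by rewrite sub ?wW.
  have e1 : insert_before c (up e) r (up f) = dn w.
    rewrite insert_other rf // ?old //.
    case: cP => [[t -> tW]|[y -> _]]; last by rewrite xpair_eqE andbF.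
    by apply: contraNneq tW => -[<-].
  rewrite insert_other e1 ?old //.
  case: aP => [[t -> tW]|[_ [y -> _]]]; last by rewrite xpair_eqE andbF.
  by apply: contraNneq tW => -[<-].
have upc y : y \notin Wm ++ Wr -> up y != c.
  move=> yW; case: cP => [[t -> _]|[y' -> y'W]]; first by rewrite xpair_eqE andbF.
  by apply: contraNneq yW => -[->].
split=> //.
- rewrite outline_nil.
  have -> : ups (Wm ++ Wr) ++ downs ((Ea ++ H) ++ [::] ++ e :: Eb) =
      (ups (Wm ++ Wr) ++ downs (Ea ++ H)) ++ (dn e :: downs Eb).
    by rewrite -[[::] ++ _]/(e :: Eb) [downs (_ ++ e :: Eb)]map_cat catA.
  apply: core_rot; rewrite cat_cons def_c.
  apply: (core_chord (p := up l) (q := finv r a) K) (_ : a :: X = _) => //.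
  + by rewrite te vc.
  + by rewrite he va.
  + by rewrite f_finv //; apply: sewing_inj I.
  + by right.
  + case: aP => [[t -> _]|[H0 _]]; first exact: Or31.
    apply: Or33 => -[f []] //= fA; rewrite va => hf.
    by have := i_B I H0 fA; rewrite -hf eqxx.
  by rewrite -def_a def_Ew.
- by have [h [hA hC]] := i_rank I; exists h; split=> // f;
    rewrite in_setU1 => /orP[/eqP->|/hA//]; rewrite te he hC.
- exact: i_Wr0 I.
- exact: i_Wm I.
- exact: i_Wr I.
- by apply/dpath_cat; exists Ac; [apply: i_Ea I | apply: i_H I].
- by rewrite /= te he; split=> //; apply: i_Eb I.
- move=> f; rewrite in_setU1 => /orP[/eqP->|/(i_src I)].
    rewrite te -tl_l; case: (i_src I lA) => [?|[_]|[g gA hg]]; first exact: Or31.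
      by rewrite tl_l => CB; rewrite CB eqxx in BC.
    by apply: Or33; exists g; rewrite // in_setU1 gA orbT.
  case=> [?|[_ tf]|[g gA hg]]; [exact: Or31|apply: Or33..].
    by exists e; rewrite ?in_setU1 ?eqxx // he.
  by exists g; rewrite // in_setU1 gA orbT.
- by move=> f; rewrite in_setU1 => /orP[/eqP->|/(i_So I)//]; rewrite he.
- move=> f; rewrite in_setU1 => /orP[/eqP->|/(i_snk I)[->|[g gA hg]]].
  + rewrite he; have [->|[g gA hg]] := sewing_B_snk I; first by left.
    by right; exists g; rewrite // in_setU1 gA orbT.
  + by left.
  by right; exists g; rewrite // in_setU1 gA orbT.
- by move=> f; rewrite in_setU1 => /orP[/eqP->|/(i_No I)//]; rewrite te -tl_l (i_No I).
- move=> w wW; have [f fA rf] := i_low I wW; exists f; last exact: notW.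
  by rewrite in_setU1 fA orbT.
- move=> z; rewrite mem_cat => /orP[zE|zH].
    have [g gA rg] := i_high I zE; have zA : z \in A by rewrite sub // zE !orbT.
    exists g; first by rewrite in_setU1 gA orbT.
    have e1 : insert_before c (up e) r (dn g) = up z.
      by rewrite insert_other rg // ?old // upc // (i_EW I).
    rewrite insert_other e1 ?old //.
    case: aP => [[t -> tW]|[_ [y -> yH]]]; first by rewrite xpair_eqE andbF.
    have:= un2; rewrite cat_uniq => /and3P[_ /hasPn/(_ y)].
    by rewrite mem_cat yH => /(_ isT) yE _; apply: contraNneq yE => -[<-].
  have zA : z \in A by rewrite sub // zH !orbT.
  (* For [i_high], the downward dart before [up z] is the chord if [z] is the last edge of [H], and
     otherwise the edge of [H] just below [z]. *)
  have [a_z|a_z] := eqVneq (up z) a.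
    exists e; first by rewrite in_setU1 eqxx.
    have cA : c.1 \in A by apply: (co_sub K); rewrite in_cons mem_cat mem_head !orbT.
    have e1 : insert_before c (up e) r (dn e) = dn e.
      rewrite insert_other re ?xpair_eqE ?andbF //.
      by apply: contraNneq eA => ec; rewrite -[e]/((dn e).1) ec.
    rewrite [insert_before a _ _ _]/(insert_before _ _ _ _) /insert_before.
    rewrite -/(insert_before c (up e) r (dn e)) e1 eqxx -a_z.
    by rewrite [_ == _]xpair_eqE andbF.
  have := co_cyc K; rewrite -cat_cons -def_a; have: z \in rev H by rewrite mem_rev.
  case/splitPr def_H: _ / => [s1 s2]; case: (seq_last s1) def_H => [->|[s [y ->]]] def_H.
    by move: def_a; rewrite def_H => -[za _]; rewrite za eqxx in a_z.
  rewrite cat_rcons !map_cat -!catA /= => /fcycle_adjacent ry.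
  have yH : y \in H by rewrite -mem_rev def_H mem_cat mem_rcons mem_head.
  exists y; first by rewrite in_setU1 sub ?orbT // yH !orbT.
  have e1 : insert_before c (up e) r (dn y) = up z.
    by rewrite insert_other -[r (dn y)]/(fc r (up y)) ry ?old // upc // HW.
  by rewrite insert_other e1 ?old.
- move=> w wW; have := i_WE I wW; rewrite !mem_cat in_cons !negb_or => /andP[-> ->].
  rewrite andbT /=; apply/andP; split.
    by apply: contraTN wW => /HW; rewrite mem_cat negb_or => /andP[].
  by apply: contraNneq eA => <-; rewrite sub ?wW.
by move=> z; rewrite mem_cat => /orP[/(i_EW I)|/HW].
Qed.

End Invariant.

(** * Embedded maps and the sewing steps *)

Import Defs.

Definition gd (E E' : Type) (g : E -> E') (d : E * bool) : E' * bool := (g d.1, d.2).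

Lemma gd_ups (E E' : Type) (g : E -> E') s : map (gd g) (ups s) = ups (map g s).
Proof. by rewrite -!map_comp. Qed.

Lemma gd_downs (E E' : Type) (g : E -> E') s :
  map (gd g) (downs s) = downs (map g s).
Proof. by rewrite -!map_comp. Qed.

Lemma ohead_map (T T' : Type) (h : T -> T') s : ohead (map h s) = omap h (ohead s).
Proof. by case: s. Qed.

Section Embedding.
Variables (M : map_data) (V E : finType) (tl hd : E -> V).
Variables (f : vertex M -> V) (g : edge M -> E) (A : {set E}).
Variable (r : E * bool -> E * bool).
Notation vt := (dart_vertex tl hd).

(** [M] is realised as the part of the ambient oriented map over [A]. This serves three purposes: a
    map inside the one obtained by a sewing step, a built map inside a given marked map, and two
    built maps inside a common one. *)
Record emb : Prop := Emb {
  emb_f : injective f;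
  emb_g : injective g;
  emb_A : forall e, (e \in A) = (e \in codom g);
  emb_tl : forall x, tl (g x) = f (tail x);
  emb_hd : forall x, hd (g x) = f (head x);
  emb_rot : forall d, r (gd g d) = gd g (rot d)
}.

Hypothesis em : emb.

Lemma emb_mem x : g x \in A.
Proof. by rewrite (emb_A em) codom_f. Qed.

Lemma emb_ex e : e \in A -> exists x, e = g x.
Proof. by rewrite (emb_A em) => /codomP. Qed.

Lemma gd_inj : injective (gd g).
Proof. by move=> [x b] [y b'] [/(emb_g em)-> ->]. Qed.

Lemma emb_vt d : vt (gd g d) = f (vert d).
Proof. by case: d => x []; rewrite /vt /vert /= ?(emb_tl em) ?(emb_hd em). Qed.

Lemma emb_fc d : fc r (gd g d) = gd g (face d).
Proof. exact: emb_rot em (d.1, ~~ d.2). Qed.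

Lemma emb_dart d : d.1 \in A -> exists d0, d = gd g d0.
Proof. by case: d => e b /= /emb_ex[x ->]; exists (x, b). Qed.

Lemma emb_face_connect d d' :
  fconnect (fc r) (gd g d) (gd g d') = fconnect (@face M) d d'.
Proof.
apply/idP/idP; last first.
  by apply: fconnect_img => x; rewrite -emb_fc fconnect1.
move/fconnectP_iter=> [n]; have -> : iter n (fc r) (gd g d) = gd g (iter n (@face M) d).
  by elim: n => //= n ->; rewrite emb_fc.
by move/gd_inj->; rewrite fconnect_iter.
Qed.

Lemma gd_outline Wm Wr Ea H Ew Eb : map (gd g) (outline Wm Wr Ea H Ew Eb) =
  outline (map g Wm) (map g Wr) (map g Ea) (map g H) (map g Ew) (map g Eb).
Proof. by rewrite /outline !map_cat -!map_comp -map_rev -!map_comp. Qed.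

Lemma emb_core O : injective r -> core (@tail M) (@head M) setT (@rot M) O ->
  core tl hd A r (map (gd g) O).
Proof.
move=> ri [vs cyc un sub face]; split.
- split=> //.
  + move=> d; rewrite !inE; apply/idP/idP; last first.
      by case/emb_dart => d0 ->; rewrite (emb_rot em) emb_mem.
    case/emb_dart=> d1 e; have := f_finv (vs_inj vs) d1.
    set d0 := finv _ _ => e0; rewrite -e0 -(emb_rot em) in e.
    by rewrite (ri _ _ e) emb_mem.
  + move=> d; rewrite inE => /emb_dart[d0 ->].
    by rewrite (emb_rot em) !emb_vt; congr f; apply: (vs_vt vs); rewrite inE.
  + move=> d d'; rewrite !inE => /emb_dart[d0 ->] /emb_dart[d0' ->].
    rewrite !emb_vt => /(emb_f em) e.
    apply: (fconnect_img (f := @rot M)) => [x|]; first by rewrite -(emb_rot em) fconnect1.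
    by apply: (vs_orb vs); rewrite ?inE.
  move=> d d'; rewrite !inE => /emb_dart[d0 ->] /emb_dart[d0' ->].
  rewrite !emb_vt !(emb_rot em) => /(emb_f em) e ? ? ? ?.
  by congr gd; apply: (vs_one vs); rewrite ?inE.
- apply: homo_cycle cyc => d d' /eqP <-.
  by rewrite -[fc _ d]/(Defs.face d) -emb_fc /= eqxx.
- by rewrite map_inj_uniq //; apply: gd_inj.
- by move=> _ /mapP[d _ ->]; apply: emb_mem.
move=> e e' /emb_ex[x ->] /emb_ex[x' ->].
rewrite -![(g _, _)]/(gd g (_, _)) !(emb_rot em) (mem_map gd_inj) emb_face_connect.
by move=> ? ? ? ?; congr g; apply: face; rewrite ?inE.
Qed.

Lemma emb_upath u s v : upath (@tail M) (@head M) u s v ->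
  upath tl hd (f u) (map g s) (f v).
Proof.
elim: s u => [|x s IHs] u /=; first by move->.
by case=> <- /IHs; rewrite (emb_tl em) (emb_hd em).
Qed.

Lemma emb_dpath u s v : dpath (@tail M) (@head M) u s v ->
  dpath tl hd (f u) (map g s) (f v).
Proof.
elim: s u => [|x s IHs] u /=; first by move->.
by case=> <- /IHs; rewrite (emb_tl em) (emb_hd em).
Qed.

Lemma map_nil (T T' : eqType) (h : T -> T') s : (map h s != [::]) = (s != [::]).
Proof. by case: s. Qed.

Lemma emb_sewing Wm Wr Ea H Ew Eb So St No Ac B C : injective r ->
  sewing (@tail M) (@head M) setT (@rot M) Wm Wr Ea H Ew Eb So St No Ac B C ->
  sewing tl hd A r (map g Wm) (map g Wr) (map g Ea) (map g H) (map g Ew)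
    (map g Eb) (f So) (f St) (f No) (f Ac) (f B) (f C).
Proof.
move=> ri I.
have gI x (s : seq (edge M)) : (g x \in map g s) = (x \in s).
  by rewrite mem_map //; apply: emb_g em.
split.
- by rewrite -gd_outline; apply: emb_core (i_core I).
- have [h [hA hC]] := i_rank I.
  (* The height is transported along [f]. Vertices outside the image get the default 0; no edge of
     [A] ends at them. *)
  exists (fun v => if [pick u | f u == v] is Some u then h u else 0).
  have pickf u : [pick u' | f u' == f u] = Some u.
    case: pickP => [u' /eqP/(emb_f em)-> //|/(_ u)]; by rewrite eqxx.
  split=> [e /emb_ex[x ->]|]; last by rewrite map_nil !pickf.
  by rewrite (emb_tl em) (emb_hd em) !pickf; apply: hA.
- by rewrite map_nil (i_Wr0 I).
- exact: emb_upath (i_Wm I).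
- exact: emb_upath (i_Wr I).
- exact: emb_dpath (i_Ea I).
- exact: emb_dpath (i_H I).
- exact: emb_dpath (i_Ew I).
- exact: emb_dpath (i_Eb I).
- move=> _ /emb_ex[x ->]; rewrite (emb_tl em) map_nil.
  case: (i_src I (in_setT x)) => [->|[? ->]|[y _ <-]]; [exact: Or31|exact: Or32|apply: Or33].
  by exists (g y); rewrite ?emb_mem ?(emb_hd em).
- by move=> _ /emb_ex[x ->]; rewrite (emb_hd em) (inj_eq (emb_f em)) (i_So I).
- rewrite map_nil => H0 _ /emb_ex[x ->].
  by rewrite (emb_hd em) (inj_eq (emb_f em)) (i_B I).
- move=> _ /emb_ex[x ->]; rewrite (emb_hd em).
  case: (i_snk I (in_setT x)) => [->|[y _ <-]]; first by left.
  by right; exists (g y); rewrite ?emb_mem ?(emb_tl em).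
- by move=> _ /emb_ex[x ->]; rewrite (emb_tl em) (inj_eq (emb_f em)) (i_No I).
- move=> _ /mapP[w wW ->]; have [x _ rx] := i_low I wW.
  by exists (g x); rewrite ?emb_mem // -[(g x, _)]/(gd g (up x)) (emb_rot em) rx.
- move=> _ /mapP[w wW ->]; have [x _ rx] := i_high I wW.
  by exists (g x); rewrite ?emb_mem // -[(g x, _)]/(gd g (dn x)) (emb_rot em) rx.
- by move=> _ /mapP[w /(i_WE I) wE ->]; rewrite -map_cat gI.
- by move=> _ /mapP[w /(i_EW I) wE ->]; rewrite -map_cat gI.
move=> x s; case: Ew I => //= y Ew I [<- _].
by rewrite gI (i_top I (erefl _)).
Qed.

End Embedding.

Lemma setC1U (E : finType) : None |: [set~ None] = [set: option E].
Proof. by apply/setP=> x; rewrite !inE orbN. Qed.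

Lemma old_inj (E : Type) : injective (@old E).
Proof. by case=> [x b] [y b'] [-> ->]. Qed.

Lemma old_rot_inj (E : Type) (r : E * bool -> E * bool) :
  injective r -> injective (old_rot r).
Proof. by move=> ri [[x|] b] [[y|] b'] //= /old_inj/ri[-> ->]. Qed.

Lemma leaf_emb (M : map_data) b (c : dart M) s n a :
  emb (M := M) (@tail (add_leaf b c s n a)) (@head (add_leaf b c s n a)) Some Some
    [set~ None] (old_rot (@rot M)).
Proof.
split=> //; try by move=> x y [].
- by case=> [x|]; rewrite !inE; apply/esym/codomP; [exists x|case].
- by case.
Qed.

Lemma chord_emb (M : map_data) (c a : dart M) :
  emb (M := M) (@tail (add_chord c a)) (@head (add_chord c a))
    (id : vertex M -> vertex M) Some
    [set~ None] (old_rot (@rot M)).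
Proof.
split=> //; try by move=> x y [].
- by case=> [x|]; rewrite !inE; apply/esym/codomP; [exists x|case].
- by case.
Qed.

(** [sewing] constrains vertices only through the edges, so the absence of isolated vertices is
    added here, as well as the position of the dart [outer]. *)
Definition mstate (M : map_data) Wm Wr Ea H Ew Eb B C : Prop :=
  [/\ sewing (@tail M) (@head M) setT (@rot M) Wm Wr Ea H Ew Eb
        (south M) (start M) (north M) (active M) B C,
      forall v : vertex M, exists d, vert d = v &
      outer M \in outline Wm Wr Ea H Ew Eb].

Definition mmark (M : map_data) Wm Wr Ea Eb : Prop :=
  @mstate M Wm Wr Ea [::] [::] Eb (active M) (active M).

Lemma mmark_set (M : map_data) Wm Wr Ea (z : edge M) Eb :
  @mmark M Wm Wr (rcons Ea z) Eb -> @mmark (set_active (head z)) Wm Wr Ea (z :: Eb).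
Proof.
case=> I live out; split=> //; first exact: (fwd_set I).
by move: out; rewrite !outline_nil cat_rcons.
Qed.

Lemma leaf_live (M : map_data) b (c : dart M) s n a (v : vertex (add_leaf b c s n a)) :
  (forall v : vertex M, exists d, vert d = v) -> exists d, vert d = v.
Proof.
move=> live; case: v => [v|]; last by exists (None, ~~ b); case: b.
have [[x b'] <-] := live v; exists (Some x, b').
by rewrite /vert /=; case: b'.
Qed.

Lemma mmark_top (M : map_data) Wm Wr (x : edge M) Eb :
  @mmark M Wm Wr [::] (x :: Eb) ->
  @mmark (@add_leaf M true (x, false) (Some (south M)) None None)
    (map Some Wm) (rcons (map Some Wr) None) [::] (None :: Some x :: map Some Eb).
Proof.
case=> I live out; split.
- have ri := old_rot_inj (sewing_inj I).
  rewrite -setC1U; have := emb_sewing (leaf_emb _ _ _ _ _) ri I.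
  move=> /(_ true (x, false) (Some (south M)) None None) {}I.
  apply: (fwd_top I) => //=; first by rewrite !inE.
    by rewrite /vert /=; congr Some; case: (i_Eb I) => [] [].
  by case=> -[y|] [] //=; rewrite !inE.
- by move=> v; apply: leaf_live live.
by rewrite outline_nil !mem_cat mem_downs !mem_head !orbT.
Qed.

(** The corners are darts of a map whose type changes at each step; bundling them with the map turns
    the recursions of the sewing into iterations. *)
Record pointed := Pointed { pm : map_data; pc : dart pm; pa : dart pm }.

Definition walk_step (p : pointed) : pointed :=
  if vert (pc p) == south (pm p) then
    @Pointed (@add_leaf (pm p) false (pc p) None (Some (north (pm p))) (Some (active (pm p))))
      (None, true) (old (pa p))
  else Pointed (face (pc p)) (pa p).

Definition hang_step (p : pointed) : pointed :=
  @Pointed (@add_leaf (pm p) false (pa p) (Some (south (pm p)))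
    (Some (north (pm p))) (Some (active (pm p)))) (old (pc p)) (None, true).

Lemma sew_eastE j p : sew_east j (pc p) (pa p) =
  add_chord (pc (iter j hang_step p)) (pa (iter j hang_step p)).
Proof. by elim: j p => // j IHj p; rewrite iterSr -IHj. Qed.

Lemma sew_faceE k j p : sew_face k j (pc p) (pa p) =
  sew_east j (pc (iter k walk_step p)) (pa (iter k walk_step p)).
Proof.
elim: k p => // k IHk p; rewrite iterSr -IHk /= /walk_step.
by case: ifP.
Qed.

(** Both corners are read off the outline: [pa] comes right after the descent along [H], and [pc]
    right after [Ew], passing to the western boundary when [Eb] is exhausted. *)
Definition pstate (p : pointed) Wm Wr Ea H Ew Eb B C : Prop :=
  [/\ @mstate (pm p) Wm Wr Ea H Ew Eb B C,
      ohead (ups (rev H) ++ downs (Ew ++ Eb)) = Some (pa p) &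
      ohead (downs Eb ++ ups (Wm ++ Wr)) = Some (pc p)].

Lemma mmark_pstate (M : map_data) Wm Wr Ea (x : edge M) Eb :
  @mmark M Wm Wr Ea (x :: Eb) ->
  @pstate (@Pointed M (x, false) (x, false)) Wm Wr Ea [::] [::] (x :: Eb) (active M) (active M).
Proof. by split. Qed.

Lemma pc_south (p : pointed) Wm Wr Ea H Ew Eb B C :
  @pstate p Wm Wr Ea H Ew Eb B C -> (vert (pc p) == south (pm p)) = (Eb == [::]).
Proof.
case=> -[I _ _] _; case: Eb I => [|x Eb] I /=.
  case def_W: (Wm ++ Wr) => [|w Ws] /=.
    by case: (Wm) (Wr) (i_Wr0 I) def_W => [|? ?] [|? ?].
  move=> [<-]; have : upath (@tail _) (@head _) (south (pm p)) (Wm ++ Wr) (north (pm p)).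
    by apply/upath_cat; exists (start (pm p)); [apply: i_Wm I | apply: i_Wr I].
  by rewrite def_W => -[<- _]; rewrite /vert /= !eqxx.
by move=> [<-]; rewrite /vert /= (negbTE (i_So I (in_setT x))).
Qed.

Lemma pstate_walk (p : pointed) Wm Wr Ea Ew x Eb B C :
  @pstate p Wm Wr Ea [::] Ew (x :: Eb) B C ->
  walk_step p = Pointed (face (pc p)) (pa p) /\
  @pstate (Pointed (face (pc p)) (pa p)) Wm Wr Ea [::] (rcons Ew x) Eb B (tail x).
Proof.
move=> P; have pS := pc_south P; rewrite /walk_step pS; split=> //.
case: P => -[I live out] ha [hc]; split=> /=.
- split=> //; first exact: (fwd_walk I).
  by move: out; rewrite !outline_nil cat_rcons.
- by rewrite cat_rcons.
case def_c: (downs Eb ++ ups (Wm ++ Wr)) => [|d s].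
  by case: (Eb) (Wm) (Wr) (i_Wr0 I) def_c => [|? ?] [|? ?] [|? ?].
congr Some; have := i_core I; rewrite outline_nil.
have -> : ups (Wm ++ Wr) ++ downs (Ea ++ Ew ++ x :: Eb) =
    (ups (Wm ++ Wr) ++ downs (Ea ++ Ew)) ++ downs (x :: Eb).
  by rewrite -catA -map_cat -catA.
move=> /core_rot/co_cyc; rewrite catA [downs (x :: Eb)]/= !cat_cons def_c.
by case: hc => <- /= /andP[/eqP].
Qed.

Lemma chord_live (M : map_data) (c a : dart M) (v : vertex (add_chord c a)) :
  (forall v : vertex M, exists d, vert d = v) -> exists d, vert d = v.
Proof.
move=> live; have [[x b] <-] := live v; exists (Some x, b).
by rewrite /vert /=; case: b.
Qed.

Lemma pstate_ext (p : pointed) Wm Wr Ea Ew B C :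
  @pstate p Wm Wr Ea [::] Ew [::] B C -> Ew != [::] ->
  let q := @Pointed (@add_leaf (pm p) false (pc p) None (Some (north (pm p)))
    (Some (active (pm p)))) (None, true) (old (pa p)) in
  walk_step p = q /\
  @pstate q (None :: map Some Wm) (map Some Wr) (map Some Ea) [::]
    (rcons (map Some Ew) None) [::] (Some B) None.
Proof.
move=> P Ew0 q; have pS := pc_south P; rewrite /walk_step pS; split=> //.
case: P pS => -[I live out] ha hc /eqP pS; split=> /=.
- split; first 1 last.
  + by move=> v; apply: leaf_live live.
  + by rewrite outline_nil mem_cat mem_downs !mem_cat mem_rcons mem_head !orbT.
  have ri := old_rot_inj (sewing_inj I); rewrite -setC1U.
  case def_W: (Wm ++ Wr) hc => [//|w Ws] /= [def_c].
  have := emb_sewing (leaf_emb false (pc p) None (Some (north (pm p)))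
    (Some (active (pm p)))) ri I.
  move=> /fwd_ext; rewrite map_nil -map_cat def_W -def_c.
  move=> /(_ _ _ None Ew0 (erefl _)); apply=> //=.
  + by rewrite !inE.
  + by rewrite -pS -def_c.
  by case=> -[x|] []; rewrite !inE.
- case: (Ew) Ew0 ha => // x s _ /= [<-] //.
by [].
Qed.

Lemma pstate_hang (p : pointed) Wm Wr Ea H Ew Eb B C :
  @pstate p Wm Wr Ea H Ew Eb B C -> Ew != [::] ->
  @pstate (hang_step p) (map Some Wm) (map Some Wr) (map Some Ea)
    (rcons (map Some H) None) (map Some Ew) (map Some Eb) None (Some C).
Proof.
case=> -[I live out] ha hc Ew0; split=> /=.
- split; first 1 last.
  + by move=> v; apply: leaf_live live.
  + by rewrite !mem_cat mem_downs !mem_cat mem_rcons mem_head !orbT.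
  have ri := old_rot_inj (sewing_inj I); rewrite -setC1U.
  case def_a: (ups (rev H) ++ downs (Ew ++ Eb)) ha => [//|a X] [ha].
  have := emb_sewing (leaf_emb false (pa p) (Some (south (pm p)))
    (Some (north (pm p))) (Some (active (pm p)))) ri I.
  have def_a' : ups (rev (map Some H)) ++ downs (map Some Ew ++ map Some Eb) =
      old (pa p) :: map (gd Some) X.
    by rewrite -ha -[RHS]/(map (gd Some) (a :: X)) -def_a -map_cat [RHS]map_cat -map_rev -!map_comp.
  move=> J; apply: (fwd_hang J _ def_a') => //=.
  + by rewrite map_nil.
  + by rewrite !inE.
  + have [va _] := sewing_corner I Ew0 def_a.
    by rewrite -va -ha.
  by case=> -[x|] []; rewrite !inE.
- by rewrite rev_rcons.
by rewrite -map_cat -gd_downs -gd_ups -map_cat ohead_map hc.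
Qed.

Lemma mmark_chord (p : pointed) Wm Wr Ea H Ew Eb B C :
  @pstate p Wm Wr Ea H Ew Eb B C -> Ew != [::] ->
  @mmark (add_chord (pc p) (pa p)) (map Some Wm) (map Some Wr)
    (map Some (Ea ++ H)) (None :: map Some Eb).
Proof.
case=> -[I live out] ha hc Ew0; split; first 1 last.
- by move=> v; apply: chord_live live.
- by rewrite outline_nil !mem_cat !mem_downs !mem_cat mem_head !orbT.
have ri := old_rot_inj (sewing_inj I); rewrite -setC1U.
have ha' : ohead (ups (rev H) ++ downs Ew) = Some (pa p).
  by move: ha; rewrite map_cat catA; case: (rev H) (Ew) Ew0 => [|? ?] [|? ?].
have hc' : ohead (downs Eb ++ ups (Wm ++ Wr) ++ downs (Ea ++ H)) = Some (pc p).
  by move: hc; rewrite catA; case: (_ ++ ups _).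
case def_a: (ups (rev H) ++ downs Ew) ha' => [//|a X] [a_pa].
case def_c: (downs Eb ++ ups (Wm ++ Wr) ++ downs (Ea ++ H)) hc' => [//|c Y] [c_pc].
have def_a' : ups (rev H) ++ downs (Ew ++ Eb) = a :: X ++ downs Eb.
  by rewrite map_cat catA def_a.
have J := emb_sewing (chord_emb (pc p) (pa p)) ri I.
have [va _] := sewing_corner I Ew0 def_a'; have vB : vert (pa p) = B by rewrite -a_pa.
have [vc _] := sewing_walked I def_c; have vC : vert (pc p) = C by rewrite -c_pc.
rewrite map_cat (_ : active (add_chord (pc p) (pa p)) = B) -?vB // vB.
apply: (fwd_chord (e := None) J); rewrite ?map_nil //.
- by rewrite -map_rev -gd_ups -gd_downs -map_cat def_a a_pa.
- by rewrite -!map_cat -!gd_ups -!gd_downs -!map_cat def_c c_pc.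
- by rewrite !inE.
Qed.

(** * The edges of the eastern boundary at the active vertex *)

Section Boundary.
Variables (V E : finType) (tl hd : E -> V).
Notation marking := (marking tl hd).
Section Paths.
Variable h : V -> nat.
Implicit Types (s : seq E) (u v : V) (x y : E).

Lemma dpath_le s u v : (forall e, e \in s -> h (tl e) < h (hd e)) ->
  dpath tl hd u s v -> h v <= h u.
Proof.
elim: s u => /= [u _ -> //|y s IHs u hs [<- p]].
apply: leq_trans (ltnW (hs y (mem_head _ _))); apply: IHs p => e es.
by apply: hs; rewrite in_cons es orbT.
Qed.

Lemma dpath_bounds s u v x : (forall e, e \in s -> h (tl e) < h (hd e)) ->
  dpath tl hd u s v -> x \in s -> h (hd x) <= h u /\ h v <= h (tl x).
Proof.
elim: s u => //= y s IHs u hs [<- p]; have lt_y := hs y (mem_head _ _).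
have {}hs e : e \in s -> h (tl e) < h (hd e).
  by move=> es; apply: hs; rewrite in_cons es orbT.
rewrite in_cons => /predU1P[->|/(IHs _ hs p)[le_x ->]]; last first.
  by rewrite (leq_trans le_x) // ltnW.
split=> //; apply: dpath_le hs p.
Qed.

Lemma dpath_hd_inj s u v x y : (forall e, e \in s -> h (tl e) < h (hd e)) ->
  dpath tl hd u s v -> x \in s -> y \in s -> hd x = hd y -> x = y.
Proof.
elim: s u => //= z s IHs u hs [_ p]; have lt_z := hs z (mem_head _ _).
have {}hs e : e \in s -> h (tl e) < h (hd e).
  by move=> es; apply: hs; rewrite in_cons es orbT.
have no e : e \in s -> hd z = hd e -> z = e.
  move=> /(dpath_bounds hs p)[le_e _] ze.
  by rewrite -ze leqNgt lt_z in le_e.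
rewrite !in_cons => /predU1P[->|xs] /predU1P[->|ys] //; first exact: no.
  by move/esym/(no _ xs).
exact: IHs p xs ys.
Qed.

Lemma dpath_tl_inj s u v x y : (forall e, e \in s -> h (tl e) < h (hd e)) ->
  dpath tl hd u s v -> x \in s -> y \in s -> tl x = tl y -> x = y.
Proof.
elim: s u => //= z s IHs u hs [_ p].
have {}hs e : e \in s -> h (tl e) < h (hd e).
  by move=> es; apply: hs; rewrite in_cons es orbT.
have no e : e \in s -> tl z = tl e -> z = e.
  move=> es; have [+ _] := dpath_bounds hs p es => + ze.
  by rewrite ze leqNgt hs.
rewrite !in_cons => /predU1P[->|xs] /predU1P[->|ys] //; first exact: no.
  by move/esym/(no _ xs).
exact: IHs p xs ys.
Qed.

End Paths.

Variables (A : {set E}) (r : E * bool -> E * bool) (Wm Wr Ea Eb : seq E).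
Variables (So St No Ac : V).
Hypothesis I : marking A r Wm Wr Ea Eb So St No Ac.

(** Heights decrease strictly down the eastern boundary, so its edges have distinct heads. This
    makes the choice by [pick] in [edge_below] unambiguous. *)
Lemma marking_below e : e \in Ea ++ Eb -> hd e = Ac -> exists Eb', Eb = e :: Eb'.
Proof.
have [h [hA _ _ _]] := sewing_rank I; have sub := sewing_sub I.
have hE x : x \in Ea ++ Eb -> x \in A.
  by rewrite mem_cat => /orP[] xE; rewrite sub // xE !orbT.
have p : dpath tl hd No (Ea ++ Eb) So.
  by apply/dpath_cat; exists Ac; [apply: i_Ea I | apply: i_Eb I].
move=> eE he; have := i_Eb I; case def_Eb: Eb => [|x s] /= => [AcS|[hx _]].
  by have := i_So I (hE _ eE); rewrite he AcS eqxx.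
exists s; congr (_ :: _); apply: (dpath_hd_inj (h := h) _ p) => //.
- by move=> y /hE/hA.
- by rewrite def_Eb mem_cat mem_head orbT.
by rewrite he.
Qed.

Lemma marking_above e : e \in Ea ++ Eb -> tl e = Ac -> exists Ea', Ea = rcons Ea' e.
Proof.
have [h [hA _ _ _]] := sewing_rank I; have sub := sewing_sub I.
have hE x : x \in Ea ++ Eb -> x \in A.
  by rewrite mem_cat => /orP[] xE; rewrite sub // xE !orbT.
have p : dpath tl hd No (Ea ++ Eb) So.
  by apply/dpath_cat; exists Ac; [apply: i_Ea I | apply: i_Eb I].
move=> eE te; case: (seq_last Ea) (i_Ea I) => [->/= NoAc|[s [x def_Ea]]].
  by have := i_No I (hE _ eE); rewrite te NoAc eqxx.
rewrite {1}def_Ea => /dpath_rcons[_ tx].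
exists s; rewrite def_Ea; congr rcons; apply: (dpath_tl_inj (h := h) _ p) => //.
- by move=> y /hE/hA.
- by rewrite def_Ea mem_cat mem_rcons mem_head.
by rewrite te.
Qed.

End Boundary.

Section Marked.
Variables (M : map_data) (Wm Wr Ea Eb : seq (edge M)).
Hypothesis P : mmark Wm Wr Ea Eb.

Lemma on_outerE d : on_outer d = (d \in outline Wm Wr Ea [::] [::] Eb).
Proof. by case: P => I _ out; apply: (fconnect_cycle (co_cyc (i_core I)) out). Qed.

Lemma east_edgeE e : east_edge e = (e \in Ea ++ Eb).
Proof. by rewrite /east_edge on_outerE mem_outline. Qed.

Lemma west_edgeE e : west_edge e = (e \in Wm ++ Wr).
Proof. by rewrite /west_edge on_outerE mem_outline cats0. Qed.

Lemma edge_belowE x s : Eb = x :: s -> edge_below M = Some x.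
Proof.
case: P => I _ _ def_Eb; rewrite /edge_below; case: pickP => [e|/(_ x)].
  rewrite east_edgeE => /andP[eE /eqP he].
  by case: (marking_below I eE he) => s'; rewrite def_Eb => -[->].
have [hx _] : dpath (@tail M) (@head M) (active M) (x :: s) (south M).
  by rewrite -def_Eb; apply: i_Eb I.
by rewrite east_edgeE def_Eb mem_cat mem_head orbT hx eqxx.
Qed.

Lemma edge_aboveE : Ea = [::] /\ edge_above M = None \/
  exists s z, Ea = rcons s z /\ edge_above M = Some z.
Proof.
case: P => I _ _; rewrite /edge_above; case: pickP => [e|no].
  rewrite east_edgeE => /andP[eE /eqP te].
  by case: (marking_above I eE te) => s ->; right; exists s, e.
case: (seq_last Ea) (i_Ea I) => [->|[s [z def_Ea]]]; first by left.
rewrite {1}def_Ea => /dpath_rcons[_ tz]; have := no z.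
by rewrite east_edgeE {1}def_Ea mem_cat mem_rcons mem_head tz eqxx.
Qed.

End Marked.

Lemma walk_iter k (p : pointed) Wm Wr Ea Ew Eb B C :
  @pstate p Wm Wr Ea [::] Ew Eb B C -> Ew ++ Eb != [::] ->
  exists Wm' Wr' Ea' Ew' Eb' B' C',
    [/\ @pstate (iter k walk_step p) Wm' Wr' Ea' [::] Ew' Eb' B' C',
        Ew' ++ Eb' != [::] & (0 < k) || (Ew != [::]) -> Ew' != [::]].
Proof.
elim: k p Wm Wr Ea Ew Eb B C => [|k IHk] p Wm Wr Ea Ew Eb B C Pp nE.
  by exists Wm, Wr, Ea, Ew, Eb, B, C; split.
rewrite iterSr; case: Eb Pp nE => [|x Eb] Pp nE.
  rewrite cats0 in nE; have [-> Pq] := pstate_ext Pp nE.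
  case: (IHk _ _ _ _ _ _ _ _ Pq) => [|Wm' [Wr' [Ea' [Ew' [Eb' [B' [C' [Pk n1 n2]]]]]]]].
    by rewrite -size_eq0 size_cat size_rcons.
  exists Wm', Wr', Ea', Ew', Eb', B', C'; split=> // _; apply: n2.
  by rewrite -size_eq0 size_rcons orbT.
have [-> Pq] := pstate_walk Pp.
case: (IHk _ _ _ _ _ _ _ _ Pq) => [|Wm' [Wr' [Ea' [Ew' [Eb' [B' [C' [Pk n1 n2]]]]]]]].
  by rewrite -size_eq0 size_cat size_rcons.
exists Wm', Wr', Ea', Ew', Eb', B', C'; split=> // _; apply: n2.
by rewrite -size_eq0 size_rcons orbT.
Qed.

Lemma hang_iter j (p : pointed) Wm Wr Ea H Ew Eb B C :
  @pstate p Wm Wr Ea H Ew Eb B C -> Ew != [::] ->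
  exists Wm' Wr' Ea' H' Ew' Eb' B' C',
    @pstate (iter j hang_step p) Wm' Wr' Ea' H' Ew' Eb' B' C' /\ Ew' != [::].
Proof.
elim: j p Wm Wr Ea H Ew Eb B C => [|j IHj] p Wm Wr Ea H Ew Eb B C Pp nE.
  by exists Wm, Wr, Ea, H, Ew, Eb, B, C; split.
rewrite iterSr; apply: IHj (pstate_hang Pp nE) _.
by rewrite map_nil.
Qed.

Lemma mmark_apply (M : map_data) Wm Wr Ea Eb m :
  @mmark M Wm Wr Ea Eb -> Eb != [::] ->
  exists Wm' Wr' Ea' Eb', @mmark (apply_move M m) Wm' Wr' Ea' Eb' /\ Eb' != [::].
Proof.
case: Eb => // x Eb P _; case: m => [|i j] /=; rewrite (edge_belowE P (erefl _)).
  have [[Ea0 ->]|[s [z [def_Ea ->]]]] := edge_aboveE P.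
    rewrite Ea0 in P; do 4!eexists; split; first exact: (mmark_top P).
    by [].
  rewrite def_Ea in P; do 4!eexists; split; first exact: (mmark_set P).
  by [].
suff K : exists Wm' Wr' Ea' Eb', @mmark (@sew_face i.+1 j M (x, false) (x, false))
    Wm' Wr' Ea' Eb' /\ Eb' != [::] by case: (edge_above M).
rewrite (sew_faceE i.+1 j (@Pointed M (x, false) (x, false))) sew_eastE.
have [Wm1 [Wr1 [Ea1 [Ew1 [Eb1 [B1 [C1 [P1 _ n1]]]]]]]] :=
  walk_iter i.+1 (mmark_pstate P) isT.
have [Wm2 [Wr2 [Ea2 [H2 [Ew2 [Eb2 [B2 [C2 [P2 n2]]]]]]]]] := hang_iter j P1 (n1 isT).
by do 4!eexists; split; first exact: (mmark_chord P2 n2).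
Qed.

Lemma mmark_single : @mmark single_edge [::] [:: tt] [::] [:: tt].
Proof.
split; last by [].
  split=> //.
  - split=> //; split=> //.
      by move=> [[] b] [[] b'] _ _; case: b; case: b' => // _; apply: connect0.
    by case=> -[] [] [[] []].
  - by exists nat_of_bool; split=> // -[].
  - by move=> [] _; apply: Or31.
  by move=> [] _; left.
by case; [exists (tt, false)|exists (tt, true)].
Qed.

Lemma mmark_moves s : exists Wm Wr Ea Eb,
  @mmark (map_of_moves s) Wm Wr Ea Eb /\ Eb != [::].
Proof.
elim/last_ind: s => [|s m [Wm [Wr [Ea [Eb [P nE]]]]]].
  by do 4!eexists; split; first exact: mmark_single.
by rewrite /map_of_moves -cats1 foldl_cat; apply: mmark_apply P nE.
Qed.

(** * Euler's formula *)

Section Count.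
Variable M : map_data.
Hypothesis rot_i : injective (@rot M).
Hypothesis rot_v : forall d d' : dart M, fconnect (@rot M) d d' = (vert d == vert d').
Variable h : vertex M -> nat.
Hypothesis h_lt : forall e, h (tail e) < h (head e).
Hypothesis S_N : south M != north M.
Hypothesis S_in : forall e : edge M, head e != south M.
Hypothesis N_out : forall e : edge M, tail e != north M.
Hypothesis in_ex : forall v, v != south M -> exists e, head e = v.
Hypothesis out_ex : forall v, v != north M -> exists e, tail e = v.

(** The edges at which the upward group of their tail ends; each remaining edge has on its east a
    face with a bottom corner at its tail. *)
Definition turning : {set edge M} := [set e | ~~ (@rot M (e, true)).2].

Lemma vert_rot d : vert (@rot M d) = vert d.
Proof. by apply/esym/eqP; rewrite -rot_v fconnect1. Qed.

Lemma vert_face d : vert (@face M d) = vert (d.1, ~~ d.2).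
Proof. exact: vert_rot. Qed.

Lemma face_i : injective (@face M).
Proof. exact: fc_inj rot_i. Qed.

(** A vertex other than a pole has both upward and downward darts, so its rotation passes somewhere
    from the former to the latter; a pole has only one kind. *)
Lemma card_vertex : #|vertex M| = #|[set tail e | e in turning]| + 2.
Proof.
have -> : [set tail e | e in turning] = ~: [set south M; north M].
  apply/setP=> v; rewrite !inE negb_or; apply/imsetP/andP => [[e]|[vS vN]].
    rewrite inE; case def_d: (rot _) => [e' []] //= _ ->; split=> //.
    by have := vert_rot (e, true); rewrite def_d /vert /= => <-.
  have [e1 t1] := out_ex vN; have [e2 h2] := in_ex vS.
  have conn : fconnect (@rot M) (e1, true) (e2, false).
    by rewrite rot_v /vert /= t1 h2 eqxx.
  have [] := fconnect_change (P := fun d => d.2) conn isT isT.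
  case=> e [] [c //= _ re]; exists e; first by rewrite inE.
  by apply/esym/eqP; move: c; rewrite rot_v /vert /= t1 eq_sym.
by have := cardsC [set south M; north M]; rewrite cards2 S_N addnC => ->; rewrite -cardsT.
Qed.

(** A face whose darts were all upward would increase the height forever around its finite orbit,
    and similarly downwards. So both kinds occur, and a downward dart is followed by an upward
    one. *)
Lemma face_bottom d : exists2 e, e \notin turning & fconnect (@face M) d (e, false).
Proof.
have no_up : ~ (forall z, fconnect (@face M) d z -> z.2).
  move=> up_z; apply: (fconnect_increasing (h := fun z => h (vert z)) (x := d) face_i).
  by move=> z /up_z; rewrite vert_face; case: z => e [] //= _; apply: h_lt.
have no_dn : ~ (forall z, fconnect (@face M) d z -> ~~ z.2).
  (* Subtracting from the maximal height turns a descent into an increasing natural number. *)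
  move=> dn_z; pose m := \max_v h v.
  apply: (fconnect_increasing (h := fun z => m - h (vert z)) (x := d) face_i).
  move=> z /dn_z; rewrite vert_face; case: z => e [] //= _.
  apply: ltn_sub2l; last exact: h_lt.
  by apply: leq_trans (h_lt e) _; rewrite /m (leq_bigmax (head e)).
have sym := fconnect_sym face_i.
have [z1 c1 z1d] : exists2 z, fconnect (@face M) d z & ~~ z.2.
  have /existsP[z /andP[? ?]] : [exists z, fconnect (@face M) d z && ~~ z.2]; last by exists z.
  apply: contra_notT no_up => /existsPn no z dz.
  by have := no z; rewrite dz negbK.
have [z2 c2 z2u] : exists2 z, fconnect (@face M) d z & z.2.
  have /existsP[z /andP[? ?]] : [exists z, fconnect (@face M) d z && z.2]; last by exists z.
  apply: contra_notT no_dn => /existsPn no z dz.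
  by have := no z; rewrite dz.
have c12 : fconnect (@face M) z1 z2 by apply: connect_trans c2; rewrite sym.
have [|z [cz dz uz]] := fconnect_change (P := fun d => ~~ d.2) c12 z1d; first by rewrite z2u.
case: z cz dz uz => e [] //= cz _ uz; exists e; last exact: connect_trans cz.
by rewrite inE.
Qed.

Lemma card_face : fcard (@face M) (dart M) =
  #|[set froot (@face M) (e, false) | e in ~: turning]|.
Proof.
have sym := fconnect_sym face_i.
rewrite /n_comp_mem; apply: eq_card => d; rewrite !inE andbT.
apply/idP/imsetP => [/eqP rd|[e _ ->]]; last exact: roots_root.
have [e et de] := face_bottom d; exists e; first by rewrite inE.
by rewrite -{1}rd; apply/eqP; rewrite root_connect.
Qed.

(** Turning edges map onto the vertices other than the poles, and the other edges onto the faces. So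
    the number of vertices plus faces never exceeds the number of edges plus 2, with equality
    exactly when both maps are injective. *)
Lemma euler_count : #|vertex M| + fcard (@face M) (dart M) = #|edge M| + 2 <->
  {in turning &, injective (@tail M)} /\
  {in ~: turning &, injective (fun e => froot (@face M) (e, false))}.
Proof.
rewrite card_vertex card_face -(cardsC turning).
split=> [eq_c|[/card_in_imset-> /card_in_imset->]]; last by rewrite addnAC.
have le1 := leq_imset_card (@tail M) (mem turning).
have le2 := leq_imset_card (fun e => froot (@face M) (e, false)) (mem (~: turning)).
move/eqP: eq_c; rewrite addnAC eqn_add2r => /eqP eq_c.
have [e1 e2] : #|[set tail e | e in turning]| = #|turning| /\
  #|[set froot (@face M) (e, false) | e in ~: turning]| = #|~: turning|.
  split; apply/eqP; rewrite eqn_leq ?le1 ?le2 /=.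
    by rewrite -(leq_add2r #|~: turning|) -eq_c leq_add2l.
  by rewrite -(leq_add2l #|turning|) -eq_c leq_add2r.
by split; apply/imset_injP; rewrite ?e1 ?e2.
Qed.

End Count.

Lemma fconnect_closed_inv (T : finType) (P : pred T) (f : T -> T) :
  (forall x, P (f x) -> P x) -> forall x y, fconnect f x y -> P y -> P x.
Proof.
move=> Pf x _ /fconnectP_iter[n ->]; elim: n => //= n IHn /Pf; exact: IHn.
Qed.

(** * Degrees at the ends of missing edges *)

Section Degree.
Variables (V E : finType) (tl hd : E -> V).
Notation vt := (dart_vertex tl hd).
Variables (A : {set E}) (r : E * bool -> E * bool) (Wm Wr Ea H Ew Eb : seq E).
Variables (So St No Ac B C : V).
Hypothesis I : sewing tl hd A r Wm Wr Ea H Ew Eb So St No Ac B C.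

(** Clockwise after [dn w] the darts are upward until the only change of the vertex, which is at
    [up g] and leads back to [dn w]. No second downward dart is met. *)
Lemma indegree_one w g g' : w \in A -> g \in A -> r (up g) = dn w ->
  r (dn w) = up g' -> forall e, e \in A -> hd e = hd w -> e = w.
Proof.
move=> wA gA rg rw e eA he.
pose P (d : E * bool) := [&& d.1 \in A, vt d == hd w & d.2 || (d == dn w)].
suff: P (dn e) by rewrite /P /= xpair_eqE andbT => /and3P[_ _ /eqP].
have vs := co_vs (i_core I).
have conn : fconnect r (dn w) (dn e) by apply: (vs_orb vs); rewrite ?inE.
apply: fconnect_closed conn _; last by rewrite /P /= wA /dart_vertex /= !eqxx.
move=> d /and3P[dA vd dd]; rewrite /P (sewing_dom I) dA (sewing_vt I) // vd /=.
case/orP: dd => [du|/eqP->]; last by rewrite rw.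
case def_rd: (r d) => [x [//|]] /=; case: d dA vd du def_rd => y [] //= yA /eqP vy _ ry.
have [|_ ->//] := sewing_one I yA gA _ ry rg.
have vg := sewing_vt I (gA : (up g).1 \in A).
by rewrite -[LHS]/(dart_vertex tl hd (up y)) vy -[RHS]/(dart_vertex tl hd (up g)) -vg rg.
Qed.

(** The mirror image of [indegree_one], with the rotation followed backwards because [vs_one] bounds
    the changes from upward to downward and not the reverse ones. *)
Lemma outdegree_one z g g' : z \in A -> g \in A -> r (dn g) = up z ->
  r (up z) = dn g' -> forall e, e \in A -> tl e = tl z -> e = z.
Proof.
move=> zA gA rg rz e eA te.
pose P (d : E * bool) := [&& d.1 \in A, vt d == tl z & ~~ d.2 || (d == up z)].
suff: P (up e) by rewrite /P /= xpair_eqE andbT => /and3P[_ _ /eqP].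
have vs := co_vs (i_core I).
have conn : fconnect r (up e) (up z) by apply: (vs_orb vs); rewrite ?inE.
apply: fconnect_closed_inv conn _; last by rewrite /P /= zA /dart_vertex /= !eqxx.
move=> d /and3P[]; rewrite (sewing_dom I) => dA; rewrite (sewing_vt I) // => vd.
rewrite /P dA vd /=; case/orP => [rd|/eqP rd]; last first.
  by rewrite (sewing_inj I (etrans rd (esym rg))).
case: d dA vd rd => y [] //= yA /eqP vy; case def_ry: (r _) => [x []] //= _.
have [|-> _] := sewing_one I yA zA _ def_ry rz; last by rewrite eqxx.
by rewrite -[RHS]vy.
Qed.

Lemma low_next w : w \in Wm -> exists g, r (dn w) = up g.
Proof.
move=> wW; have := co_cyc (i_core I); rewrite /outline.
case/splitPr: wW (i_Wr0 I) => s1 s2 Wr0; rewrite -catA cat_cons.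
case def_s: (s2 ++ Wr) => [|g s]; first by case: (s2) (Wr) Wr0 def_s => [|? ?] [|? ?].
by rewrite map_cat -catA /= => /fcycle_adjacent ?; exists g.
Qed.

Lemma high_next z : H ++ Ew ++ Eb != [::] -> z \in Ea -> exists g, r (up z) = dn g.
Proof.
move=> n0 zE; have := co_cyc (i_core I); rewrite /outline.
case/splitPr: zE => s1 s2; rewrite -(catA s1) cat_cons [downs (s1 ++ _)]map_cat.
rewrite -(catA (downs s1)) (catA (ups _)).
case: s2 => [|g s] /=; last by move=> /fcycle_adjacent ?; exists g.
case: H n0 => [|g s] /= n0; last by move=> /fcycle_adjacent ?; exists g.
case: (Ew ++ Eb) n0 => // g s _ /= /fcycle_adjacent ?; by exists g.
Qed.

Lemma low_indegree w : w \in Wm -> forall e, e \in A -> hd e = hd w -> e = w.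
Proof.
move=> wW; have [g gA rg] := i_low I wW; have [g' rw] := low_next wW.
have wA : w \in A by rewrite (sewing_sub I) ?wW.
exact: indegree_one wA gA rg rw.
Qed.

Lemma high_outdegree z : H ++ Ew ++ Eb != [::] -> z \in Ea ->
  forall e, e \in A -> tl e = tl z -> e = z.
Proof.
move=> n0 zE; have [g gA rg] := i_high I zE; have [g' rz] := high_next n0 zE.
have zA : z \in A by rewrite (sewing_sub I) // zE !orbT.
exact: outdegree_one zA gA rg rz.
Qed.

End Degree.

(** * Marked bipolar maps and boundary data *)

Lemma connect_le (T : finType) (e : rel T) (h : T -> nat) u v :
  (forall x y, e x y -> h x <= h y) -> connect e u v -> h u <= h v.
Proof.
move=> he /connectP[p ep ->]; elim: p u ep => //= y p IHp u /andP[/he le_y /IHp].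
exact: leq_trans.
Qed.

Lemma connect_ind_l (T : finType) (e : rel T) (P : T -> Prop) v :
  P v -> (forall x y, e x y -> P y -> P x) -> forall u, connect e u v -> P u.
Proof.
move=> Pv Pe u /connectP[p ep def_v]; move: Pv; rewrite {v}def_v.
by elim: p u ep => //= y p IHp u /andP[/Pe euy /IHp Py] /Py; apply: euy.
Qed.

Lemma connect_ind_r (T : finType) (e : rel T) (P : T -> Prop) u :
  P u -> (forall x y, e x y -> P x -> P y) -> forall v, connect e u v -> P v.
Proof.
move=> Pu Pe v /connectP[p ep ->]; elim: p u Pu ep => //= y p IHp u Pu /andP[euy].
by apply: IHp; apply: Pe euy Pu.
Qed.

Section ToMarked.
Variables (M : map_data) (Wm Wr Ea Eb : seq (edge M)).
Hypothesis P : mmark Wm Wr Ea Eb.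
Hypothesis Eb0 : Eb != [::].

Let I : marking (@tail M) (@head M) setT (@rot M) Wm Wr Ea Eb (south M) (start M)
  (north M) (active M).
Proof. by case: P. Qed.

Let rot_i : injective (@rot M). Proof. exact: sewing_inj I. Qed.

Let inT (e : edge M) : e \in setT. Proof. exact: in_setT. Qed.

Let rot_v d d' : fconnect (@rot M) d d' = (@vert M d == vert d').
Proof.
apply/idP/eqP => [c|e]; last by apply: (vs_orb (co_vs (i_core I))); rewrite ?inE.
by have [] := vs_conn (co_vs (i_core I)) _ c; rewrite ?inE.
Qed.

Let live v : exists d : dart M, vert d = v. Proof. by case: P. Qed.

Let in_ex v : v != south M -> exists e : edge M, head e = v.
Proof.
have [[e []] <-] := live v; last by exists e.
rewrite -[vert _]/(tail e).
by case: (i_src I (inT e)) => [->|[//]|[e' _ he'] _]; [rewrite eqxx | exists e'].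
Qed.

Let out_ex v : v != north M -> exists e : edge M, tail e = v.
Proof.
have [[e []] <-] := live v; first by exists e.
rewrite -[vert _]/(head e).
by case: (i_snk I (inT e)) => [->|[e' _ te'] _]; [rewrite eqxx | exists e'].
Qed.

Let W_path : upath (@tail M) (@head M) (south M) (Wm ++ Wr) (north M).
Proof. by apply/upath_cat; exists (start M); [apply: i_Wm I | apply: i_Wr I]. Qed.

Let E_path : dpath (@tail M) (@head M) (north M) (Ea ++ Eb) (south M).
Proof. by apply/dpath_cat; exists (active M); [apply: i_Ea I | apply: i_Eb I]. Qed.

Let W_hd x y : x \in Wm ++ Wr -> y \in Wm ++ Wr -> head x = head y -> x = y.
Proof.
have [h [hA _ _ _]] := sewing_rank I; rewrite -!(mem_rev (Wm ++ Wr)).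
move/upath_rev: W_path => p; apply: (dpath_hd_inj (h := h)) p => e _; exact: hA.
Qed.

Let E_tl x y : x \in Ea ++ Eb -> y \in Ea ++ Eb -> tail x = tail y -> x = y.
Proof.
have [h [hA _ _ _]] := sewing_rank I.
by apply: (dpath_tl_inj (h := h)) E_path => e _; apply: hA.
Qed.

Let one_change : {in turning M &, injective (@tail M)} /\
  {in ~: turning M &, injective (fun e => froot (@face M) (e, false))}.
Proof.
split=> [e e'|e e']; rewrite !inE ?negbK => te te'.
  move=> tt; have [] // : up e = up e'.
  by apply: (vs_one (co_vs (i_core I))) te te'; rewrite ?inE.
have face_i : injective (@face M) := fc_inj rot_i.
move/eqP; rewrite (root_connect (fconnect_sym face_i)) => conn.
(* [co_face] speaks of inner faces only; the outer walk goes up and then down, so its bottom corner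
   is unique by [last_down]. *)
have [eO|eO] := boolP (dn e \in outline Wm Wr Ea [::] [::] Eb); last first.
  exact: (co_face (i_core I)) eO conn.
have cyc := co_cyc (i_core I).
have e'O : dn e' \in outline Wm Wr Ea [::] [::] Eb.
  by rewrite -(fconnect_cycle cyc eO).
rewrite !mem_outline in eO e'O; rewrite outline_nil in cyc.
case def_W: (Wm ++ Wr) cyc => [|w s].
  by move: (i_Wr0 I) def_W; case: (Wm) (Wr) => [|? ?] [|? ?].
case: (seq_last (Ea ++ Eb)) eO e'O => [->//|[t [x def_E]]].
rewrite def_E => eO e'O cyc.
by rewrite (last_down cyc eO te) (last_down cyc e'O te').
Qed.

(** Edges of the western path have distinct heads, so a western step into one of its vertices uses
    the path's own edge. Reachability of the start vertex thus amounts to lying along [Wm]. *)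
Let prefix v : connect (@west_step M) v (start M) ->
  exists s1 s2, Wm = s1 ++ s2 /\ upath (@tail M) (@head M) (south M) s1 v.
Proof.
move: v; apply: connect_ind_l => [|u v /existsP[e /and3P[]]].
  by exists Wm, [::]; rewrite cats0; split=> //; apply: i_Wm I.
rewrite (west_edgeE P) => eW /eqP te /eqP he [s1 [s2 [def_Wm]]].
case: (seq_last s1) => [-> /= Sv|[s [w def_s1]]].
  by have := i_So I (inT e); rewrite he Sv eqxx.
rewrite def_s1 => /upath_rcons[p hw].
have ew : e = w.
  apply: W_hd; rewrite // ?he ?hw //.
  by rewrite def_Wm def_s1 !mem_cat mem_rcons mem_head.
by exists s, (w :: s2); rewrite def_Wm def_s1 cat_rcons -te ew.
Qed.

Let suffix v : connect (@east_step M) (active M) v ->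
  exists s1 s2, [/\ Ea = s1 ++ s2, dpath (@tail M) (@head M) (north M) s1 v
    & dpath (@tail M) (@head M) v s2 (active M)].
Proof.
move: v; apply: connect_ind_r => [|u v /existsP[e /and3P[]]].
  by exists Ea, [::]; rewrite cats0; split=> //; apply: i_Ea I.
rewrite (east_edgeE P) => eE /eqP te /eqP he [s1 [s2 [def_Ea]]].
case: (seq_last s1) => [-> /= Nu|[s [z def_s1]]].
  by have := i_No I (inT e); rewrite te Nu eqxx.
rewrite def_s1 => /dpath_rcons[p tz] q.
have ez : e = z.
  apply: E_tl; rewrite // ?te ?tz //.
  by rewrite def_Ea def_s1 !mem_cat mem_rcons mem_head.
exists s, (z :: s2); rewrite def_Ea def_s1 cat_rcons -he ez; split=> //=.
by rewrite -ez te ez.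
Qed.

Lemma mmark_marked : marked_bipolar M.
Proof.
have [h [hA _ _ _]] := sewing_rank I.
have SN : south M != north M.
  have [x [s def_Eb]] : exists x s, Eb = x :: s by case: (Eb) Eb0 => // x s; exists x, s.
  have := dpath_le (h := h) (fun e _ => hA e (inT e)) (i_Ea I).
  have := i_Eb I; rewrite def_Eb => -[hx /(dpath_le (h := h) (fun e _ => hA e (inT e)))].
  move=> le1 le2; apply/eqP=> eSN; have := hA x (inT x); rewrite hx.
  by move=> /(leq_ltn_trans le1)/leq_trans/(_ le2); rewrite eSN ltnn.
have h_lt e : h (tail e) < h (head e) by apply: hA.
have S_in e : head e != south M by apply: (i_So I).
have N_out e : tail e != north M by apply: (i_No I).
(* Connectedness: following incoming edges lowers the height until the only source is reached. *)
have to_S v : connect (@adjacent M) v (south M).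
  elim: {v}_.+1 {-2}v (ltnSn (h v)) => // n IHn v lt_v.
  have [->|/in_ex[e he]] := eqVneq v (south M); first exact: connect0.
  apply: connect_trans (IHn (tail e) _); last first.
    by rewrite -ltnS; apply: leq_ltn_trans lt_v; rewrite -he.
  apply: connect1; rewrite /adjacent; apply/orP; right.
  by apply/existsP; exists e; rewrite he !eqxx.
have adj_sym : connect_sym (@adjacent M).
  by apply: sym_connect_sym => u v; rewrite /adjacent orbC.
have step_le u v : connect (@step M) u v -> h u <= h v.
  apply: connect_le => x y /existsP[e /andP[/eqP<- /eqP<-]].
  exact: ltnW.
split; first split=> //; first split=> //.
- by move=> e; apply/eqP=> te; have := h_lt e; rewrite te ltnn.
- by move=> u v; apply: connect_trans (to_S u) _; rewrite adj_sym.
- exact: iffRL (euler_count rot_i rot_v h_lt SN S_in N_out in_ex out_ex) one_change.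
- have [w [s def_W]] : exists w s, Wm ++ Wr = w :: s.
    by case: (Wm) (Wr) (i_Wr0 I) => [|w ?] [|w' ?] // _; do 2!eexists.
  exists (w, true); last by rewrite (on_outerE P) mem_outline cats0 def_W mem_head.
  by move: W_path; rewrite def_W => -[].
- have [x [s def_E]] : exists x s, Ea ++ Eb = x :: s.
    by case: (Ea) (Eb) Eb0 => [|w ?] [|w' ?] // _; do 2!eexists.
  exists (x, false); last by rewrite (on_outerE P) mem_outline /= def_E mem_head.
  by move: E_path; rewrite def_E => -[].
- move=> u v /existsP[e /andP[/eqP <- /eqP <-]]; apply/negP=> /step_le.
  by rewrite leqNgt h_lt.
- move=> v; rewrite /indegree cards_eq0; apply/idP/eqP => [/eqP v0|->].
    apply/eqP; apply: contraT => /in_ex[e he].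
    by have := in_set0 e; rewrite -v0 inE he eqxx.
  by apply/eqP/setP=> e; rewrite !inE (negbTE (S_in e)).
- move=> v; rewrite /outdegree cards_eq0; apply/idP/eqP => [/eqP v0|->].
    apply/eqP; apply: contraT => /out_ex[e he].
    by have := in_set0 e; rewrite -v0 inE he eqxx.
  by apply/eqP/setP=> e; rewrite !inE (negbTE (N_out e)).
- have := i_Wr I; case def_W: Wr (i_Wr0 I) => [//|w s] _ [tw _].
  by apply/existsP; exists w; rewrite (west_edgeE P) mem_cat def_W mem_head tw eqxx orbT.
- have := i_Wr I; case def_W: Wr (i_Wr0 I) => [//|w s] _ [<- _]; exact: N_out.
- have := i_Eb I; case def_E: Eb Eb0 => [//|x s] _ [hx _].
  by apply/existsP; exists x; rewrite (east_edgeE P) mem_cat def_E mem_head hx eqxx !orbT.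
- have := i_Eb I; case def_E: Eb Eb0 => [//|x s] _ [<- _]; exact: S_in.
- move=> v /prefix[s1 [s2 [def_Wm]]].
  case: (seq_last s1) => [-> /= <-|[s [w def_s1]]].
    rewrite /indegree (_ : [set _ | _] = set0) ?cards0 //.
    by apply/setP=> e; rewrite !inE (negbTE (S_in e)).
  rewrite def_s1 => /upath_rcons[_ hw].
  have wW : w \in Wm by rewrite def_Wm def_s1 mem_cat mem_rcons mem_head.
  rewrite -(cards1 w); apply/subset_leq_card/subsetP => e; rewrite !inE => /eqP he.
  by apply/eqP/(low_indegree I wW); rewrite // he hw.
- move=> v /suffix[s1 [s2 [def_Ea]]].
  case: (seq_last s1) => [-> /= <-|[s [z def_s1]]].
    rewrite /outdegree (_ : [set _ | _] = set0) ?cards0 //.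
    by apply/setP=> e; rewrite !inE (negbTE (N_out e)).
  rewrite def_s1 => /dpath_rcons[_ tz] _.
  have zE : z \in Ea by rewrite def_Ea def_s1 mem_cat mem_rcons mem_head.
  rewrite -(cards1 z); apply/subset_leq_card/subsetP => e; rewrite !inE => /eqP te.
  by apply/eqP/(high_outdegree I _ zE); rewrite // te tz.
move=> e /orP[/andP[]|/andP[]].
  rewrite (west_edgeE P) => eW /prefix[s1 [s2 [def_Wm]]].
  case: (seq_last s1) => [-> /= Sv|[s [w def_s1]]].
    by have := S_in e; rewrite -Sv eqxx.
  rewrite def_s1 => /upath_rcons[_ hw].
  have wW : w \in Wm by rewrite def_Wm def_s1 mem_cat mem_rcons mem_head.
  have -> : e = w by apply: W_hd; rewrite // mem_cat wW.
  by exists false; rewrite (on_outerE P) mem_outline /= (i_WE I wW).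
rewrite (east_edgeE P) => eE /suffix[s1 [s2 [def_Ea]]].
case: (seq_last s1) => [-> /= Sv|[s [z def_s1]]].
  by have := N_out e; rewrite -Sv eqxx.
rewrite def_s1 => /dpath_rcons[_ tz] _.
have zE : z \in Ea by rewrite def_Ea def_s1 mem_cat mem_rcons mem_head.
have -> : e = z by apply: E_tl; rewrite // mem_cat zE.
by exists true; rewrite (on_outerE P) mem_outline cats0 (i_EW I zE).
Qed.

End ToMarked.

Lemma ups_downs (E : eqType) (s : seq (E * bool)) :
  (forall s1 s2 x y, s = s1 ++ [:: x, y & s2] -> x.2 || ~~ y.2) ->
  exists t1 t2, s = ups t1 ++ downs t2.
Proof.
elim: s => [|[x b] s IHs] no; first by exists [::], [::].
have [|t1 [t2 def_s]] := IHs.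
  by move=> s1 s2 y z def_s; apply: (no ((x, b) :: s1) s2); rewrite def_s.
case: b no => no; first by exists (x :: t1), t2; rewrite def_s.
case: t1 def_s => [|y t1] def_s; first by exists [::], (x :: t2); rewrite def_s.
by have := no [::] (ups t1 ++ downs t2) (x, false) (y, true); rewrite def_s => /(_ (erefl _)).
Qed.

Section FromMarked.
Variable M : map_data.
Hypothesis K : marked_bipolar M.

Let BM := marked_is_bipolar K.
Let PM := bipolar_planar BM.
Let rot_i := rot_inj PM.
Let rot_v := rot_vert PM.

(** By acyclicity the set of vertices below grows strictly along each edge, so its cardinal is a
    height. *)
Let h (v : vertex M) := #|[set u | connect (@step M) u v]|.

Let h_lt e : h (tail e) < h (head e).
Proof.
have st : step (tail e) (head e) by apply/existsP; exists e; rewrite !eqxx.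
apply/proper_card/properP; split.
  by apply/subsetP=> u; rewrite !inE => c; apply: connect_trans c (connect1 st).
by exists (head e); rewrite inE ?connect0 //; apply: (acyclic BM).
Qed.

Let S_in (e : edge M) : head e != south M.
Proof.
rewrite -(sources BM) /indegree cards_eq0; apply/eqP=> s0.
by have := in_set0 e; rewrite -s0 inE eqxx.
Qed.

Let N_out (e : edge M) : tail e != north M.
Proof.
rewrite -(sinks BM) /outdegree cards_eq0; apply/eqP=> s0.
by have := in_set0 e; rewrite -s0 inE eqxx.
Qed.

Let in_ex v : v != south M -> exists e : edge M, head e = v.
Proof.
rewrite -(sources BM) /indegree cards_eq0 => /set0Pn[e]; rewrite inE => /eqP.
by exists e.
Qed.

Let out_ex v : v != north M -> exists e : edge M, tail e = v.
Proof.
rewrite -(sinks BM) /outdegree cards_eq0 => /set0Pn[e]; rewrite inE => /eqP.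
by exists e.
Qed.

Let count := (euler_count rot_i rot_v h_lt (poles_neq BM) S_in N_out in_ex out_ex).1
  (euler PM).

Let face_i : injective (@face M). Proof. exact: fc_inj rot_i. Qed.

Let vertE (d : dart M) : vert (rot d) = vert d.
Proof. by apply/esym/eqP; rewrite -rot_v fconnect1. Qed.

Let one_up (e e' : edge M) : ~~ (rot (e, true)).2 -> ~~ (rot (e', true)).2 ->
  tail e = tail e' -> e = e'.
Proof. by move=> te te' ee'; apply: (count.1); rewrite ?inE. Qed.

Let one_bottom (e e' : edge M) : (rot (e, true)).2 -> (rot (e', true)).2 ->
  fconnect (@face M) (e, false) (e', false) -> e = e'.
Proof.
move=> te te' c; apply: (count.2); rewrite ?inE ?negbK //.
by apply/eqP; rewrite root_connect //; apply: fconnect_sym.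
Qed.

(** The outer orbit is opened at an upward dart of the south pole. The dart before it is downward,
    as no edge enters the pole, so this is the only bottom corner of the outer face and the orbit
    goes up and then down. *)
Lemma marked_outer : exists w (W D : seq (edge M)),
  [/\ tail w = south M, D != [::], fcycle (@face M) (ups (w :: W) ++ downs D),
    uniq (ups (w :: W) ++ downs D) &
    forall d, on_outer d = (d \in ups (w :: W) ++ downs D)].
Proof.
have [[e b] /= ve out_e] := south_outer BM.
case: b ve out_e => ve out_e; last by have := S_in e; rewrite -ve eqxx.
set O := orbit (@face M) (e, true).
have cycO : fcycle (@face M) O by apply: cycle_orbit.
have unO : uniq O by apply: orbit_uniq.
have outO d : on_outer d = (d \in O).
  rewrite -fconnect_orbit /on_outer.
  exact: (same_connect (fconnect_sym face_i) out_e).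
have def_O : O = (e, true) :: behead O by rewrite /O /orbit; case: (order _ _) (order_gt0 (@face M) (e, true)).
have [[l b] rl fl] : exists2 l, l \in O & face l = (e, true).
  exists (finv (@face M) (e, true)); last exact: f_finv.
  by rewrite -fconnect_orbit fconnect_finv.
have vl : vert (l, ~~ b) = south M by rewrite -ve -fl -vertE.
case: b vl rl fl => /= vl rl fl; first by have := S_in l; rewrite -vl eqxx.
have [W [D def_O']] : exists W D, O = ups W ++ downs D.
  (* A descent followed by an ascent is a bottom corner; being unique, it would repeat the opening
     dart of the list. *)
  apply: ups_downs => s1 s2 x y def_s; apply: contraT; rewrite negb_or negbK => /andP[xd yu].
  have fx : face x = y by move: cycO; rewrite def_s => /fcycle_adjacent.
  have xO : x \in O by rewrite def_s mem_cat mem_head orbT.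
  case: x xd fx xO def_s => x [] //= _ fx xO def_s.
  have xl : x = l.
    apply: one_bottom; rewrite -?[rot _]/(face (_, false)) ?fx ?fl //.
    by rewrite (fconnect_cycle cycO xO).
  move: fx; rewrite xl fl => ey.
  case: s1 def_s => [|z s1] def_s; first by move: def_O; rewrite def_s xl.
  move: unO; rewrite def_O in def_s *; case: def_s => _ ->.
  by rewrite -ey /= mem_cat !in_cons eqxx !orbT.
have D0 : D != [::].
  by apply: contraTneq rl => D0; rewrite def_O' D0 cats0 mem_ups.
case: W def_O' => [|w W] def_O'; first by move: def_O; rewrite def_O'; case: (D).
have ew : e = w by move: def_O; rewrite def_O' => -[].
rewrite def_O' in cycO unO outO; exists w, W, D; split=> //.
by rewrite -ew.
Qed.

Lemma path_upath (x : edge M) (s : seq (edge M)) : fpath (@face M) (x, true) (ups s) ->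
  upath (@tail M) (@head M) (tail x) (x :: s) (head (last x s)).
Proof.
elim: s x => [|y s IHs] x //= /andP[/eqP fx /IHs p]; split=> //.
suff -> : head x = tail y by [].
by rewrite -[RHS]/(vert (y, true)) -fx vertE.
Qed.

Lemma path_dpath (x : edge M) (s : seq (edge M)) : fpath (@face M) (x, false) (downs s) ->
  dpath (@tail M) (@head M) (head x) (x :: s) (tail (last x s)).
Proof.
elim: s x => [|y s IHs] x //= /andP[/eqP fx /IHs p]; split=> //.
suff -> : tail x = head y by [].
by rewrite -[RHS]/(vert (y, false)) -fx vertE.
Qed.

(** No edge leaves the north pole, so an outer dart at it is downward and has no downward
    predecessor in the walk. The turning point of the outer walk is therefore the north pole. *)
Lemma marked_boundary : exists W D : seq (edge M),
  [/\ upath (@tail M) (@head M) (south M) W (north M),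
      dpath (@tail M) (@head M) (north M) D (south M),
      fcycle (@face M) (ups W ++ downs D), uniq (ups W ++ downs D) &
      forall d, on_outer d = (d \in ups W ++ downs D)].
Proof.
have [w [W [D [tw D0 cyc un out]]]] := marked_outer.
case: D D0 cyc un out => // d D _ cyc un out.
have /= := cyc; rewrite rcons_path cat_path /= last_cat /= last_map last_map.
case/andP=> /and3P[pW /eqP fW pD] /eqP fD.
have hd_T : head d = head (last w W).
  by rewrite -[LHS]/(vert (d, false)) -fW vertE.
have tl_S : tail (last d D) = south M.
  by rewrite -tw -[RHS]/(vert (w, true)) -fD vertE.
have pathW := path_upath pW; have pathD := path_dpath pD.
have dN : head d = north M.
  have [[x b] vx] := north_outer BM; rewrite out => xO.
  case: b vx xO => vx; first by have := N_out x; rewrite -vx eqxx.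
  rewrite mem_cat mem_ups mem_downs /= => xD; move: vx; rewrite /vert /=.
  case/splitPr def_D: _ / xD pathD => [s1 s2].
  case: (seq_last s1) def_D => [->|[s [y ->]]] def_D; first by case: def_D => ->.
  rewrite cat_rcons => /dpath_cat[m _ [_ [xy _]]] xN.
  by have := N_out y; rewrite -xy xN eqxx.
exists (w :: W), (d :: D); split=> //.
  by rewrite -tw -dN hd_T.
by rewrite -tl_S -dN.
Qed.

Lemma upath_split u s v x : upath (@tail M) (@head M) u s v ->
  (exists2 e, e \in s & (tail e == x) || (head e == x)) ->
  exists s1 s2, [/\ s = s1 ++ s2, upath (@tail M) (@head M) u s1 x
    & upath (@tail M) (@head M) x s2 v].
Proof.
move=> p [e /splitPr def_s ex]; case: def_s p => s1 s2.
case/orP: ex => /eqP <-.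
  move/upath_cat => [m p q]; exists s1, (e :: s2); split=> //.
    by case: q => ->.
  by case: q.
rewrite -cat_rcons => /upath_cat[m p q]; exists (rcons s1 e), s2; split=> //.
  by move: p => /upath_rcons[? _]; apply/upath_rcons.
by move: p => /upath_rcons[_ ->].
Qed.

Lemma dpath_split u s v x : dpath (@tail M) (@head M) u s v ->
  (exists2 e, e \in s & (tail e == x) || (head e == x)) ->
  exists s1 s2, [/\ s = s1 ++ s2, dpath (@tail M) (@head M) u s1 x
    & dpath (@tail M) (@head M) x s2 v].
Proof.
move=> p [e /splitPr def_s ex]; case: def_s p => s1 s2.
rewrite orbC in ex; case/orP: ex => /eqP <-.
  move/dpath_cat => [m p q]; exists s1, (e :: s2); split=> //.
    by case: q => ->.
  by case: q.
rewrite -cat_rcons => /dpath_cat[m p q]; exists (rcons s1 e), s2; split=> //.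
  by move: p => /dpath_rcons[? _]; apply/dpath_rcons.
by move: p => /dpath_rcons[_ ->].
Qed.

Lemma west_connect u s v : upath (@tail M) (@head M) u s v ->
  (forall e : edge M, e \in s -> west_edge e) -> connect (@west_step M) u v.
Proof.
elim: s u => [|x s IHs] u /=; first by move->.
case=> <- p ws; apply: connect_trans (IHs _ p _).
  by apply/connect1/existsP; exists x; rewrite !eqxx ws ?mem_head.
by move=> e es; rewrite ws // in_cons es orbT.
Qed.

Lemma east_connect u s v : dpath (@tail M) (@head M) u s v ->
  (forall e : edge M, e \in s -> east_edge e) -> connect (@east_step M) v u.
Proof.
elim: s u => [|x s IHs] u /=; first by move->.
case=> <- p ws; apply: connect_trans (IHs _ p _) _.
  by move=> e es; rewrite ws // in_cons es orbT.
by apply/connect1/existsP; exists x; rewrite !eqxx ws ?mem_head.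
Qed.

Lemma dpath_mem u s v x : dpath (@tail M) (@head M) u s v -> x \in s ->
  exists s1 s2, s = rcons s1 x ++ s2 /\ dpath (@tail M) (@head M) (tail x) s2 v.
Proof.
move=> p /splitPr def_s; case: def_s p => s1 s2.
by rewrite -cat_rcons => /dpath_cat[m /dpath_rcons[_ <-] q]; exists s1, s2.
Qed.

Lemma fconnect_fixed (T : finType) (f : T -> T) x y : f x = x -> fconnect f x y -> x = y.
Proof. by move=> fx /fconnectP_iter[n ->]; elim: n => //= n <-. Qed.

Lemma card_le1 (T : finType) (B : {set T}) x y : #|B| <= 1 -> x \in B -> y \in B -> x = y.
Proof. by move=> B1 xB yB; apply: (card_le1_eqP B1). Qed.

Lemma marked_mmark : exists Wm Wr Ea Eb, @mmark M Wm Wr Ea Eb /\ Eb != [::].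
Proof.
have [W [D [pW pD cyc un out]]] := marked_boundary.
have west e : west_edge e = (e \in W).
  by rewrite /west_edge out mem_cat mem_ups mem_downs orbF.
have east e : east_edge e = (e \in D).
  by rewrite /east_edge out mem_cat mem_ups mem_downs.
have [|Wm [Wr [def_W pWm pWr]]] := upath_split (x := start M) pW.
  by have /existsP[e /andP[]] := start_west K; rewrite west => ? ?; exists e.
have [|Ea [Eb [def_D pEa pEb]]] := dpath_split (x := active M) pD.
  by have /existsP[e /andP[]] := active_east K; rewrite east => ? ?; exists e.
have Wr0 : Wr != [::].
  by apply: contraTneq (start_not_top K) => Wr0; rewrite Wr0 /= in pWr; rewrite pWr negbK.
have Eb0 : Eb != [::].
  by apply: contraTneq (active_not_bottom K) => Eb0; rewrite Eb0 /= in pEb; rewrite pEb negbK.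
have low_conn w : w \in Wm -> connect (@west_step M) (head w) (start M).
  move=> wW; have [s1 [s2 [def_Wm _ p2]]] := upath_mem pWm wW.
  apply: west_connect p2 _ => e es.
  by rewrite west def_W mem_cat def_Wm mem_cat es orbT.
have high_conn z : z \in Ea -> connect (@east_step M) (active M) (tail z).
  move=> zE; have [s1 [s2 [def_Ea p2]]] := dpath_mem pEa zE.
  apply: east_connect p2 _ => e es.
  by rewrite east def_D mem_cat def_Ea mem_cat es orbT.
exists Wm, Wr, Ea, Eb; split=> //; split; first split=> //.
- rewrite outline_nil -def_W -[Ea ++ _]def_D.
  split=> //.
  + split=> //.
    * by move=> d; rewrite !in_set.
    * by move=> d _; apply: vertE.
    * by move=> d d' _ _ vd; rewrite rot_v; apply/eqP.
    move=> [e []] [e' []] //= _ _ tt _ _ re re'.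
    by congr (_, _); apply: one_up.
  by move=> e e' _ _ te te' _; apply: one_bottom.
- by exists h.
- move=> e _; have [->|/in_ex[e' he']] := eqVneq (tail e) (south M); first exact: Or31.
  by apply: Or33; exists e'.
- move=> e _; have [->|/out_ex[e' he']] := eqVneq (head e) (north M); first by left.
  by right; exists e'.
- move=> w wW; have in1 := below_start K (low_conn w wW).
  have rp : rot (finv (@rot M) (w, false)) = (w, false) by rewrite f_finv.
  (* If the dart before [dn w] were downward, in-degree at most one would make it [dn w] itself.
     This fixed point of the rotation would be the only dart of a vertex that an edge leaves. *)
  case def_p: (finv _ _) rp => [e []] rp; first by exists e.
  have he : head e = head w by rewrite -[LHS]/(vert (e, false)) -vertE rp.
  have ew : e = w by apply: (card_le1 in1); rewrite !inE ?he.
  have [g tg] : exists g : edge M, tail g = head w.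
    have [s1 [s2 [_ _ p2]]] := upath_mem pWm wW.
    case: s2 p2 => [/= ->|g s2 [tg _]]; last by exists g.
    by case: (Wr) Wr0 pWr => // g s2 _ [tg _]; exists g.
  have : fconnect (@rot M) (w, false) (g, true) by rewrite rot_v /vert /= tg.
  by move=> /(fconnect_fixed (etrans (congr1 (fun x => rot (x, false)) (esym ew)) rp)).
- move=> z zE; have out1 := above_active K (high_conn z zE).
  have rp : rot (finv (@rot M) (z, true)) = (z, true) by rewrite f_finv.
  case def_p: (finv _ _) rp => [e []] rp; last by exists e.
  have te : tail e = tail z by rewrite -[LHS]/(vert (e, true)) -vertE rp.
  have ez : e = z by apply: (card_le1 out1); rewrite !inE ?te.
  have [g hg] : exists g : edge M, head g = tail z.
    have [s1 [s2 [_ p2]]] := dpath_mem pEa zE.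
    case: s2 p2 => [/= ->|g s2 [tg _]]; last by exists g.
    by case: (Eb) Eb0 pEb => // g s2 _ [hg _]; exists g.
  have : fconnect (@rot M) (z, true) (g, false) by rewrite rot_v /vert /= hg.
  by move=> /(fconnect_fixed (etrans (congr1 (fun x => rot (x, true)) (esym ez)) rp)).
- move=> w wW; have wW' : w \in W by rewrite def_W mem_cat wW.
  have [|b] := missing_interior K (e := w).
    by rewrite /missing_west west wW' low_conn.
  rewrite out mem_cat mem_ups mem_downs -def_D; case: b; last by [].
  by rewrite wW'.
- move=> z zE; have zD : z \in D by rewrite def_D mem_cat zE.
  have [|b] := missing_interior K (e := z).
    by rewrite /missing_east east zD high_conn // orbT.
  rewrite out mem_cat mem_ups mem_downs -def_W; case: b; first by rewrite orbF.
  by rewrite zD.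
- move=> v; have [->|/in_ex[e <-]] := eqVneq v (south M); last by exists (e, false).
  have [e te] := out_ex (poles_neq BM); by exists (e, true).
by rewrite outline_nil -def_W -[Ea ++ _]def_D -out /on_outer connect0.
Qed.

End FromMarked.

(** * Undoing the sewing steps *)

Lemma skip_other (T : finType) (n : T) f x : x != n -> f x != n -> skip n f x = f x.
Proof. by rewrite /skip => /negbTE-> /negbTE->. Qed.

Section Backward.
Variables (V E : finType) (tl hd : E -> V).
Notation vt := (dart_vertex tl hd).
Notation core := (core tl hd).
Notation sewing := (sewing tl hd).
Notation marking := (marking tl hd).
Implicit Types (A : {set E}) (r : E * bool -> E * bool) (e x y z w : E).
Implicit Types (s t Wm Wr Ea H Ew Eb : seq E) (u v So St No Ac B C : V).

(** One orbit of the rotation contains all darts of a vertex. With [d = d'] this says that the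
    vertex has degree one. *)
Lemma two_cycle A r Wm Wr Ea H Ew Eb So St No Ac B C d d' d'' :
  sewing A r Wm Wr Ea H Ew Eb So St No Ac B C ->
  d.1 \in A -> r d = d' -> r d' = d -> d''.1 \in A -> vt d'' = vt d ->
  d'' = d \/ d'' = d'.
Proof.
move=> I dA rd rd' dA' vd.
pose P := pred2 d d'.
have Pr d0 : P d0 -> P (r d0) by move=> /orP[]/eqP->; rewrite /P /= ?rd ?rd' eqxx ?orbT.
have c : fconnect r d d'' by apply: (vs_orb (co_vs (i_core I))); rewrite ?inE.
have Pd : P d by rewrite /P /= eqxx.
by have /orP[/eqP|/eqP] := fconnect_closed Pr c Pd; [left|right].
Qed.

Lemma bwd_set A r Wm Wr Ea x Eb So St No Ac e :
  marking A r Wm Wr Ea (x :: Eb) So St No Ac ->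
  e \in A -> r (dn e) = up x -> x \notin Wm ++ Wr ->
  marking A r Wm Wr (rcons Ea x) Eb So St No (tl x).
Proof.
move=> I eA re xW; have [hx Eb_x] := i_Eb I.
split=> //.
- by have := i_core I; rewrite !outline_nil cat_rcons.
- by have [h [? _]] := i_rank I; exists h.
- exact: i_Wr0 I.
- exact: i_Wm I.
- exact: i_Wr I.
- by apply/dpath_rcons; rewrite hx; split=> //; apply: i_Ea I.
- by move=> f /(i_src I)[?|[//]|?]; [apply: Or31|apply: Or33].
- exact: i_So I.
- exact: i_snk I.
- exact: i_No I.
- exact: i_low I.
- move=> z; rewrite mem_rcons in_cons => /orP[/eqP->|/(i_high I)//].
  by exists e.
- by move=> w /(i_WE I); rewrite cat_rcons.
by move=> z; rewrite mem_rcons in_cons => /orP[/eqP->|/(i_EW I)].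
Qed.

Lemma bwd_walk A r Wm Wr Ea Ew x Eb So St No Ac B C :
  sewing A r Wm Wr Ea [::] (rcons Ew x) Eb So St No Ac B C -> x \notin Wm ->
  sewing A r Wm Wr Ea [::] Ew (x :: Eb) So St No Ac B (hd x).
Proof.
move=> I xW; have /dpath_rcons[Ew_x tx] := i_Ew I.
split; try by case: I.
- by have := i_core I; rewrite !outline_nil cat_rcons.
- have [h [hA _ hdp _]] := sewing_rank I; exists h; split=> // Ew0.
  have /= <- := i_H I; apply: leq_trans (hdp _ _ _ _ Ew_x).
    by rewrite -addn1 leq_add2l lt0n size_eq0.
  by move=> y yE; rewrite (sewing_sub I) // mem_rcons in_cons yE !orbT.
- by split=> //; rewrite tx; apply: i_Eb I.
- move=> w wW; have := i_WE I wW; rewrite !mem_cat in_cons !negb_or => /andP[-> ->].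
  by rewrite andbT /=; apply: contraNneq xW => <-.
move=> y s def_Ew; apply: (i_top I (s := rcons s x)).
by rewrite def_Ew.
Qed.

(** [x] is the only edge at the north pole and the only one leaving its own tail, so deleting it
    makes the tail the unique sink. *)
Lemma bwd_top A r Wm Wr x Eb So St No Ac :
  marking A r Wm (rcons Wr x) [::] (x :: Eb) So St No Ac -> Wr != [::] ->
  (forall e, e \in A -> tl e = tl x -> e = x) ->
  marking (A :\ x) (skip (up x) r) Wm Wr [::] Eb So St (tl x) (tl x).
Proof.
move=> I Wr0 out1; have /= NoAc := i_Ea I; have [hx Eb_x] := i_Eb I.
have /upath_rcons[Wr_x hN] := i_Wr I; have sub := sewing_sub I.
have xA : x \in A by rewrite sub // mem_head !orbT.
have Kc : core A r (up x :: dn x :: downs Eb ++ ups (Wm ++ Wr)).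
  have := i_core I; rewrite outline_nil -rcons_cat map_rcons cat_rcons => /core_rot.
  by rewrite /= -cat_cons.
have rx : r (dn x) = dn x.
  by have /= /andP[/eqP] := co_cyc Kc.
have in1 e : e \in A -> hd e = hd x -> e = x.
  move=> eA he; have := two_cycle (d := dn x) (d'' := dn e) I xA rx rx eA he.
  by case=> -[].
have ltW : tl x != So.
  have [h [hA _ _ hup]] := sewing_rank I.
  have le1 : h So <= h St.
    apply: leq_trans (hup _ _ _ _ (i_Wm I)); first exact: leq_addr.
    by move=> y yW; rewrite sub ?yW.
  have le2 : h St < h (tl x).
    apply: leq_trans (hup _ _ _ _ Wr_x); first by rewrite -addn1 leq_add2l lt0n size_eq0.
    by move=> y yW; rewrite sub // mem_rcons in_cons yW !orbT.
  by apply: contraTneq (leq_ltn_trans le1 le2) => ->; rewrite ltnn.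
have Eb0 : Eb != [::].
  by apply/eqP=> Eb0; move: Eb_x ltW; rewrite Eb0 /= => ->; rewrite eqxx.
split=> //.
- rewrite outline_nil /=; apply: (core_rot (X := downs Eb)).
  case: Eb Eb0 Kc {I Eb_x sub} => // y Eb _ Kc.
  exact: (core_unleaf (b := true) Kc).
- have [h [hA _]] := i_rank I; exists h; split=> // e.
  by rewrite in_setD1 => /andP[_ /hA].
- exact: i_Wm I.
- move=> e; rewrite in_setD1 => /andP[ex eA]; case: (i_src I eA).
  - by move=> ?; apply: Or31.
  - by case.
  move=> [g gA hg]; apply: Or33; exists g => //.
  rewrite in_setD1 gA andbT; apply/eqP=> gx.
  by have := i_No I eA; rewrite -hg gx hN eqxx.
- by move=> e; rewrite in_setD1 => /andP[_ /(i_So I)].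
- move=> e; rewrite in_setD1 => /andP[ex eA]; case: (i_snk I eA) => [he|[g gA tg]].
    by rewrite (in1 e eA) ?eqxx // in ex; rewrite he.
  have [gx|gx] := eqVneq g x; first by left; rewrite -tg gx.
  by right; exists g; rewrite // in_setD1 gx.
- move=> e; rewrite in_setD1 => /andP[ex eA].
  by apply: contra ex => /eqP/(out1 _ eA)->.
- move=> w wW; have [g gA rg] := i_low I wW.
  have gx : g != x.
    apply/eqP=> gx; have wE := i_WE I wW.
    case: (Eb) Eb0 Kc wE => // y s _ /co_cyc /= /and3P[_ /eqP]; rewrite /fc /rv /= -gx rg.
    by move=> [->] _; rewrite !in_cons eqxx orbT.
  exists g; first by rewrite in_setD1 gx.
  by rewrite skip_other ?rg // xpair_eqE ?andbF // andbT.
- by move=> w /(i_WE I); rewrite in_cons negb_or => /andP[].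
Qed.

(** The south pole has degree one, and in-degree one at [hd x] comes from [x] being missing. So
    [hd x] becomes the unique source when [x] is deleted. *)
Lemma bwd_ext A r Wm Wr Ea Ew x So St No Ac B C :
  sewing A r (x :: Wm) Wr Ea [::] (rcons Ew x) [::] So St No Ac B C -> Ew != [::] ->
  sewing (A :\ x) (skip (dn x) r) Wm Wr Ea [::] Ew [::] (hd x) St No Ac B (hd x) /\
  r (up x) = up x.
Proof.
move=> I Ew0; have sub := sewing_sub I.
have [tx Wm_x] := i_Wm I; have /dpath_rcons[Ew_x txC] := i_Ew I.
have /= AcB := i_H I.
have xA : x \in A by rewrite sub // mem_head.
have in1 : forall e, e \in A -> hd e = hd x -> e = x.
  by apply: (low_indegree I); rewrite mem_head.
have [un1 un2 _] := sewing_uniqs I.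
have [w [Ws def_W]] : exists w Ws, Wm ++ Wr = w :: Ws.
  by case: (Wm) (Wr) (i_Wr0 I) => [|w ?] [|w' ?] // _; do 2!eexists.
have Kc : core A r (dn x :: up x :: up w :: ups Ws ++ downs (Ea ++ Ew)).
  have := i_core I; rewrite outline_nil cats0 cat_cons def_W -rcons_cat map_rcons -cats1 catA.
  by move/core_rot.
have rx : r (up x) = up x by have /= /andP[/eqP] := co_cyc Kc.
have rdx : r (dn x) = up w by have /= /and3P[_ /eqP] := co_cyc Kc.
have out1 e : e \in A -> tl e = tl x -> e = x.
  move=> eA he; have := two_cycle (d := up x) (d'' := up e) I xA rx rx eA he.
  by case=> -[].
split=> //; split=> //.
- rewrite outline_nil cats0 def_W.
  exact: (core_unleaf (b := false) Kc).
- have [h [hA _ hdp _]] := sewing_rank I; exists h; split=> [e|_].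
    by rewrite in_setD1 => /andP[_ /hA].
  rewrite -AcB; apply: leq_trans (hdp _ _ _ _ Ew_x).
    by rewrite -addn1 leq_add2l lt0n size_eq0.
  by move=> y yE; rewrite sub // mem_rcons in_cons yE !orbT.
- exact: i_Wr0 I.
- exact: i_Wr I.
- exact: i_Ea I.
- move=> e; rewrite in_setD1 => /andP[ex eA]; case: (i_src I eA).
  + by rewrite -tx => /(out1 _ eA) e_x; rewrite e_x eqxx in ex.
  + by case.
  move=> [g gA hg]; have [gx|gx] := eqVneq g x; first by apply: Or31; rewrite -hg gx.
  by apply: Or33; exists g; rewrite // in_setD1 gx.
- move=> e; rewrite in_setD1 => /andP[ex eA].
  by apply: contra ex => /eqP/(in1 _ eA)->.
- move=> e; rewrite in_setD1 => /andP[ex eA]; case: (i_snk I eA) => [|[g gA tg]]; first by left.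
  right; exists g; rewrite // in_setD1 gA andbT; apply/eqP=> gx.
  by have := i_So I eA; rewrite -tg gx tx eqxx.
- by move=> e; rewrite in_setD1 => /andP[_ /(i_No I)].
- move=> w' wW; have [|g gA rg] := i_low I (w := w'); first by rewrite in_cons wW orbT.
  have gx : g != x by apply: contra_eq_neq rg => ->; rewrite rx xpair_eqE andbF.
  exists g; first by rewrite in_setD1 gx.
  rewrite skip_other ?rg // xpair_eqE ?andbF // andbT.
  by move: un1 => /= /andP[+ _]; apply: contraNneq => <-; rewrite mem_cat wW.
- move=> z zE; have [g gA rg] := i_high I zE.
  have gx : g != x.
    apply/eqP=> gx; move: rg; rewrite gx rdx => -[wz].
    by have := i_EW I zE; rewrite cat_cons def_W wz !in_cons eqxx orbT.
  exists g; first by rewrite in_setD1 gx.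
  by rewrite skip_other ?rg // xpair_eqE ?andbF // andbT.
- by move=> w' wW; apply: (i_WE I); rewrite in_cons wW orbT.
- by move=> z /(i_EW I); rewrite cat_cons in_cons negb_or => /andP[].
move=> y s def_Ew; have := i_top I (x := y) (s := rcons s x).
by rewrite def_Ew => /(_ erefl); rewrite in_cons negb_or => /andP[].
Qed.

Lemma bwd_hang A r Wm Wr Ea H x Ew Eb So St No Ac B C :
  sewing A r Wm Wr Ea (rcons H x) Ew Eb So St No Ac B C -> Ew != [::] ->
  sewing (A :\ x) (skip (dn x) r) Wm Wr Ea H Ew Eb So St No Ac (hd x) C /\
  r (up x) = up x.
Proof.
move=> I Ew0; have sub := sewing_sub I.
have /dpath_rcons[H_x tx] := i_H I.
have H0 : rcons H x != [::] by rewrite -size_eq0 size_rcons.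
have xA : x \in A by rewrite sub // mem_rcons mem_head !orbT.
have [un1 un2 HW] := sewing_uniqs I; have [BSo BC] := sewing_B_So I Ew0.
have [a [X def_a]] : exists a X, ups (rev H) ++ downs (Ew ++ Eb) = a :: X.
  by case: (rev H) (Ew) Ew0 => [|? ?] [|? ?] // _; do 2!eexists.
have Kc : core A r (dn x :: up x :: a :: X ++ (ups (Wm ++ Wr) ++ downs (Ea ++ H))).
  have := i_core I; rewrite /outline rev_rcons /= def_a -rcons_cat map_rcons cat_rcons catA.
  by move/core_rot.
have rx : r (up x) = up x by have /= /andP[/eqP] := co_cyc Kc.
have rdx : r (dn x) = a by have /= /and3P[_ /eqP] := co_cyc Kc.
have out1 e : e \in A -> tl e = tl x -> e = x.
  move=> eA he; have := two_cycle (d := up x) (d'' := up e) I xA rx rx eA he.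
  by case=> -[].
have [t [Et def_Ew]] : exists (t : E) (Et : seq E), Ew = t :: Et.
  by case: (Ew) Ew0 => // t Et _; exists t, Et.
have t_x : t != x.
  move: un2; rewrite cat_uniq => /and3P[_ _]; rewrite cat_uniq => /and3P[_ /hasPn/(_ t)].
  rewrite def_Ew mem_head => /(_ isT) + _; apply: contraNneq => ->.
  by rewrite mem_rcons mem_head.
have ht : hd t = Ac by have := i_Ew I; rewrite def_Ew => -[].
have tA : t \in A by rewrite sub // def_Ew mem_head !orbT.
have zx z : z \in Ea -> z \notin rcons H x.
  by move=> zE; move: un2; rewrite cat_uniq => /and3P[_ /hasPn nE _]; apply/negP=> zH;
    have := nE z; rewrite mem_cat zH zE => /(_ isT).
split=> //; split=> //.
- rewrite /outline def_a; have := core_unleaf (b := false) Kc; rewrite -cat_cons.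
  by move/core_rot; rewrite -catA.
- have [h [hA hC _ _]] := sewing_rank I; exists h; split=> [e|_].
    by rewrite in_setD1 => /andP[_ /hA].
  by apply: ltn_trans (hC Ew0) _; rewrite -tx hA.
- exact: i_Wr0 I.
- exact: i_Wm I.
- exact: i_Wr I.
- exact: i_Ea I.
- exact: i_Ew I.
- exact: i_Eb I.
- move=> e; rewrite in_setD1 => /andP[ex eA]; case: (i_src I eA).
  + by move=> ?; apply: Or31.
  + by rewrite -tx => -[_ /(out1 _ eA) e_x]; rewrite e_x eqxx in ex.
  move=> [g gA hg]; have [gx|gx] := eqVneq g x; last first.
    by apply: Or33; exists g; rewrite // in_setD1 gx.
  case: (seq_last H) H_x => [->/= Ac_x|[s [y ->]] _].
    by apply: Or33; exists t; rewrite ?in_setD1 ?t_x // ht Ac_x -gx.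
  by apply: Or32; rewrite -hg gx -size_eq0 size_rcons.
- by move=> e; rewrite in_setD1 => /andP[_ /(i_So I)].
(* The only darts at [hd x] are [dn x] and [up y], where [y] is the new last edge of [H]; without
   [x] nothing enters this vertex. *)
- case: (seq_last H) => [->//|[s [y def_H]]] _ e; rewrite in_setD1 => /andP[ex eA].
  have ya : a = up y by move: def_a; rewrite def_H rev_rcons => -[->].
  have ry : r (up y) = dn x.
    have := co_cyc (i_core I); rewrite /outline def_H -!rcons_cat !map_rcons !cat_rcons.
    by rewrite (catA (ups (Wm ++ Wr))) => /fcycle_adjacent.
  apply: contra ex => /eqP he.
  have [] := two_cycle (d := dn x) (d'' := dn e) I xA (etrans rdx ya) ry eA he => -[//->].
  by rewrite eqxx.
- move=> e; rewrite in_setD1 => /andP[ex eA]; case: (i_snk I eA) => [|[g gA tg]]; first by left.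
  right; exists g; rewrite // in_setD1 gA andbT; apply/eqP=> gx.
  by have := i_B I H0 eA; rewrite -tg gx tx eqxx.
- by move=> e; rewrite in_setD1 => /andP[_ /(i_No I)].
- move=> w wW; have [g gA rg] := i_low I wW.
  have gx : g != x by apply: contra_eq_neq rg => ->; rewrite rx xpair_eqE andbF.
  exists g; first by rewrite in_setD1 gx.
  rewrite skip_other ?rg // xpair_eqE ?andbF // andbT.
  by apply: contraTneq wW => ->; have := HW x; rewrite mem_rcons mem_head mem_cat negb_or => /(_ isT)/andP[].
- move=> z zE; have [g gA rg] := i_high I zE.
  have gx : g != x.
    apply/eqP=> gx; move: rg; rewrite gx rdx => az; move: def_a; rewrite az.
    case: (seq_last H) (zx z zE) => [->|[s [y ->]]]; first by rewrite def_Ew.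
    by rewrite rev_rcons => zN [yz _]; move: zN; rewrite -yz !(mem_rcons, in_cons) eqxx orbT.
  exists g; first by rewrite in_setD1 gx.
  by rewrite skip_other ?rg // xpair_eqE ?andbF // andbT.
- exact: i_WE I.
- exact: i_EW I.
exact: i_top I.
Qed.

(** The inner face west of [x] is opened: its west side [Ew] becomes outer again, and the missing
    edges [H] on its east side become a path hanging from the top [T] of the face. *)
Lemma bwd_chord A r Wm Wr Ea H Ew x Eb So St No T Ac :
  marking A r Wm Wr (Ea ++ H) (x :: Eb) So St No Ac ->
  fcycle (fc r) (up x :: ups (rev H) ++ downs Ew) ->
  uniq (up x :: ups (rev H) ++ downs Ew) -> x \notin Wm ++ Wr -> Ew != [::] ->
  dpath tl hd No Ea T -> dpath tl hd T H Ac -> dpath tl hd T Ew (tl x) ->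
  sewing (A :\ x) (skip (up x) (skip (dn x) r)) Wm Wr Ea H Ew Eb So St No T Ac (tl x).
Proof.
move=> I cycI unI xW Ew0 Ea_T H_T Ew_T; have sub := sewing_sub I.
have [hx Eb_x] := i_Eb I.
have xA : x \in A by rewrite sub // mem_head !orbT.
have [un1 un2 _] := sewing_uniqs I; rewrite /= in un2.
have [a [X def_a]] : exists a X, ups (rev H) ++ downs Ew = a :: X.
  by case: (rev H) (Ew) Ew0 => [|? ?] [|? ?] // _; do 2!eexists.
have [c [Y def_c]] : exists c Y, downs Eb ++ ups (Wm ++ Wr) ++ downs (Ea ++ H) = c :: Y.
  by case: (Eb) (Wm) (Wr) (i_Wr0 I) => [|? ?] [|? ?] [|? ?] // _; do 2!eexists.
have Kc : core A r (dn x :: c :: Y).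
  have := i_core I; rewrite outline_nil [downs (_ ++ _)]map_cat (catA (ups _)).
  by move/core_rot; rewrite /= def_c.
rewrite def_a in cycI unI.
have rdx : r (dn x) = a by have /= /andP[/eqP] := cycI.
have rux : r (up x) = c by have /= /andP[/eqP] := co_cyc Kc.
have xO : up x \notin dn x :: c :: Y.
  by rewrite -def_c in_cons !mem_cat !mem_ups !mem_downs /= orbF xpair_eqE andbF.
have disj d : d \in up x :: a :: X -> d \notin dn x :: c :: Y.
  move=> dI; apply: contra xO => dO.
  by rewrite -(fconnect_cycle (co_cyc Kc) dO) (fconnect_cycle cycI dI) mem_head.
have inA d : d \in up x :: a :: X -> d.1 \in A.
  move=> dI; rewrite -(fconnect_cycle cycI (mem_head _ _)) in dI.
  apply: (fconnect_closed (P := fun d : E * bool => d.1 \in A)) dI _ => //= d'.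
  by rewrite (sewing_dom I).
have Ew_I e : e \in Ew -> dn e \in up x :: a :: X.
  by move=> eE; rewrite -def_a in_cons mem_cat mem_downs eE !orbT.
have Ew_x e : e \in Ew -> e != x.
  by move=> /Ew_I/disj; apply: contraNneq => ->; rewrite mem_head.
have [t [Et def_Ew]] : exists (t : E) (Et : seq E), Ew = t :: Et.
  by case: (Ew) Ew0 => // t Et _; exists t, Et.
have tE : t \in Ew by rewrite def_Ew mem_head.
have tA : t \in A := inA _ (Ew_I _ tE).
have ht : hd t = T by move: Ew_T; rewrite def_Ew => -[].
have H_x y : y \in Ea ++ H -> y != x.
  by move=> yE; move: un2; rewrite cat_uniq => /and3P[_ /norP[xn _] _]; apply: contraNneq xn => <-.
(* Were [t] missing on the west, its head [T] would have in-degree one. But the top edge of the east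
   side enters [T] too: it is the first edge of [H], or [x] if [H] is empty. *)
have TW : t \notin Wm.
  apply/negP=> tW; have in1 := low_indegree I tW.
  have Ac_T : forall y, y \in A -> y != t -> hd y <> T.
    by move=> y yA yt yT; move/negP: yt; apply; apply/eqP/in1; rewrite // ht.
  case: H H_T I {H_x def_a sub def_c un2 in1} => [/= TAc|y s [hy _]] I.
    by apply: (Ac_T x); rewrite // ?TAc // eq_sym Ew_x.
  apply: (Ac_T y) => //; first by rewrite (sewing_sub I) // mem_cat mem_head !orbT.
  by apply: contraTneq (i_WE I tW) => <-; rewrite !mem_cat mem_head orbT.
split.
- have := core_unchord Kc cycI unI xO; rewrite -cat_cons -def_a -def_c.
  rewrite /outline [downs (Ew ++ _)]map_cat (catA (ups (rev H))) => K.
  by rewrite catA; apply: core_rot; rewrite -catA.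
- have [h [hA _]] := i_rank I; exists h; split=> [e|_]; last by rewrite -hx hA.
  by rewrite in_setD1 => /andP[_ /hA].
- exact: i_Wr0 I.
- exact: i_Wm I.
- exact: i_Wr I.
- exact: Ea_T.
- exact: H_T.
- exact: Ew_T.
- exact: Eb_x.
- move=> e; rewrite in_setD1 => /andP[ex eA]; case: (i_src I eA).
  + by move=> ?; apply: Or31.
  + by case.
  move=> [g gA hg]; have [gx|gx] := eqVneq g x; last first.
    by apply: Or33; exists g; rewrite // in_setD1 gx.
  case: (seq_last H) H_T => [->/= TAc|[s [y ->]] _].
    by apply: Or33; exists t; rewrite ?in_setD1 ?Ew_x // ht TAc -hx -gx.
  by apply: Or32; rewrite -hg gx -size_eq0 size_rcons hx.
- by move=> e; rewrite in_setD1 => /andP[_ /(i_So I)].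
- case: (seq_last H) => [->//|[s [y def_H]]] _ e; rewrite in_setD1 => /andP[ex eA].
  have ya : a = up y by move: def_a; rewrite def_H rev_rcons => -[->].
  have ry : r (up y) = dn x.
    have := co_cyc (i_core I); rewrite outline_nil def_H -rcons_cat cat_rcons.
    by rewrite (map_cat _ (Ea ++ s)) catA => /fcycle_adjacent.
  apply: contra ex => /eqP he; rewrite -hx in he.
  have [] := two_cycle (d := dn x) (d'' := dn e) I xA (etrans rdx ya) ry eA he => -[//->].
  by rewrite eqxx.
- move=> e; rewrite in_setD1 => /andP[ex eA]; case: (i_snk I eA) => [|[g gA tg]]; first by left.
  have [gx|gx] := eqVneq g x; last by right; exists g; rewrite // in_setD1 gx.
  right; case: (seq_last Ew) Ew_T Ew0 => [->//|[s [l def_l]]].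
  have lE : l \in Ew by rewrite def_l mem_rcons mem_head.
  rewrite {1}def_l => /dpath_rcons[_ tl_l] _; exists l; last by rewrite tl_l -gx.
  by rewrite in_setD1 Ew_x // (inA _ (Ew_I _ lE)).
- by move=> e; rewrite in_setD1 => /andP[_ /(i_No I)].
- move=> w wW; have [g gA rg] := i_low I wW; have wE := i_WE I wW.
  have gx : g != x.
    have Wr0 := i_Wr0 I; apply/eqP=> gx; move: def_c; rewrite -rux -gx rg.
    case: Eb wE {I Eb_x sub un2 Kc} => [|y s] wE; last first.
      by move=> [yw _]; case/negP: wE; rewrite yw mem_cat !in_cons eqxx !orbT.
    by case: (Wm) (Wr) Wr0 => [|? ?] [|? ?].
  have wx : w != x by apply: contraNneq wE => ->; rewrite mem_cat mem_head orbT.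
  have ne b d : d.1 != x -> d != (x, b) by apply: contraNneq => ->.
  exists g; first by rewrite in_setD1 gx.
  by rewrite skip_other ?ne // skip_other ?rg ?ne.
- move=> z zE; have zE' : z \in Ea ++ H by rewrite mem_cat zE.
  have [g gA rg] := i_high I zE'.
  have gx : g != x.
    apply/eqP=> gx; move: def_a; rewrite -rdx -gx rg.
    case: (seq_last H) un2 => [->|[s [y ->]]] un2; first by rewrite def_Ew.
    rewrite rev_rcons => -[yz _]; move: un2; rewrite yz cat_uniq => /and3P[+ _ _].
    rewrite cat_uniq => /and3P[_ /hasPn/(_ z)].
    by rewrite mem_rcons mem_head zE => /(_ isT).
  have zx := H_x z zE'.
  have ne b d : d.1 != x -> d != (x, b) by apply: contraNneq => ->.
  exists g; first by rewrite in_setD1 gx.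
  by rewrite skip_other ?ne // skip_other ?rg ?ne.
- move=> w /(i_WE I); rewrite !mem_cat in_cons !negb_or.
  by case/andP=> /andP[-> _] /andP[_ ->].
- by move=> z zE; apply: (i_EW I); rewrite mem_cat zE.
by move=> y s; rewrite def_Ew => -[<-].
Qed.

End Backward.

(** * Reading off the last move at the edge below the active vertex *)

Section Cases.
Variables (V E : finType) (tl hd : E -> V).
Notation vt := (dart_vertex tl hd).
Variables (A : {set E}) (r : E * bool -> E * bool) (Wm Wr Ea : seq E) (x : E).
Variables (Eb : seq E) (So St No Ac : V).
Hypothesis I : marking tl hd A r Wm Wr Ea (x :: Eb) So St No Ac.

Let sub := sewing_sub I.

Let hx : hd x = Ac. Proof. by case: (i_Eb I). Qed.

Let xA : x \in A. Proof. by rewrite sub // mem_head !orbT. Qed.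

(** A missing eastern edge above [x] would be the only edge leaving the head of [x], hence equal to
    the next western edge, against [i_EW]. So [x] ends at the north pole. *)
Lemma bridge_top : x \in Wm ++ Wr -> Ea = [::] /\ exists s, Wr = rcons s x.
Proof.
have xWm : x \notin Wm by apply/negP=> /(i_WE I); rewrite mem_cat mem_head orbT.
rewrite mem_cat (negbTE xWm) /= => xW; case/splitPr def_Wr: _ / xW => [p q].
have q0 y s : q = y :: s -> [/\ tl y = hd x, y \in Wr & y \in A].
  move=> def_q; have yW : y \in Wr by rewrite def_Wr def_q mem_cat !in_cons eqxx !orbT.
  split; rewrite ?sub ?yW ?orbT //.
  by have := i_Wr I; rewrite def_Wr def_q => /upath_cat[m _ /= [_ []]].
have Ea0 : Ea = [::].
  have Wp := i_Wr I; case: (seq_last Ea) => // -[s [z def_Ea]].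
  have := i_Ea I; rewrite {1}def_Ea => /dpath_rcons[_ tz].
  have zE : z \in Ea by rewrite def_Ea mem_rcons mem_head.
  have zA : z \in A by rewrite sub // zE !orbT.
  case: (q) def_Wr q0 => [|y t] def_Wr q0.
    move: Wp; rewrite def_Wr => /upath_cat[m _ [_ /= hN]].
    by have := i_No I zA; rewrite tz -hx hN eqxx.
  have [ty yW yA] := q0 y t erefl.
  have yz := high_outdegree I isT zE yA (etrans ty (etrans hx (esym tz))).
  by have := i_EW I zE; rewrite -yz mem_cat yW orbT.
split=> //; exists p; rewrite -cats1; case: (q) q0 => // y s q0.
have [ty _ yA] := q0 _ _ erefl; have /= NoAc : dpath tl hd No [::] Ac by rewrite -Ea0; apply: i_Ea I.
by have := i_No I yA; rewrite ty hx NoAc eqxx.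
Qed.

(** In the outer walk [up x] follows the western edge below it and [dn x] precedes the next eastern
    edge, so [up x] stands between two downward darts and [outdegree_one] applies. *)
Lemma bridge_out s : Wr = rcons s x -> s != [::] ->
  forall e, e \in A -> tl e = tl x -> e = x.
Proof.
move=> def_Wr; case: (seq_last s) => [->//|[s' [y def_s]]] _.
have yA : y \in A by rewrite sub // def_Wr def_s mem_rcons in_cons mem_rcons mem_head !orbT.
have hy : hd y = tl x.
  by have := i_Wr I; rewrite def_Wr def_s => /upath_rcons[/upath_rcons[]].
case def_Eb: Eb => [|z t].
  have := i_Eb I; rewrite def_Eb => -[_ /= tx].
  by have := i_So I yA; rewrite hy tx eqxx.
have cyc := co_cyc (i_core I); rewrite outline_nil def_Wr def_s def_Eb in cyc.
have ry : r (dn y) = up x.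
  move: cyc; rewrite -!rcons_cat !map_rcons !cat_rcons; exact: fcycle_adjacent.
have rx : r (up x) = dn z.
  move: cyc; rewrite [downs _]map_cat /= catA; exact: fcycle_adjacent.
by apply: (outdegree_one I) ry rx.
Qed.

Lemma bridge_single : x \in Wm ++ Wr -> Wr = [:: x] ->
  [/\ Wm = [::], Eb = [::], A = [set x], r (dn x) = dn x & r (up x) = up x].
Proof.
move=> xW def_Wr; have [Ea0 _] := bridge_top xW.
have := i_Wr I; rewrite def_Wr => -[tx /= hN].
have Wm0 : Wm = [::].
  case: (seq_last Wm) => // -[s [w def_Wm]].
  have wW : w \in Wm by rewrite def_Wm mem_rcons mem_head.
  have wA : w \in A by rewrite sub ?wW.
  have := i_Wm I; rewrite {1}def_Wm => /upath_rcons[_ hw].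
  case def_Eb: Eb => [|y t].
    have := i_Eb I; rewrite def_Eb => -[_ /= txS].
    by have := i_So I wA; rewrite hw -tx txS eqxx.
  have := i_Eb I; rewrite def_Eb => -[_ [hy _]].
  have yA : y \in A by rewrite sub // def_Eb !in_cons eqxx !orbT.
  have yw := low_indegree I wW yA (etrans hy (etrans tx (esym hw))).
  by have := i_WE I wW; rewrite -yw def_Eb mem_cat !in_cons eqxx !orbT.
have SoSt : So = St by have := i_Wm I; rewrite Wm0.
have Eb0 : Eb = [::].
  case def_Eb: Eb => [//|y t]; have := i_Eb I; rewrite def_Eb => -[_ [hy _]].
  have yA : y \in A by rewrite sub // def_Eb !in_cons eqxx !orbT.
  by have := i_So I yA; rewrite hy tx SoSt eqxx.
have := co_cyc (i_core I); rewrite outline_nil Wm0 def_Wr Ea0 Eb0 /= andbT.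
case/andP=> /eqP rdx /eqP rux; rewrite /fc /rv /= in rdx rux.
split=> //; apply/setP=> e; rewrite inE; apply/idP/eqP => [|->//].
have [h [hA _]] := i_rank I; pose K := \max_v h v.
have in1 f : f \in A -> hd f = hd x -> f = x.
  move=> fA hf; have := two_cycle (d := dn x) (d'' := dn f) I xA rdx rdx fA hf.
  by case=> -[].
(* Every edge continues upwards to an edge into the north pole, which must be [x]; and no edge
   precedes [x], whose tail is the south pole. *)
elim: {e}_.+1 {-2}e (ltnSn (K - h (hd e))) => // n IHn e lt_e eA.
case: (i_snk I eA) => [he|[g gA tg]]; first by apply: in1; rewrite ?hN.
have gx : g = x.
  have lt_eg : h (hd e) < h (hd g) by rewrite -tg hA.
  apply: IHn gA; rewrite ltnS in lt_e; apply: leq_trans lt_e.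
  by apply: ltn_sub2l; rewrite //; apply: leq_trans lt_eg _; rewrite /K (leq_bigmax (hd g)).
by have := i_So I eA; rewrite -tg gx tx SoSt eqxx.
Qed.

(** The dart before [up x] at its tail decides: downward for a missing edge that has been sewn,
    upward for the bottom east edge of a face. In the former case an edge enters the tail, which is
    then not the south pole. *)
Lemma no_bridge_ex : x \notin Wm ++ Wr ->
  (exists2 e, e \in A & r (dn e) = up x) /\ Eb != [::] \/
  exists2 e, e \in A & r (up e) = up x.
Proof.
move=> xW; have rp : r (finv r (up x)) = up x by rewrite f_finv //; apply: sewing_inj I.
have pA : (finv r (up x)).1 \in A by rewrite -(sewing_dom I) rp.
case: (finv _ _) rp pA => e [] rp eA; [right|left]; first by exists e.
split; first by exists e.
apply/eqP=> Eb0; have := i_Eb I; rewrite Eb0 => -[_ /= tx].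
have := sewing_vt I (eA : (dn e).1 \in A); rewrite rp /dart_vertex /= tx => he.
by have := i_So I eA; rewrite -he eqxx.
Qed.

Lemma face_upath e s : e \in A -> fpath (fc r) (up e) (ups s) ->
  upath tl hd (hd e) s (hd (last e s)) /\ {subset s <= A}.
Proof.
elim: s e => [|y s IHs] e eA //= /andP[/eqP fe p].
have yA : y \in A by have := sewing_dom I (dn e); rewrite -[r _]/(fc r (up e)) fe /= => ->.
have [py sA] := IHs _ yA p; split=> [|z]; last first.
  by rewrite in_cons => /predU1P[->|/sA].
by split=> //; have := sewing_vt I (eA : (dn e).1 \in A); rewrite -[r _]/(fc r (up e)) fe.
Qed.

Lemma face_dpath e s : e \in A -> fpath (fc r) (dn e) (downs s) ->
  dpath tl hd (tl e) s (tl (last e s)) /\ {subset s <= A}.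
Proof.
elim: s e => [|y s IHs] e eA //= /andP[/eqP fe p].
have yA : y \in A by have := sewing_dom I (up e); rewrite -[r _]/(fc r (dn e)) fe /= => ->.
have [py sA] := IHs _ yA p; split=> [|z]; last first.
  by rewrite in_cons => /predU1P[->|/sA].
by split=> //; have := sewing_vt I (eA : (up e).1 \in A); rewrite -[r _]/(fc r (dn e)) fe.
Qed.

(** The lower end of a missing eastern edge has only one outgoing edge, so a path going up from
    there is forced to follow the missing edges. *)
Lemma face_east s Es u v : (exists Es', Ea = Es ++ Es') ->
  upath tl hd u s v -> {subset s <= A} -> dpath tl hd No Es u ->
  exists Ea', Es = Ea' ++ rev s.
Proof.
elim: s Es u => [|y s IHs] Es u [Es' def_Ea] /=; first by exists Es; rewrite cats0.
case=> ty p sA; have yA : y \in A by apply: sA; rewrite mem_head.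
case: (seq_last Es) def_Ea => [->/= _ Nu|[Es1 [z ->]] def_Ea /dpath_rcons[q tz]].
  by have := i_No I yA; rewrite ty Nu eqxx.
have zE : z \in Ea by rewrite def_Ea mem_cat mem_rcons mem_head.
have yz := high_outdegree I isT zE yA (etrans ty (esym tz)).
have [||||Ea' ->] := IHs Es1 (hd y).
- by exists (z :: Es'); rewrite def_Ea cat_rcons.
- by [].
- by move=> w ws; apply: sA; rewrite in_cons ws orbT.
- by rewrite yz.
by exists Ea'; rewrite rev_cons rcons_cat yz.
Qed.

(** The orbit of [up x] is the inner face west of [x]. Opened at its only bottom corner, it goes up
    its east side, which [face_east] places at the lower end of [Ea], and down its west side. *)
Lemma face_cycle e : x \notin Wm ++ Wr -> e \in A -> r (up e) = up x ->
  exists Ea' H Ew T, [/\ Ea = Ea' ++ H, Ew != [::],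
    fcycle (fc r) (up x :: ups (rev H) ++ downs Ew),
    uniq (up x :: ups (rev H) ++ downs Ew) &
    [/\ dpath tl hd No Ea' T, dpath tl hd T H Ac & dpath tl hd T Ew (tl x)]].
Proof.
move=> xW eA re; have ri := sewing_inj I; have fi := fc_inj ri.
set O := orbit (fc r) (up x).
have cycO : fcycle (fc r) O by apply: cycle_orbit.
have unO : uniq O by apply: orbit_uniq.
have def_O : O = up x :: behead O.
  by rewrite /O /orbit; case: (order _ _) (order_gt0 (fc r) (up x)).
have xO : up x \in O by rewrite def_O mem_head.
have eO : dn e \in O by apply: (fcycle_in fi cycO); rewrite [fc _ _]re.
have out d : d \in O -> d \notin outline Wm Wr Ea [::] [::] (x :: Eb).
  move=> dO; have xout : up x \notin outline Wm Wr Ea [::] [::] (x :: Eb).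
    by rewrite mem_outline cats0.
  apply: contra xout => dout.
  by rewrite -(fconnect_cycle (co_cyc (i_core I)) dout) (fconnect_cycle cycO dO).
have inA d : d \in O -> d.1 \in A.
  rewrite -fconnect_orbit => c.
  apply: (fconnect_closed (P := fun d : E * bool => d.1 \in A)) c _ => //= d'.
  by rewrite (sewing_dom I).
have [t1 [t2 def_O']] : exists t1 t2, O = ups t1 ++ downs t2.
  apply: ups_downs => s1 s2 y z def_s; apply: contraT; rewrite negb_or negbK => /andP[yd zu].
  have fy : fc r y = z by move: cycO; rewrite def_s => /fcycle_adjacent.
  have yO : y \in O by rewrite def_s mem_cat mem_head orbT.
  case: y yd fy yO def_s => y [] //= _ fy yO def_s.
  have ye : y = e.
    apply: (co_face (i_core I)); rewrite ?re ?(inA _ yO) ?out //.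
      by rewrite -[r _]/(fc r (dn y)) fy.
    by rewrite (fconnect_cycle cycO yO).
  have ez : z = up x by rewrite -fy ye.
  case: s1 def_s => [|d s1] def_s; first by move: def_O; rewrite def_s.
  move: unO; rewrite def_O in def_s *; case: def_s => _ ->.
  by rewrite ez /= mem_cat !in_cons eqxx !orbT.
have t20 : t2 != [::].
  by apply: contraTneq eO => t20; rewrite def_O' t20 cats0 mem_ups.
case: t1 def_O' => [|x' t1] def_O'; first by move: def_O; rewrite def_O'; case: (t2).
have xx' : x = x' by move: def_O; rewrite def_O' => -[].
rewrite -{x'}xx' in def_O'; rewrite def_O' in cycO unO inA.
case: t2 t20 def_O' cycO unO inA => // t Et _ def_O' cycO unO inA.
have /= := cycO; rewrite rcons_path cat_path /= last_cat /= !last_map.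
case/andP=> /and3P[p1 /eqP f1 p2] /eqP f2.
have [up1 sA1] := face_upath xA p1.
have tA : t \in A by apply: (inA (dn t)); rewrite in_cons mem_cat mem_head !orbT.
have [dp2 sA2] := face_dpath tA p2.
have lA : last x t1 \in A.
  by have := mem_last x t1; rewrite in_cons => /predU1P[->|/sA1].
have l2A : last t Et \in A.
  by have := mem_last t Et; rewrite in_cons => /predU1P[->|/sA2].
have ht : hd t = hd (last x t1).
  by have := sewing_vt I (lA : (dn (last x t1)).1 \in A); rewrite -[r _]/(fc r (up _)) f1.
have tx : tl x = tl (last t Et).
  by have := sewing_vt I (l2A : (up (last t Et)).1 \in A); rewrite -[r _]/(fc r (dn _)) f2.
have NAc := i_Ea I; rewrite -hx in NAc.
have [|Ea' def_Ea] := face_east _ up1 sA1 NAc; first by exists [::]; rewrite cats0.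
have pH : dpath tl hd (hd (last x t1)) (rev t1) Ac by move/upath_rev: up1; rewrite hx.
exists Ea', (rev t1), (t :: Et), (hd (last x t1)); rewrite revK; split=> //.
split=> //; last by split=> //; rewrite tx.
move: NAc; rewrite def_Ea => /dpath_cat[m pEa' pm].
suff <- : m = hd (last x t1) by [].
by case: (rev t1) pm pH => [|y s] /=; [move=> -> ->|case=> -> _ []].
Qed.

End Cases.

(** Shows that a walked edge that is missing on the west can be undone by [bwd_ext]. A missing
    western edge below [x] would be the only edge entering [tl x], which leaves no way to continue
    the eastern boundary from there to the south pole. *)
Lemma walked_low (V E : finType) (tl hd : E -> V) A r Wm Wr Ea Ew x Eb So St No Ac B C :
  sewing tl hd A r Wm Wr Ea [::] (rcons Ew x) Eb So St No Ac B C -> x \in Wm ->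
  [/\ Eb = [::], Ew != [::] & exists s, Wm = x :: s].
Proof.
move=> I xW; have sub := sewing_sub I.
have xA : x \in A by rewrite sub ?xW.
have Ew0 : Ew != [::].
  by apply: contraTneq xW => Ew0; apply: (i_top I (s := [::])); rewrite Ew0.
have /dpath_rcons[_ tx] := i_Ew I.
case/splitPr def_W: _ / xW (i_Wm I) => [s1 s2] pW.
have Eb0 : s1 = [::] -> Eb = [::].
  case: Eb I {sub} => // y s I s10; have [hy _] := i_Eb I.
  have yA : y \in A by rewrite (sewing_sub I) // mem_head !orbT.
  move: pW; rewrite s10 => -[txS _].
  by have := i_So I yA; rewrite hy -tx txS eqxx.
case: (seq_last s1) => [s10|[s [w def_s1]]].
  by split; [apply: Eb0 | | exists s2; rewrite s10].
exfalso; have wW : w \in Wm by rewrite def_W def_s1 mem_cat mem_rcons mem_head.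
have wA : w \in A by rewrite sub ?wW.
have hw : hd w = tl x by move: pW; rewrite def_s1 => /upath_cat[m /upath_rcons[_ <-] [-> _]].
case def_Eb: Eb => [|y t].
  have := i_Eb I; rewrite def_Eb /= => CSo.
  by have := i_So I wA; rewrite hw tx CSo eqxx.
have := i_Eb I; rewrite def_Eb => -[hy _].
have yA : y \in A by rewrite sub // def_Eb mem_head !orbT.
have yw := low_indegree I wW yA (etrans hy (etrans (esym tx) (esym hw))).
by have := i_WE I wW; rewrite -yw def_Eb mem_cat mem_head orbT.
Qed.

Lemma old_None (E : eqType) (d : E * bool) b : (old d == (None, b)) = false.
Proof. by case: d. Qed.

Lemma None_old (E : eqType) (d : E * bool) b : ((None, b) == old d) = false.
Proof. by case: d. Qed.

Lemma gd_eqF (E E' : eqType) (g : E -> E') d x b :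
  (forall y, g y != x) -> (gd g d == (x, b)) = false.
Proof. by move=> gx; rewrite /gd xpair_eqE (negbTE (gx _)). Qed.

(** * Embeddings when one edge is put back or taken away *)

Section Extend.
Variables (N : map_data) (V E : finType) (tl hd : E -> V).
Variables (f : vertex N -> V) (g : edge N -> E) (A : {set E}) (x : E).
Variable (r : E * bool -> E * bool).
Hypothesis ri : injective r.
Hypothesis xA : x \in A.
Notation vt := (dart_vertex tl hd).

Definition ext_edge (o : option (edge N)) : E := if o is Some e then g e else x.
Definition ext_vertex (w : V) (o : option (vertex N)) : V :=
  if o is Some u then f u else w.

Lemma ext_codom : (forall e, (e \in A :\ x) = (e \in codom g)) ->
  forall e, (e \in A) = (e \in codom ext_edge).
Proof.
move=> gA e; apply/idP/codomP => [eA|[[y|] ->] //].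
  have [->|ex] := eqVneq e x; first by exists None.
  have : e \in codom g by rewrite -gA in_setD1 ex.
  by case/codomP=> y ->; exists (Some y).
by have := codom_f g y; rewrite -gA in_setD1 => /andP[].
Qed.

Lemma ext_edge_inj : (forall e, (e \in A :\ x) = (e \in codom g)) ->
  injective g -> injective ext_edge.
Proof.
move=> gA gi; have gx y : g y != x.
  by have := codom_f g y; rewrite -gA in_setD1 => /andP[].
case=> [y|] [z|] //= => [/gi-> //|e|e].
  by have := gx y; rewrite e eqxx.
by have := gx z; rewrite -e eqxx.
Qed.

(** Redoes a removal: sewing a leaf to [N] at the corner corresponding to [r (x, b)] realises the
    submap with [x] put back. *)
Lemma emb_leaf b c s n a : emb (M := N) tl hd f g (A :\ x) (skip (x, b) r) ->
  r (x, b) = gd g c -> r (x, ~~ b) = (x, ~~ b) ->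
  vt (r (x, b)) = vt (x, b) -> (forall u, f u != vt (x, ~~ b)) ->
  emb (M := @add_leaf N b c s n a) tl hd (ext_vertex (vt (x, ~~ b))) ext_edge A r.
Proof.
move=> em rc rx vx fresh.
have gA := emb_A em; have gx y : g y != x.
  by have := codom_f g y; rewrite -gA in_setD1 => /andP[].
have vc : vt (x, b) = f (vert c) by rewrite -vx rc (emb_vt em).
split.
- case=> [u|] [u'|] //= => [/(emb_f em)-> //|e|e].
    by have := fresh u; rewrite e eqxx.
  by have := fresh u'; rewrite -e eqxx.
- exact: ext_edge_inj (emb_g em).
- exact: ext_codom.
- case=> [y|] /=; first exact: emb_tl em y.
  by case: (b) vc => [vc|_] //; rewrite -vc.
- case=> [y|] /=; first exact: emb_hd em y.
  by case: (b) vc => [_|vc] //; rewrite -vc.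
have oldE d : gd ext_edge (old d) = gd g d by [].
case=> -[y|] b' /=; rewrite /insert_before /=.
  rewrite -[(Some y, b')]/(old (y, b')) oldE.
  have := emb_rot em (y, b'); rewrite /skip.
  have -> : (gd g (y, b') == (x, b)) = false by apply: gd_eqF.
  rewrite (inj_eq (@old_inj _)).
  case: (r _ =P (x, b)) => [-> |ne].
    by rewrite rc => /(gd_inj em)->; rewrite eqxx.
  move=> ry; have -> : (rot (y, b') == c) = false.
    apply/eqP=> yc; move: ry; rewrite yc -rc => /ri /(congr1 fst) /= e.
    by have := gx y; rewrite e eqxx.
  by rewrite oldE.
rewrite xpair_eqE eqxx /=; case: (b' =P b) => [->|/eqP]; first by rewrite oldE.
by move: rx; case: (b); case: (b').
Qed.

Lemma emb_chord c a :
  emb (M := N) tl hd f g (A :\ x) (skip (up x) (skip (dn x) r)) ->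
  r (up x) = gd g c -> r (dn x) = gd g a ->
  vt (r (up x)) = vt (up x) -> vt (r (dn x)) = vt (dn x) ->
  emb (M := @add_chord N c a) tl hd f ext_edge A r.
Proof.
move=> em rc ra vc va.
have gA := emb_A em; have gx y : g y != x.
  by have := codom_f g y; rewrite -gA in_setD1 => /andP[].
have gxd d b : (gd g d == (x, b)) = false by apply: gd_eqF.
have ac : c != a by apply/eqP=> ca; move: rc; rewrite ca -ra => /ri [].
split.
- exact: emb_f em.
- exact: ext_edge_inj (emb_g em).
- exact: ext_codom.
- case=> [y|] /=; first exact: emb_tl em y.
  by rewrite -(emb_vt em) -rc vc.
- case=> [y|] /=; first exact: emb_hd em y.
  by rewrite -(emb_vt em) -ra va.
have oldE d : gd ext_edge (old d) = gd g d by [].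
case=> -[y|] b' /=; rewrite /insert_before /=; last first.
  case: b'; last by rewrite [_ == up None]xpair_eqE andbF None_old eqxx oldE.
  by rewrite eqxx (inj_eq (@old_inj _)) (negbTE ac) old_None oldE.
rewrite -[(Some y, b')]/(old (y, b')) oldE (inj_eq (@old_inj _)).
have := emb_rot em (y, b'); rewrite {1}/skip gxd.
have -> : skip (dn x) r (gd g (y, b')) =
    if r (gd g (y, b')) == dn x then gd g a else r (gd g (y, b')).
  by rewrite /skip gxd ra.
have -> : skip (dn x) r (up x) = gd g c.
  by rewrite /skip rc gxd xpair_eqE andbF.
case: (r _ =P dn x) => [-> |ne1].
  rewrite gxd => /(gd_inj em) <-; rewrite [a == c]eq_sym (negbTE ac).
  by rewrite eqxx.
case: (r _ =P up x) => [-> |ne2].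
  move=> /(gd_inj em) <-; rewrite eqxx None_old.
  by rewrite [_ == dn None]xpair_eqE andbF.
move=> ry; have -> : (rot (y, b') == c) = false.
  apply/eqP=> yc; move: ry; rewrite yc -rc => /ri /(congr1 fst) /= e.
  by have := gx y; rewrite e eqxx.
rewrite (inj_eq (@old_inj _)); have -> : (rot (y, b') == a) = false.
  apply/eqP=> yc; move: ry; rewrite yc -ra => /ri /(congr1 fst) /= e.
  by have := gx y; rewrite e eqxx.
by rewrite old_None oldE.
Qed.

End Extend.

Section Restrict.
Variables (N : map_data) (V E : finType) (tl hd : E -> V).
Variables (A : {set E}) (r : E * bool -> E * bool).

Lemma restrict_codom (T : finType) (g : option T -> E) : injective g ->
  (forall e, (e \in A) = (e \in codom g)) ->
  forall e, (e \in A :\ g None) = (e \in codom (g \o Some)).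
Proof.
move=> gi gA e; rewrite in_setD1 gA; apply/andP/codomP => [[]|[y ->]].
  by move=> /eqP ne /codomP[[y|] ey]; [exists y | case: ne].
by split; rewrite /= ?(inj_eq gi) ?codom_f.
Qed.

(** The converse of [emb_leaf]. The corner used by the sewing is recovered from the ambient
    rotation, which is what injectivity needs. *)
Lemma emb_unleaf b (c : dart N) s n a f g :
  emb (M := @add_leaf N b c s n a) tl hd f g A r ->
  emb (M := N) tl hd (f \o Some) (g \o Some) (A :\ g None) (skip (g None, b) r) /\
  r (g None, b) = gd (g \o Some) c.
Proof.
move=> em; have gi := emb_g em; have ro := emb_rot em.
have gdi := gd_inj em.
have rc : r (g None, b) = gd (g \o Some) c.
  have := ro (None, b); rewrite /= /insert_before /= => ->.
  by rewrite eqxx.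
split=> //; split.
- by move=> u u' /(emb_f em)[].
- by move=> y y' /gi[].
- by apply: restrict_codom => //; apply: emb_A em.
- by move=> y; apply: emb_tl em (Some y).
- by move=> y; apply: emb_hd em (Some y).
move=> d; have := ro (old d); rewrite -[gd g (old d)]/(gd (g \o Some) d).
have gN b' d' : (gd (g \o Some) d' == (g None, b')) = false.
  by apply: gd_eqF => y /=; rewrite (inj_eq gi).
rewrite /skip gN => ->.
case: d => y b' /=; rewrite /insert_before /= (inj_eq (@old_inj _)).
case: (rot _ =P c) => [->|_]; first by rewrite eqxx rc.
by rewrite -[gd g (old _)]/(gd (g \o Some) _) gN.
Qed.

(** If [c] and [a] coincided, the dart following [up None] would be [dn None] instead of the old
    corner. *)
Lemma emb_unchord (c a : dart N) f g : c != a -> injective r ->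
  emb (M := @add_chord N c a) tl hd f g A r ->
  [/\ emb (M := N) tl hd f (g \o Some) (A :\ g None)
        (skip (up (g None)) (skip (dn (g None)) r)),
      r (up (g None)) = gd (g \o Some) c & r (dn (g None)) = gd (g \o Some) a].
Proof.
move=> ca ri em; have gi := emb_g em; have ro := emb_rot em.
have rc : r (up (g None)) = gd (g \o Some) c.
  have := ro (None, true); rewrite /= /insert_before /= => ->.
  by rewrite (inj_eq (@old_inj _)) (negbTE ca).
have ra : r (dn (g None)) = gd (g \o Some) a.
  have := ro (None, false); rewrite /= /insert_before /= => ->.
  by [].
have gN d b : (gd (g \o Some) d == (g None, b)) = false.
  by apply: gd_eqF => y /=; rewrite (inj_eq gi).
split=> //; split.
- exact: emb_f em.
- by move=> y y' /gi[].
- by apply: restrict_codom => //; apply: emb_A em.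
- by move=> y; apply: emb_tl em (Some y).
- by move=> y; apply: emb_hd em (Some y).
move=> d; have := ro (old d); rewrite -[gd g (old d)]/(gd (g \o Some) d).
rewrite {1}/skip gN.
have -> : skip (dn (g None)) r (gd (g \o Some) d) =
    if r (gd (g \o Some) d) == dn (g None) then gd (g \o Some) a else r (gd (g \o Some) d).
  by rewrite /skip gN ra.
have -> : skip (dn (g None)) r (up (g None)) = gd (g \o Some) c.
  by rewrite /skip rc gN xpair_eqE andbF.
move=> ->; case: d => y b' /=; rewrite /insert_before /= (inj_eq (@old_inj _)).
have gdN b : gd g (None, b) = (g None, b) by [].
case: (rot (y, b') =P c) => [->|_].
  by rewrite None_old [up None == _]xpair_eqE andbF gdN [_ == dn _]xpair_eqE andbF eqxx.
rewrite (inj_eq (@old_inj _)) old_None.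
case: (rot (y, b') =P a) => [->|_]; first by rewrite gdN eqxx gN.
by rewrite -[gd g (old _)]/(gd (g \o Some) _) !gN.
Qed.

End Restrict.

(** * Surjectivity *)

Section Reach.
Variables (V E : finType) (tl hd : E -> V).
Notation vt := (dart_vertex tl hd).
Notation sewing := (sewing tl hd).
Notation marking := (marking tl hd).
Implicit Types (A : {set E}) (r : E * bool -> E * bool) (e x y z w : E).
Implicit Types (s t Wm Wr Ea H Ew Eb : seq E) (u v So St No Ac B C : V).

Definition marks (N : map_data) (f : vertex N -> V) So St No : Prop :=
  [/\ f (south N) = So, f (start N) = St & f (north N) = No].

Definition placed (p : pointed) A r So St No Ac c a : Prop :=
  exists f g, [/\ emb (M := pm p) tl hd f g A r, marks f So St No, f (active (pm p)) = Ac &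
    [/\ forall q : vertex (pm p), exists d, vert d = q, gd g (pc p) = c & gd g (pa p) = a]].

Definition reached A r Wm Wr Ea Eb So St No Ac : Prop :=
  exists (mv : seq move) f g, [/\ emb (M := map_of_moves mv) tl hd f g A r, marks f So St No,
    f (active (map_of_moves mv)) = Ac &
    gd g (outer (map_of_moves mv)) \in outline Wm Wr Ea [::] [::] Eb].

Lemma leaf_next A r Wm Wr Ea H x Ew Eb So St No Ac B C a X :
  sewing A r Wm Wr Ea (rcons H x) Ew Eb So St No Ac B C ->
  ups (rev H) ++ downs (Ew ++ Eb) = a :: X -> r (dn x) = a.
Proof.
move=> I def_a; have := co_cyc (i_core I); rewrite /outline rev_rcons /= def_a.
rewrite -rcons_cat map_rcons cat_rcons -[dn x :: _]cat1s catA (catA (_ ++ _)).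
rewrite -catA -cat1s catA => /fcycle_adjacent; exact.
Qed.

Lemma emb_live_fresh (N : map_data) (f : vertex N -> V) g A r Wm Wr Ea H Ew Eb So St No Ac B C x b :
  emb (M := N) tl hd f g (A :\ x) (skip (x, b) r) ->
  (forall q : vertex N, exists d, vert d = q) ->
  sewing A r Wm Wr Ea H Ew Eb So St No Ac B C -> x \in A ->
  r (x, ~~ b) = (x, ~~ b) -> forall u : vertex N, f u != vt (x, ~~ b).
Proof.
move=> em live I xA rx u; have [d <-] := live u; rewrite -(emb_vt em).
apply/eqP => vd; have := emb_mem em d.1; rewrite in_setD1 => /andP[dx dA].
have [e|e] := two_cycle I (xA : (x, ~~ b).1 \in A) rx rx (dA : (gd g d).1 \in A) vd;
  by have := congr1 fst e => /= e1; rewrite e1 eqxx in dx.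
Qed.

(** Stands for a bound on the number of edges, so that the induction hypothesis on this number can
    be used inside a partly undone move; closure under removal of edges is all that is required of
    it. *)
Variable reach_le : {set E} -> Prop.
Hypothesis IH : forall A r Wm Wr Ea Eb So St No Ac, reach_le A ->
  marking A r Wm Wr Ea Eb So St No Ac -> Eb != [::] -> reached A r Wm Wr Ea Eb So St No Ac.
Hypothesis reach_sub : forall A x, reach_le A -> reach_le (A :\ x).

Lemma reached_below A r Wm Wr Ea x Eb So St No Ac (mv : seq move) f g :
  marking A r Wm Wr Ea (x :: Eb) So St No Ac ->
  emb (M := map_of_moves mv) tl hd f g A r ->
  f (active (map_of_moves mv)) = Ac ->
  gd g (outer (map_of_moves mv)) \in outline Wm Wr Ea [::] [::] (x :: Eb) ->
  exists2 e, edge_below (map_of_moves mv) = Some e & g e = x.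
Proof.
move=> I em fa out; have [Wm' [Wr' [Ea' [Eb' [P]]]]] := mmark_moves mv.
case def_Eb': Eb' => [//|e t] _; exists e; first exact: (edge_belowE P def_Eb').
have he : head e = active (map_of_moves mv).
  by case: P => I' _ _; have := i_Eb I'; rewrite def_Eb' => -[].
have oute : dn (g e) \in outline Wm Wr Ea [::] [::] (x :: Eb).
  rewrite -(fconnect_cycle (co_cyc (i_core I)) out) -[dn (g e)]/(gd g (dn e)).
  rewrite (emb_face_connect em) -[fconnect _ _ _]/(on_outer (dn e)).
  by rewrite (on_outerE P) mem_outline def_Eb' mem_cat mem_head orbT.
rewrite mem_outline in oute.
by have [|t' [->]] := marking_below I oute _; rewrite ?(emb_hd em) ?he.
Qed.

Lemma reached_above A r Wm Wr Ea Eb So St No Ac (mv : seq move) f g :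
  marking A r Wm Wr Ea Eb So St No Ac ->
  emb (M := map_of_moves mv) tl hd f g A r ->
  f (active (map_of_moves mv)) = Ac ->
  gd g (outer (map_of_moves mv)) \in outline Wm Wr Ea [::] [::] Eb ->
  edge_above (map_of_moves mv) = None /\ Ea = [::] \/
  exists (e : edge (map_of_moves mv)) s,
    edge_above (map_of_moves mv) = Some e /\ Ea = rcons s (g e).
Proof.
move=> I em fa out.
have outE (e : edge (map_of_moves mv)) : east_edge e = (g e \in Ea ++ Eb).
  rewrite /east_edge /on_outer -(emb_face_connect em) (fconnect_cycle (co_cyc (i_core I)) out).
  by rewrite mem_outline.
rewrite /edge_above; case: pickP => [e|no].
  rewrite outE => /andP[eE /eqP te]; right.
  have [|s ->] := marking_above I eE; first by rewrite (emb_tl em) te.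
  by exists e, s.
case: (seq_last Ea) => [|[s [z def_Ea]]]; first by left.
have zE : z \in Ea by rewrite def_Ea mem_rcons mem_head.
have zA : z \in A by rewrite (sewing_sub I) // zE !orbT.
have [e ze] := emb_ex em zA; have := no e; rewrite outE -ze mem_cat zE /=.
have -> : tail e = active (map_of_moves mv); last by rewrite eqxx.
apply: (emb_f em); rewrite -(emb_tl em) -ze fa.
by have := i_Ea I; rewrite def_Ea => /dpath_rcons[].
Qed.

Lemma map_of_moves_rcons (mv : seq move) m :
  map_of_moves (rcons mv m) = apply_move (map_of_moves mv) m.
Proof. by rewrite /map_of_moves foldl_rcons. Qed.

(** The walked edges are undone from the last one. One outside [Wm] was merely walked along; one in
    [Wm] was added below the south pole and is deleted. When none remains, the state is a marking
    and the induction hypothesis applies. *)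
Lemma reach_walk n A r Wm Wr Ea Ew Eb So St No Ac B C c a :
  reach_le A -> size Ew = n ->
  sewing A r Wm Wr Ea [::] Ew Eb So St No Ac B C -> Ew ++ Eb != [::] ->
  ohead (downs Eb ++ ups (Wm ++ Wr)) = Some c ->
  ohead (downs (Ew ++ Eb)) = Some a ->
  exists (mv : seq move) (e : edge (map_of_moves mv)), edge_below (map_of_moves mv) = Some e /\
    placed (iter n walk_step (@Pointed (map_of_moves mv) (dn e) (dn e))) A r So St No Ac c a.
Proof.
elim: n A r Wm Wr Ea Ew Eb So St No Ac B C c a => [|n IHn]
    A r Wm Wr Ea Ew Eb So St No Ac B C c a leA.
  move/size0nil=> -> I /=; case def_Eb: Eb I => [//|x t] I _ [<-] [<-].
  have BAc : Ac = B := i_H I; have CAc : Ac = C := i_Ew I.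
  rewrite -BAc -CAc in I.
  have [mv [f [g [em mk fa out]]]] := IH leA I isT.
  have [e be ge] := reached_below I em fa out.
  exists mv, e; split=> //; exists f, g; split=> //; split=> //.
  - by have [? [? [? [? [[_ live _] _]]]]] := mmark_moves mv; apply: live.
  - by rewrite -ge.
  by rewrite -ge.
move=> szE I nE hc ha; case: (seq_last Ew) szE I nE ha => [->//|[Ew' [x ->]]].
rewrite size_rcons => -[szE] I nE ha; have ri := sewing_inj I.
have sub := sewing_sub I.
have xA : x \in A by rewrite sub // mem_rcons mem_head !orbT.
have [xW|xW] := boolP (x \in Wm); last first.
  have I' := bwd_walk I xW.
  have [|||mv [e [be [f [g [em mk fa [live fc fpa]]]]]]] :=
    IHn A r Wm Wr Ea Ew' (x :: Eb) So St No Ac B (hd x) (dn x) a leA szE I'.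
  - by case: (Ew').
  - by [].
  - by rewrite -cat_rcons.
  exists mv, e; split=> //; rewrite iterS; set p := iter n _ _ in em mk fa live fc fpa *.
  have [mS _ _] := mk.
  have -> : walk_step p = Pointed (face (pc p)) (pa p).
    rewrite /walk_step; case: eqP => // vS.
    have := congr1 f vS; rewrite -(emb_vt em) fc mS => hS.
    by have := i_So I xA; rewrite -hS eqxx.
  exists f, g; split=> //; split=> //=.
  rewrite -(emb_fc em) fc.
  have := co_cyc (i_core I); rewrite outline_nil.
  have -> : ups (Wm ++ Wr) ++ downs (Ea ++ rcons Ew' x ++ Eb) =
      (ups (Wm ++ Wr) ++ downs (Ea ++ Ew')) ++ (dn x :: downs Eb).
    by rewrite cat_rcons (catA Ea) (map_cat _ (Ea ++ Ew')) catA.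
  rewrite -(rot_cycle (size (ups (Wm ++ Wr) ++ downs (Ea ++ Ew')))) rot_size_cat.
  case: Eb hc {I I' nE ha sub} => [|y t] /=; last first.
    by move=> [<-] /andP[/eqP].
  by case: (ups (Wm ++ Wr)) => //= d t [<-] /andP[/eqP].
have [Eb0 Ew0 [Wm' def_Wm]] := walked_low I xW.
rewrite Eb0 def_Wm in I hc ha.
have [I' rx] := bwd_ext I Ew0.
have [w [Ws def_W]] : exists w Ws, Wm' ++ Wr = w :: Ws.
  by case: (Wm') (Wr) (i_Wr0 I) => [|w ?] [|w' ?] // _; do 2!eexists.
have rdx : r (dn x) = up w.
  have := co_cyc (i_core I); rewrite outline_nil cats0 cat_cons def_W /=.
  by case/andP=> /eqP.
have [|||mv [e [be [f [g [em mk fa [live fpc fpa]]]]]]] :=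
  IHn (A :\ x) (skip (dn x) r) Wm' Wr Ea Ew' [::] (hd x) St No Ac B (hd x) (up w) a
    (reach_sub x leA) szE I'.
- by rewrite cats0.
- by rewrite def_W.
- by case: (Ew') ha Ew0.
exists mv, e; split=> //; rewrite iterS; set p := iter n _ _ in em mk fa live fpc fpa *.
have [mS mSt mN] := mk.
have vw : vt (up w) = hd x.
  by rewrite -rdx (sewing_vt I).
have -> : walk_step p = @Pointed (@add_leaf (pm p) false (pc p) None (Some (north (pm p)))
    (Some (active (pm p)))) (None, true) (old (pa p)).
  rewrite /walk_step; case: eqP => // vS; case: vS; apply: (emb_f em).
  by rewrite -(emb_vt em) fpc mS vw.
have em' := emb_leaf ri xA None (Some (north (pm p))) (Some (active (pm p))) em
  (etrans rdx (esym fpc)) rx (sewing_vt I (xA : (dn x).1 \in A))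
  (emb_live_fresh em live I xA rx).
exists (ext_vertex f (vt (up x))), (ext_edge g x); split=> //=.
  by split=> //=; have [] := i_Wm I.
split=> //=.
  by move=> v; apply: leaf_live live.
by move: hc => /= [<-].
Qed.

Lemma reach_hang n A r Wm Wr Ea H Ew Eb So St No Ac B C c a :
  reach_le A -> size H = n ->
  sewing A r Wm Wr Ea H Ew Eb So St No Ac B C -> Ew != [::] ->
  ohead (downs Eb ++ ups (Wm ++ Wr)) = Some c ->
  ohead (ups (rev H) ++ downs (Ew ++ Eb)) = Some a ->
  exists (mv : seq move) (e : edge (map_of_moves mv)), edge_below (map_of_moves mv) = Some e /\
    placed (iter n hang_step
      (iter (size Ew) walk_step (@Pointed (map_of_moves mv) (dn e) (dn e)))) A r So St No Ac c a.
Proof.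
elim: n A r H B c a => [|n IHn] A r H B c a leA.
  move/size0nil=> -> I Ew0 hc ha; apply: reach_walk (I) _ hc ha => //.
  by case: (Ew) Ew0.
move=> szH I Ew0 hc ha; case: (seq_last H) szH I ha => [->//|[H' [x ->]]].
rewrite size_rcons => -[szH] I ha; have ri := sewing_inj I.
have xA : x \in A by rewrite (sewing_sub I) // mem_rcons mem_head !orbT.
have [I' rx] := bwd_hang I Ew0.
case def_a: (ups (rev H') ++ downs (Ew ++ Eb)) => [|d X].
  by case: (rev H') (Ew) Ew0 def_a => [|? ?] [|? ?].
have rdx := leaf_next I def_a.
have [|mv [e [be [f [g [em mk fa [live fpc fpa]]]]]]] :=
  IHn (A :\ x) (skip (dn x) r) H' (hd x) c d (reach_sub x leA) szH I' Ew0 hc.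
  by rewrite def_a.
exists mv, e; split=> //; rewrite iterS; set p := iter n _ _ in em mk fa live fpc fpa *.
have [mS mSt mN] := mk.
have em' := emb_leaf ri xA (Some (south (pm p))) (Some (north (pm p))) (Some (active (pm p))) em
  (etrans rdx (esym fpa)) rx (sewing_vt I (xA : (dn x).1 \in A))
  (emb_live_fresh em live I xA rx).
exists (ext_vertex f (vt (up x))), (ext_edge g x); split=> //=.
split=> //=.
  by move=> v; apply: leaf_live live.
by move: ha; rewrite rev_rcons /= => -[<-].
Qed.

End Reach.

Section Surjectivity.
Variables (V E : finType) (tl hd : E -> V).
Notation marking := (marking tl hd).
Implicit Types (A : {set E}) (r : E * bool -> E * bool).

(** Lexicographic induction on the two bounds: undoing [m_e] along a formerly missing edge lowers
    only the number of edges below the active vertex, and every other undoing lowers the number of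
    edges. *)
Lemma reach_all n m A r Wm Wr Ea Eb So St No Ac : #|A| <= n -> size Eb <= m ->
  marking A r Wm Wr Ea Eb So St No Ac -> Eb != [::] ->
  reached tl hd A r Wm Wr Ea Eb So St No Ac.
Proof.
elim: n m A r Wm Wr Ea Eb So St No Ac => [|n IHn].
  move=> m A r Wm Wr Ea Eb So St No Ac; rewrite leqn0 cards_eq0 => /eqP A0 _.
  case: Eb => // x Eb I _.
  have : x \in A by rewrite (sewing_sub I) // mem_head !orbT.
  by rewrite A0 inE.
elim=> [|m IHm] A r Wm Wr Ea Eb So St No Ac leA; first by rewrite leqn0 size_eq0 => /eqP->.
case: Eb => [//|x Eb] leE I _; have ri := sewing_inj I.
have xA : x \in A by rewrite (sewing_sub I) // mem_head !orbT.
have leAx : #|A :\ x| <= n by rewrite -ltnS (leq_trans _ leA) // [#|A|](cardsD1 x) xA.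
have [xW|xW] := boolP (x \in Wm ++ Wr).
  have [Ea0 [s def_Wr]] := bridge_top I xW; have [s0|s0] := eqVneq s [::].
    have def_Wr' : Wr = [:: x] by rewrite def_Wr s0.
    have [Wm0 Eb0 A1 rdx rux] := bridge_single I xW def_Wr'.
    have tl_hd : tl x != hd x.
      have [h [hA _]] := i_rank I; apply/eqP=> e; have := hA x xA; by rewrite e ltnn.
    have [tx hx] : tl x = St /\ hd x = No.
      by have := i_Wr I; rewrite def_Wr' => -[? /= ?].
    exists [::], (fun b : bool => if b then hd x else tl x), (fun=> x); split.
    - split=> //=.
      + by move=> [] [] //= e; move: tl_hd; rewrite e eqxx.
      + by move=> [] [].
      + move=> e; rewrite A1 inE; apply/eqP/codomP => [->|[? ->]//]; by exists tt.
      by case=> [[] []].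
    - split=> //=; rewrite tx; have := i_Wm I; by rewrite Wm0.
    - by case: (i_Eb I).
    by rewrite [_ \in _]mem_outline /= mem_cat mem_head orbT.
  rewrite def_Wr Ea0 in I *.
  have out1 := bridge_out I (erefl _) s0.
  have I' := bwd_top I s0 out1.
  case: Eb I I' out1 {leE} => [|y t] I I' out1.
    have := i_Eb I => -[_ /= tx]; case: (seq_last s) s0 I => [->//|[s' [z ->]]] _ I.
    have zA : z \in A by rewrite (sewing_sub I) // mem_rcons in_cons mem_rcons mem_head !orbT.
    have [/upath_rcons[_ hz] _] := (upath_rcons _ _ _ _ _ _).1 (i_Wr I).
    by have := i_So I zA; rewrite hz tx eqxx.
  have [mv [f [g [em mk fa out]]]] :
      reached tl hd (A :\ x) (skip (up x) r) Wm s [::] (y :: t) So St (tl x) (tl x).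
    exact: (IHn (size (y :: t))) I' _.
  have [e be ge] := reached_below I' em fa out.
  have [[ab _]|[e' [s' [_]]]] := reached_above I' em fa out; last by case: s'.
  have [? [? [? [? [[_ live _] _]]]]] := mmark_moves mv.
  have [/= hx _] := i_Eb I; have [_ hN] := (upath_rcons _ _ _ _ _ _).1 (i_Wr I).
  have [rux rdx] : r (up x) = dn y /\ r (dn x) = dn x.
    have := co_cyc (i_core I); rewrite outline_nil -rcons_cat map_rcons cat_rcons => cyc.
    split; last exact: fcycle_adjacent cyc.
    by move: cyc; rewrite -cat_rcons; apply: fcycle_adjacent.
  have em' := emb_leaf ri xA (Some (south (map_of_moves mv))) None None em
    (etrans rux (congr1 (fun z => dn z) (esym ge)) : r (x, true) = gd g (dn e))
    rdx (sewing_vt I (xA : (up x).1 \in A)) (emb_live_fresh em live I xA rdx).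
  exists (rcons mv MoveE); rewrite map_of_moves_rcons /apply_move ab be.
  exists (ext_vertex f (hd x)), (ext_edge g x); split=> //.
  - by case: mk => mS mSt mN; split; rewrite //= mS.
  by rewrite [_ \in _]mem_outline /= mem_head.
have [[[e eA re] Eb0]|[e eA re]] := no_bridge_ex I xW.
  have I' := bwd_set I eA re xW.
  have [mv [f [g [em mk fa out]]]] := IHm _ _ _ _ _ _ _ _ _ _ leA leE I' Eb0.
  have [[_ Ea0]|[e' [s [ab def_Ea]]]] := reached_above I' em fa out.
    by case: (Ea) Ea0.
  have [ge' _] : g e' = x /\ Ea = s by case/rcons_inj: def_Ea.
  exists (rcons mv MoveE); rewrite map_of_moves_rcons /apply_move ab; exists f, g; split=> //.
  - by case: em => *; split.
  - by rewrite /= -(emb_hd em) ge'; case: (i_Eb I).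
  by move: out; rewrite !outline_nil cat_rcons.
have [Ea' [H [Ew [T [def_Ea Ew0 cycI unI [pE pH pEw]]]]]] := face_cycle I xW eA re.
rewrite def_Ea in I.
have I' := bwd_chord I cycI unI xW Ew0 pE pH pEw.
case hc: (ohead (downs Eb ++ ups (Wm ++ Wr))) => [c|]; last first.
  by case: (Eb) (Wm) (Wr) (i_Wr0 I) hc => [|? ?] [|? ?] [|? ?].
case ha: (ohead (ups (rev H) ++ downs Ew)) => [a|]; last first.
  by case: (rev H) (Ew) Ew0 ha => [|? ?] [|? ?].
have ha' : ohead (ups (rev H) ++ downs (Ew ++ Eb)) = Some a.
  by move: ha; case: (rev H) (Ew) => [|? ?] [|? ?].
have rdx : r (dn x) = a.
  have := cycI; case def_a: (ups (rev H) ++ downs Ew) ha => [//|d X] [<-].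
  by case/andP => /eqP.
have rux : r (up x) = c.
  have := co_cyc (i_core I); rewrite outline_nil.
  have -> : ups (Wm ++ Wr) ++ downs ((Ea' ++ H) ++ [::] ++ x :: Eb) =
      (ups (Wm ++ Wr) ++ downs (Ea' ++ H)) ++ (dn x :: downs Eb).
    by rewrite (map_cat _ (Ea' ++ H)) catA.
  rewrite -(rot_cycle (size (ups (Wm ++ Wr) ++ downs (Ea' ++ H)))) rot_size_cat.
  rewrite cat_cons catA; case: (downs Eb ++ ups (Wm ++ Wr)) hc => //= d X [<-].
  by case/andP => /eqP.
have IHle (B : {set E}) r' (Wm' Wr' Ea'' Eb' : seq E) (So' St' No' Ac' : V) : #|B| <= n ->
    marking B r' Wm' Wr' Ea'' Eb' So' St' No' Ac' -> Eb' != [::] ->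
    reached tl hd B r' Wm' Wr' Ea'' Eb' So' St' No' Ac'.
  by move=> leB; apply: (IHn (size Eb')).
have suble (B : {set E}) y : #|B| <= n -> #|B :\ y| <= n.
  by apply: leq_trans; apply/subset_leq_card/subsetDl.
have [mv [e0 [be [f [g [em mk _ [live fc fpa]]]]]]] :=
  reach_hang (reach_le := fun B : {set E} => #|B| <= n) IHle suble leAx (erefl _) I' Ew0 hc ha'.
(* The west side has [i+1] edges, those of [Ew]; the east side has [j+1], namely [x] and the missing
   edges [H]. *)
exists (rcons mv (MoveF (size Ew).-1 (size H))); rewrite map_of_moves_rcons /apply_move be.
have szE : (size Ew).-1.+1 = size Ew by rewrite prednK // lt0n size_eq0.
suff K : exists f g, [/\ emb (M := sew_face (size Ew).-1.+1 (size H) (dn e0) (dn e0)) tl hd f g A r,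
    marks f So St No, f (active (sew_face (size Ew).-1.+1 (size H) (dn e0) (dn e0))) = Ac &
    gd g (outer (sew_face (size Ew).-1.+1 (size H) (dn e0) (dn e0))) \in
      outline Wm Wr Ea [::] [::] (x :: Eb)].
  by case: (edge_above (map_of_moves mv)) => [?|]; apply: K.
rewrite szE (sew_faceE _ _ (@Pointed (map_of_moves mv) (dn e0) (dn e0))) sew_eastE.
set p := iter (size H) _ _ in em mk live fc fpa *.
have em' := emb_chord ri xA em (etrans rux (esym fc)) (etrans rdx (esym fpa))
  (sewing_vt I (xA : (up x).1 \in A)) (sewing_vt I (xA : (dn x).1 \in A)).
exists f, (ext_edge g x); split=> //.
- rewrite /= -(emb_vt em) fpa -rdx (sewing_vt I) //.
  by case: (i_Eb I).
by rewrite [_ \in _]mem_outline /= mem_cat mem_head orbT.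
Qed.

End Surjectivity.

(** * Injectivity *)

Lemma sewing_last (V E : finType) (tl hd : E -> V) A r Wm Wr Ea H Ew l Eb So St No Ac B C c :
  sewing tl hd A r Wm Wr Ea H (rcons Ew l) Eb So St No Ac B C ->
  ohead (downs Eb ++ ups (Wm ++ Wr)) = Some c -> r (up l) = c.
Proof.
move=> I hc; have := co_cyc (i_core I); rewrite /outline cat_rcons.
set P := ups (Wm ++ Wr).
have -> : P ++ downs (Ea ++ H) ++ ups (rev H) ++ downs (Ew ++ l :: Eb) =
    (P ++ downs (Ea ++ H) ++ ups (rev H) ++ downs Ew) ++ (dn l :: downs Eb).
  by rewrite (map_cat _ Ew) -!catA.
rewrite -(rot_cycle (size (P ++ downs (Ea ++ H) ++ ups (rev H) ++ downs Ew))) rot_size_cat.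
rewrite cat_cons (catA (downs Eb)); case: (downs Eb ++ P) hc => //= d X [<-].
by case/andP => /eqP.
Qed.

(** The corners coincide before the walk starts and never after its first step, so their equality
    marks the start of the sewing of a face. *)
Lemma pstate_neq (p : pointed) Wm Wr Ea H Ew Eb B C :
  @pstate p Wm Wr Ea H Ew Eb B C -> Ew != [::] -> pc p != pa p.
Proof.
case=> -[I _ _] ha hc Ew0; apply/eqP=> e; rewrite -e in ha.
have [un1 un2 HW] := sewing_uniqs I.
have : pc p \in downs Eb ++ ups (Wm ++ Wr) by case: (_ ++ _) hc => // d X [->]; rewrite mem_head.
have : pc p \in ups (rev H) ++ downs Ew.
  by move: ha; rewrite map_cat catA; case: (rev H) (Ew) Ew0 => [|? ?] [|? ?] //= _ [<-]; rewrite mem_head.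
case: (pc p) => y []; rewrite !mem_cat !mem_ups !mem_downs ?orbF /=.
  by rewrite mem_rev => /HW; rewrite mem_cat => /negbTE->.
move=> yE yB; move: un2; rewrite catA cat_uniq => /and3P[_ _].
by rewrite cat_uniq => /and3P[_ /hasPn/(_ y yB)]; rewrite yE.
Qed.

Lemma rot_chord (N : map_data) (c a d : dart N) :
  rot d = c -> @rot (add_chord c a) (old d) = (None, true).
Proof. by case: d => y b rd; rewrite /= /insert_before /= rd eqxx None_old. Qed.

Section Injectivity.
Variables (V E : finType) (tl hd : E -> V).
Notation vt := (dart_vertex tl hd).

Definition pinned (p : pointed) (A : {set E}) r (So St No : V) c a : Prop :=
  exists f g, [/\ emb (M := pm p) tl hd f g A r, marks f So St No,
    gd g (pc p) = c & gd g (pa p) = a].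

(** The upper corner after a hanging step is the upward dart of the added edge, so both this edge
    and the previous corner are read off from [a] and [r]. *)
Lemma hang_back p A r So St No c a : pinned (hang_step p) A r So St No c a ->
  a = up a.1 /\ pinned p (A :\ a.1) (skip (dn a.1) r) So St No c (r (dn a.1)).
Proof.
case=> f [g [em [mS mSt mN] /= gc ga]]; rewrite -ga /=; split=> //.
have [em' rx] := @emb_unleaf (pm p) V E tl hd A r false (pa p) (Some (south (pm p)))
  (Some (north (pm p))) (Some (active (pm p))) f g em.
by exists (f \o Some), (g \o Some); split=> //; rewrite rx.
Qed.

(** The upper corner is upward after a hanging step and downward as long as nothing hangs, so its
    direction tells when all hanging steps are undone. *)
Lemma hang_inj j1 j2 p1 p2 A r So St No c a :
  ~~ (pa p1).2 -> ~~ (pa p2).2 -> injective r ->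
  pinned (iter j1 hang_step p1) A r So St No c a ->
  pinned (iter j2 hang_step p2) A r So St No c a ->
  j1 = j2 /\ exists A' r' c' a', [/\ injective r',
    pinned p1 A' r' So St No c' a' & pinned p2 A' r' So St No c' a'].
Proof.
move=> d1 d2; elim: j1 j2 A r c a => [|j1 IHj] [|j2] A r c a ri.
- by move=> P1 P2; split=> //; exists A, r, c, a.
- case=> f [g [_ _ _ <-]]; rewrite iterS => /hang_back[/(congr1 snd) /= e _].
  by rewrite e in d1.
- rewrite iterS => /hang_back[/(congr1 snd) /= e _] [f [g [_ _ _ ga]]].
  by rewrite -ga /= in e; rewrite e in d2.
rewrite !iterS => /hang_back[_ P1] /hang_back[_ P2].
have [|-> Q] := IHj _ _ _ _ _ _ P1 P2; last by [].
exact: skip_inj.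
Qed.

(** Both a walked and an added edge can lead to the corner [up x] at a south pole of degree one. The
    start vertex separates them: an added edge puts the pole strictly below the start, whereas
    walking down an existing edge to such a pole means that the start is the pole itself. *)
Lemma walk_back p Wm Wr Ea Ew Eb B C A r So St No c a : injective r ->
  @pstate p Wm Wr Ea [::] Ew Eb B C -> Ew ++ Eb != [::] ->
  pinned (walk_step p) A r So St No c a ->
  (exists x, [/\ pinned p A r So St No (dn x) a, fc r (dn x) = c & c = up x -> So = St]) \/
  (exists x, [/\ c = up x, r (up x) = up x, So <> St &
    pinned p (A :\ x) (skip (dn x) r) (hd x) St No (r (dn x)) a]).
Proof.
move=> ri; case: Eb => [|y Eb] Pp nE; last first.
  have [-> Pq] := pstate_walk Pp; have [_ _ [pcy]] := Pp.
  case=> f [g [em mk /= gc ga]]; left; exists (g y).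
  have em' : emb (M := pm p) tl hd f g A r by [].
  rewrite -pcy in gc; split=> //.
  - by exists f, g; rewrite -pcy.
  - by rewrite -gc -(emb_fc em).
  rewrite -gc => fy; have [[I _ _] _ hc] := Pq; rewrite /= -pcy in hc.
  have [[I0 _ _] _ _] := Pp.
  have {fy} fy : face (dn y) = up y by apply: (gd_inj em); rewrite fy.
  rewrite fy in hc; have [<- <- _] := mk; congr f.
  case: Eb hc {Pp Pq I nE} I0 => [|? ?] //= hc I0.
  have yW : y \notin Wm by apply/negP=> /(i_WE I0); rewrite mem_cat mem_head orbT.
  case: (Wm) hc yW (i_Wm I0) => [_ _ ->//|w Ws] /= [->].
  by rewrite mem_head.
rewrite cats0 in nE; have [-> Pq] := pstate_ext Pp nE.
have vS := pc_south Pp; rewrite eqxx in vS; move/eqP in vS.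
case=> f [g [em [mS mSt mN] /= gc ga]]; right; exists (g None).
have [em' rx] := @emb_unleaf (pm p) V E tl hd A r false (pc p) None
  (Some (north (pm p))) (Some (active (pm p))) f g em.
have rux : r (up (g None)) = up (g None).
  by have := emb_rot em (None, true); rewrite /= /insert_before.
split=> //; first by rewrite -mS -mSt => /(emb_f em).
exists (f \o Some), (g \o Some); split=> //.
by split=> //=; rewrite (emb_hd em) /= vS.
Qed.

Lemma walk_inj k1 k2 p1 p2 A r So St No c a :
  (exists Wm Wr Ea Eb B C, @pstate p1 Wm Wr Ea [::] [::] Eb B C /\ Eb != [::]) -> pc p1 = pa p1 ->
  (exists Wm Wr Ea Eb B C, @pstate p2 Wm Wr Ea [::] [::] Eb B C /\ Eb != [::]) -> pc p2 = pa p2 ->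
  injective r ->
  pinned (iter k1 walk_step p1) A r So St No c a ->
  pinned (iter k2 walk_step p2) A r So St No c a ->
  k1 = k2 /\ exists A' r' So' c' a', [/\ injective r',
    pinned p1 A' r' So' St No c' a' & pinned p2 A' r' So' St No c' a'].
Proof.
move=> st1 e1 st2 e2.
have step_neq k p (st : exists Wm Wr Ea Eb B C,
    @pstate p Wm Wr Ea [::] [::] Eb B C /\ Eb != [::]) : pc (iter k.+1 walk_step p) != pa (iter k.+1 walk_step p).
  case: st => [Wm [Wr [Ea [Eb [B [C [Pp nE]]]]]]].
  have [Wm' [Wr' [Ea' [Ew' [Eb' [B' [C' [Pk _ n]]]]]]]] := walk_iter k.+1 Pp nE.
  exact: pstate_neq Pk (n isT).
have back k p A0 r0 So0 c0 a0 (ri : injective r0) (st : exists Wm Wr Ea Eb B C,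
    @pstate p Wm Wr Ea [::] [::] Eb B C /\ Eb != [::])
    (P : pinned (iter k.+1 walk_step p) A0 r0 So0 St No c0 a0) :
    (exists x, [/\ pinned (iter k walk_step p) A0 r0 So0 St No (dn x) a0,
       fc r0 (dn x) = c0 & c0 = up x -> So0 = St]) \/
    (exists x, [/\ c0 = up x, r0 (up x) = up x, So0 <> St &
       pinned (iter k walk_step p) (A0 :\ x) (skip (dn x) r0) (hd x) St No (r0 (dn x)) a0]).
  case: st => [Wm [Wr [Ea [Eb [B [C [Pp nE]]]]]]].
  have [Wm' [Wr' [Ea' [Ew' [Eb' [B' [C' [Pk n _]]]]]]]] := walk_iter k Pp nE.
  exact: walk_back ri Pk n P.
elim: k1 k2 A r So c a => [|k1 IHk] [|k2] A r So c a ri.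
- by move=> P1 P2; split=> //; exists A, r, So, c, a.
- case=> f [g [_ _ <- <-]]; rewrite e1 => -[f' [g' [em' _ ec ea]]].
  by have := step_neq k2 _ st2; rewrite -(inj_eq (gd_inj em')) ec ea eqxx.
- move=> P1 [f [g [_ _ ec ea]]]; case: P1 => f' [g' [em' _ gc ga]].
  by have := step_neq k1 _ st1; rewrite -(inj_eq (gd_inj em')) gc ga -ec -ea e2 eqxx.
move=> P1 P2.
case: (back _ _ _ _ _ _ _ ri st1 P1) => [[x [Q1 fx cx]]|[x [cx rx SS Q1]]];
  case: (back _ _ _ _ _ _ _ ri st2 P2) => [[y [Q2 fy cy]]|[y [cy ry SS' Q2]]].
- have xy : dn x = dn y by apply: (fc_inj ri); rewrite fx fy.
  rewrite -xy in Q2; have [-> Q] := IHk _ _ _ _ _ _ ri Q1 Q2; by [].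
- have xy : dn x = dn y by apply: (fc_inj ri); rewrite fx cy -ry.
  by case: SS'; apply: cx; rewrite cy; case: xy => ->.
- have xy : dn x = dn y by apply: (fc_inj ri); rewrite fy cx -rx.
  by case: SS; apply: cy; rewrite cx; case: xy => ->.
have xy : x = y by move: cx; rewrite cy => -[].
rewrite -xy in Q2; have [|-> Q] := IHk _ _ _ _ _ _ _ Q1 Q2; last by [].
exact: skip_inj.
Qed.

(** The outer face is given by any of its darts [o], since an isomorphism preserves this face but
    not the chosen dart [outer]. *)
Definition conf (mv : seq move) (A : {set E}) r o (So St No Ac : V) : Prop :=
  exists f g, [/\ emb (M := map_of_moves mv) tl hd f g A r, marks f So St No,
    f (active (map_of_moves mv)) = Ac &
    fconnect (fc r) o (gd g (outer (map_of_moves mv)))].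

Lemma conf_marking mv A r o So St No Ac : injective r -> conf mv A r o So St No Ac ->
  exists Wm Wr Ea Eb, marking tl hd A r Wm Wr Ea Eb So St No Ac /\
    forall d, fconnect (fc r) o d = (d \in outline Wm Wr Ea [::] [::] Eb).
Proof.
move=> ri [f [g [em [<- <- <-] <- out]]].
have [Wm [Wr [Ea [Eb [[I _ outN] nE]]]]] := mmark_moves mv.
have I' := emb_sewing em ri I.
do 4!eexists; split; first exact: I'.
move=> d; rewrite (same_connect (fconnect_sym (fc_inj ri)) out).
apply: (fconnect_cycle (co_cyc (i_core I'))).
by have := map_f (gd g) outN; rewrite gd_outline.
Qed.

(** The three forms exclude each other by conditions on [r] and [o] at [x], and the configuration
    left in each is written in terms of the ambient data and [x] only. *)
Lemma last_move mv m A r o So St No Ac : injective r ->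
  conf (rcons mv m) A r o So St No Ac ->
  exists x, [/\ fconnect (fc r) o (dn x), hd x = Ac &
  [\/ [/\ m = MoveE, ~~ fconnect (fc r) o (up x), (exists e, r (dn e) = up x) &
        conf mv A r o So St No (tl x)],
      [/\ m = MoveE, fconnect (fc r) o (up x) &
        conf mv (A :\ x) (skip (up x) r) (r (up x)) So St (tl x) (tl x)] |
      exists i j, [/\ m = MoveF i j, ~~ fconnect (fc r) o (up x),
        (exists e, r (up e) = up x) &
        exists2 e : edge (map_of_moves mv), edge_below (map_of_moves mv) = Some e &
          pinned (iter j hang_step (iter i.+1 walk_step
              (@Pointed (map_of_moves mv) (dn e) (dn e))))
            (A :\ x) (skip (up x) (skip (dn x) r)) So St No (r (up x)) (r (dn x))]]].
Proof.
move=> ri; rewrite /conf map_of_moves_rcons.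
have [Wm [Wr [Ea [Eb [P nE]]]]] := mmark_moves mv.
set N := map_of_moves mv in P *.
case: Eb P nE => // y t P _; have be := edge_belowE P (erefl _).
have [I live outN] := P.
have hy : head y = active N by case: (i_Eb I).
have sym := fconnect_sym (fc_inj ri).
case: m => [|i j]; rewrite /apply_move be.
  have [[Ea0 ->]|[s [z [def_Ea ->]]]] := edge_aboveE P.
    case=> f [g [em [mS mSt mN] fa out]]; exists (g None).
    have [em' rx] := emb_unleaf em.
    split=> //; first by rewrite (emb_hd em).
    have tx : tl (g None) = f (Some (active N)) by rewrite (emb_tl em) /= /vert /= hy.
    apply: Or32; split=> //.
      apply: connect_trans out _; rewrite sym.
      have <- : fc r (up (g None)) = gd g (None, false).
        by rewrite -[up _]/(gd g (up None)) (emb_fc em) /face /= /insert_before /=.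
      exact: fconnect1.
    exists (f \o Some), (g \o Some); split=> //.
    - split=> //; rewrite tx /=; congr (f (Some _)).
      by have := i_Ea I; rewrite Ea0 => <-.
    rewrite rx (emb_face_connect em') fconnect_sym; last exact: fc_inj (sewing_inj I).
    by rewrite -[fconnect _ _ _]/(on_outer (dn y)) (on_outerE P) mem_outline mem_cat mem_head orbT.
  case=> f [g [em [mS mSt mN] fa out]]; exists (g z).
  have em' : emb (M := N) tl hd f g A r by case: em => *; split.
  have zE : z \in Ea by rewrite def_Ea mem_rcons mem_head.
  have outE d : fconnect (fc r) o (gd g d) = on_outer (d : dart N).
    by rewrite (same_connect sym out) (emb_face_connect em').
  split.
  - by rewrite -[dn _]/(gd g (dn z)) outE (on_outerE P) mem_outline mem_cat zE.
  - by rewrite (emb_hd em').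
  apply: Or31; split=> //.
  - rewrite -[up _]/(gd g (up z)) outE (on_outerE P) mem_outline cats0.
    exact: (i_EW I zE).
  - have [e _ re] := i_high I zE; exists (g e).
    by rewrite -[dn _]/(gd g (dn e)) (emb_rot em') re.
  exists f, g; split=> //; rewrite (emb_tl em'); congr f.
  by have := i_Ea I; rewrite def_Ea => /dpath_rcons[_ <-].
set Q := (X in _ -> X).
suff K : (exists f g, [/\ emb (M := sew_face i.+1 j (dn y) (dn y)) tl hd f g A r,
    marks f So St No, f (active (sew_face i.+1 j (dn y) (dn y))) = Ac &
    fconnect (fc r) o (gd g (outer (sew_face i.+1 j (dn y) (dn y))))]) -> Q.
  by case: (edge_above N) => [?|]; apply: K.
rewrite {}/Q (sew_faceE _ _ (@Pointed N (dn y) (dn y))) sew_eastE.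
have [Wm1 [Wr1 [Ea1 [Ew1 [Eb1 [B1 [C1 [P1 _ n1]]]]]]]] := walk_iter i.+1 (mmark_pstate P) isT.
have [Wm2 [Wr2 [Ea2 [H2 [Ew2 [Eb2 [B2 [C2 [P2 n2]]]]]]]]] := hang_iter j P1 (n1 isT).
have ca := pstate_neq P2 n2; have PX := mmark_chord P2 n2.
set p := iter j _ _ in P2 ca PX *.
case=> f [g [em [mS mSt mN] fa out]]; exists (g None).
have [em' rux rdx] := @emb_unchord (pm p) V E tl hd A r (pc p) (pa p) f g ca ri em.
split=> //; first by rewrite (emb_hd em).
apply: Or33; exists i, j; split=> //.
- rewrite (same_connect sym out) -[up _]/(gd g (up None)) (emb_face_connect em).
  rewrite -[fconnect _ _ _]/(@on_outer (add_chord (pc p) (pa p)) (None, true)) (on_outerE PX) mem_outline cats0 -map_cat.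
  by apply/mapP => -[].
- case: (seq_last Ew2) n2 => [->//|[s [l def_Ew]]] _.
  have [[I2 _ _] _ hc] := P2; rewrite def_Ew in I2.
  have rl := sewing_last I2 hc.
  exists (g (Some l)); rewrite -[up (g _)]/(gd g (up (Some l))) (emb_rot em).
  by rewrite (@rot_chord (pm p) (pc p) (pa p) (up l)).
exists y => //; exists f, (g \o Some).
by rewrite rux rdx.
Qed.

End Injectivity.

Section Unique.
Variables (V E : finType) (tl hd : E -> V).
Notation vt := (dart_vertex tl hd).
Notation conf := (conf tl hd).
Notation pinned := (pinned tl hd).

Lemma pinned_conf mv e A r So St No c a : edge_below (map_of_moves mv) = Some e ->
  injective r -> pinned (@Pointed (map_of_moves mv) (dn e) (dn e)) A r So St No c a ->
  conf mv A r a So St No (vt a).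
Proof.
move=> be ri [f [g [em mk _ ga]]]; exists f, g; rewrite /= in em mk ga.
have [oe he] : on_outer (dn e) /\ head e = active (map_of_moves mv).
  by move: be; rewrite /edge_below; case: pickP => // e' /andP[? /eqP ?] [<-].
split=> //; first by rewrite -he -ga (emb_vt em).
rewrite -ga (emb_face_connect em) fconnect_sym //.
have [Wm [Wr [Ea [Eb [[I _ _] _]]]]] := mmark_moves mv.
exact: fc_inj (sewing_inj I).
Qed.

Lemma conf_head mv A r o So St No Ac x y : injective r -> conf mv A r o So St No Ac ->
  fconnect (fc r) o (dn x) -> hd x = Ac -> fconnect (fc r) o (dn y) -> hd y = Ac ->
  x = y /\ x \in A.
Proof.
move=> ri cf; have [Wm [Wr [Ea [Eb [I out]]]]] := conf_marking ri cf.
rewrite !out => xO hx yO hy; split; last exact: (co_sub (i_core I) xO).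
rewrite !mem_outline in xO yO.
have [s def_Eb] := marking_below I xO hx; have [t] := marking_below I yO hy.
by rewrite def_Eb => -[].
Qed.

(** In a single edge both darts are fixed by the rotation, so no downward dart precedes [up x]; and
    nothing is left when [x] is deleted. Each form of a last move is thus excluded. *)
Lemma conf_nil mv m A r o So St No Ac : injective r ->
  conf [::] A r o So St No Ac -> conf (rcons mv m) A r o So St No Ac -> False.
Proof.
move=> ri [f [g [em _ _ _]]] cf.
have [x [xO hx K]] := last_move ri cf.
have [_ xA] := conf_head ri cf xO hx xO hx.
have only e : e \in A -> e = x.
  by have [[] ->] := emb_ex em xA => /(emb_ex em)[[] ->].
have empty (N : map_data) f' g' r' : emb (M := N) tl hd f' g' (A :\ x) r' -> False.
  move=> em'; have := emb_mem em' (outer N).1; rewrite in_setD1 => /andP[/eqP ne /only].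
  exact: ne.
have rx b : r (x, b) = (x, b).
  by have [[] ->] := emb_ex em xA; apply: (emb_rot em (tt, b)).
case: K => [[_ _ [e re] _]|[_ _ [f' [g' [em' _ _ _]]]]|[i [j [_ _ _ [e _]]]]].
- by have := ri _ _ (etrans re (esym (rx true))).
- exact: empty em'.
by case=> f' [g' [em' _ _ _]]; apply: empty em'.
Qed.

Lemma walked_dn (p : pointed) Wm Wr Ea Ew Eb B C :
  @pstate p Wm Wr Ea [::] Ew Eb B C -> ~~ (pa p).2.
Proof. by case=> _ + _ /=; case: (Ew ++ Eb) => //= y s [<-]. Qed.

(** Induction on the sequences, removing last moves. All data vary except [St]: no move changes the
    start vertex. *)
Lemma conf_inj mv1 mv2 A r o So St No Ac : injective r ->
  conf mv1 A r o So St No Ac -> conf mv2 A r o So St No Ac -> mv1 = mv2.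
Proof.
elim/last_ind: mv1 mv2 A r o So No Ac => [|mv1 m1 IH] mv2 A r o So No Ac ri;
  case/lastP: mv2 => [|mv2 m2] //.
- by move=> c1 c2; case: (conf_nil ri c1 c2).
- by move=> c1 c2; case: (conf_nil ri c2 c1).
move=> c1 c2; have [x [xO hx K1]] := last_move ri c1; have [y [yO hy]] := last_move ri c2.
have [<- xA] := conf_head ri c1 xO hx yO hy => K2 {y yO hy c1 c2}.
case: K1 => [[-> nx [e re] d1]|[-> ux d1]|[i1 [j1 [-> nx [e re] [e1 be1 p1]]]]];
  case: K2 => [[-> nx' [e' re'] d2]|[-> ux' d2]|[i2 [j2 [-> nx' [e' re'] [e2 be2 p2]]]]].
- by rewrite (IH _ _ _ _ _ _ _ ri d1 d2).
- by rewrite ux' in nx.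
- by have := ri _ _ (etrans re (esym re')).
- by rewrite ux in nx'.
- by rewrite (IH _ _ _ _ _ _ _ _ d1 d2) //; apply: skip_inj.
- by rewrite ux in nx'.
- by have := ri _ _ (etrans re' (esym re)).
- by rewrite ux' in nx.
have st mv f : edge_below (map_of_moves mv) = Some f -> exists Wm Wr Ea Eb B C,
    @pstate (@Pointed (map_of_moves mv) (dn f) (dn f)) Wm Wr Ea [::] [::] Eb B C /\ Eb != [::].
  move=> be; have [Wm [Wr [Ea [Eb [P nE]]]]] := mmark_moves mv.
  case: Eb P nE => // z t P _.
  have := edge_belowE P (erefl _); rewrite be => -[fz]; rewrite fz.
  by do 6!eexists; split; [exact: mmark_pstate P|].
have down mv f k : edge_below (map_of_moves mv) = Some f ->
    ~~ (pa (iter k walk_step (@Pointed (map_of_moves mv) (dn f) (dn f)))).2.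
  move=> /st[Wm [Wr [Ea [Eb [B [C [P nE]]]]]]].
  have [? [? [? [? [? [? [? [Pk _ _]]]]]]]] := walk_iter k P nE.
  exact: walked_dn Pk.
have ri' : injective (skip (up x) (skip (dn x) r)) by do 2!apply: skip_inj.
have [<- [A1 [r1 [c1 [a1 [ri1 q1 q2]]]]]] := hang_inj (down _ _ i1.+1 be1) (down _ _ i2.+1 be2) ri' p1 p2.
have [[<-] [A2 [r2 [So2 [c2 [a2 [ri2 s1 s2]]]]]]] :=
  walk_inj (st _ _ be1) erefl (st _ _ be2) erefl ri1 q1 q2.
by rewrite (IH _ _ _ _ _ _ _ ri2 (pinned_conf be1 ri2 s1) (pinned_conf be2 ri2 s2)).
Qed.

End Unique.

Theorem theorem1 :
  [/\ (forall s : seq move, marked_bipolar (map_of_moves s)),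
      (forall s1 s2 : seq move,
         isomorphic (map_of_moves s1) (map_of_moves s2) -> s1 = s2) &
      (forall M : map_data, marked_bipolar M ->
         exists s : seq move, isomorphic (map_of_moves s) M)].
Proof.
split.
- move=> s; have [Wm [Wr [Ea [Eb [P nE]]]]] := mmark_moves s.
  exact: mmark_marked P nE.
- move=> s1 s2 [f [g [[[f' fK f'K] [g' gK g'K]] [tE hE] rE oE [sE nE stE aE]]]].
  have [Wm [Wr [Ea [Eb [[I _ _] _]]]]] := mmark_moves s2.
  (* The map of [s2] is the common ambient map: [s1] is placed in it by the isomorphism and [s2] by
     the identity. *)
  apply: (@conf_inj _ _ (@tail (map_of_moves s2)) (@head (map_of_moves s2)) s1 s2 setT
    (@rot (map_of_moves s2)) (outer (map_of_moves s2)) (south (map_of_moves s2))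
    (start (map_of_moves s2)) (north (map_of_moves s2)) (active (map_of_moves s2))).
  + exact: sewing_inj I.
  + exists f, g; split=> //; split=> //; try exact: (can_inj fK); try exact: (can_inj gK).
    by move=> e; rewrite in_setT; apply/esym/codomP; exists (g' e); rewrite g'K.
  exists id, id; split=> //; last by rewrite /gd -surjective_pairing connect0.
  split=> //; first by move=> e; rewrite in_setT; apply/esym/codomP; exists e.
  by move=> d; rewrite /gd -!surjective_pairing.
move=> M K; have [Wm [Wr [Ea [Eb [P nE]]]]] := marked_mmark K.
have [I live out] := P.
have [s [f [g [em [mS mSt mN] mA mO]]]] := reach_all (leqnn _) (leqnn _) I nE.
exists s, f, g; split=> //.
- have gb : bijective g.
    have gs e : exists x, e == g x by have [x ->] := emb_ex em (in_setT e); exists x.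
    exists (fun e => xchoose (gs e)) => [x|e].
      by apply: (emb_g em); rewrite -(eqP (xchooseP (gs (g x)))).
    by rewrite -(eqP (xchooseP (gs e))).
  split=> //; case: gb => g' gK g'K.
  (* Every vertex of [M] carries a dart, so surjectivity on edges passes to vertices. *)
  have fs v : exists u, v == f u.
    have [d <-] := live v; exists (vert (g' d.1, d.2)).
    by rewrite -(emb_vt em) /gd /= g'K -surjective_pairing.
  exists (fun v => xchoose (fs v)) => [u|v].
    by apply: (emb_f em); rewrite -(eqP (xchooseP (fs (f u)))).
  by rewrite -(eqP (xchooseP (fs v))).
- by split=> x; [rewrite (emb_tl em)|rewrite (emb_hd em)].
- by move=> d; rewrite -[RHS](emb_rot em).
by rewrite (on_outerE P).
Qed.
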